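(* Let $\varphi\in C^1(\Gamma)$ (complex-valued), and let $$v(x)=\int_\Gamma\Phi(x,y)\,\varphi(y)\,ds_y,\qquad x\in\mathbb{R}^2\setminus\Gamma,$$ be the single layer potential with density $\varphi$. Then the gradient $\nabla v$ can be continuously extended from $\Omega$ to $\bar\Omega$ and from $\mathbb{R}^2\setminus\bar\Omega$ to $\mathbb{R}^2\setminus\Omega$, respectively, with the limiting values $$\nabla v_\pm(x)=\int_\Gamma\nabla_x\Phi(x,y)\,\varphi(y)\,ds_y\mp\frac12\varphi(x)\,e_{\nu(x)},\qquad x\in\Gamma,$$ where $\nabla v_\pm(x)=\lim_{h>0,\,h\to0}\nabla v(x\pm h\nu(x))$, the integral is understood as a Cauchy principal value, and $$e_{\nu(x)}=\frac{\nu(x)}{\nu(x)\cdot\tilde\nu(x)}.$$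
   Context: Let $k_0>0$ be the free-space wavenumber and let $\varepsilon_1,\varepsilon_2\in\mathbb{C}$ be constants with $\mathrm{Re}\,\varepsilon_1\cdot\mathrm{Re}\,\varepsilon_2<0$ and $\mathrm{Im}\,\varepsilon_j>0$ for $j=1,2$ (lossy hyperbolic medium). Put $A=\mathrm{diag}(1/\varepsilon_1,1/\varepsilon_2)$. The square root $\sqrt z=|z|^{1/2}e^{\frac12 i\arg z}$ is the analytic branch on $\mathbb{C}\setminus\{-it: t\ge0\}$, i.e. $\arg z\in(-\pi/2,3\pi/2)$. Set $$\tilde r(x,y)=\sqrt{(x-y)^TA^{-1}(x-y)}=\sqrt{\varepsilon_1(x_1-y_1)^2+\varepsilon_2(x_2-y_2)^2},$$ $$\Phi(x,y)=\frac{i}{4}\sqrt{\varepsilon_1\varepsilon_2}\,H_0^{(1)}(k_0\tilde r(x,y)),\qquad x\ne y,$$ where $H_0^{(1)}$ is the Hankel function of the first kind of order zero. $\Phi$ is the outgoing fundamental solution of $\nabla\cdot(A\nabla u)+k_0^2u=0$. $\Omega\subset\mathbb{R}^2$ is a bounded simply connected domain with boundary $\Gamma$ of class $C^2$; $\nu$ is the unit normal on $\Gamma$ pointing out of $\Omega$; $\tilde\nu=A\nu$. The dot product is bilinear (no complex conjugation), so $\nu\cdot\tilde\nu=\nu_1^2/\varepsilon_1+\nu_2^2/\varepsilon_2$. $ds$ is arc length on $\Gamma$. The Cauchy principal value at $x\in\Gamma$ is the limit as $\delta\to0^+$ of the integral over $\{y\in\Gamma:|y-x|>\delta\}$. *)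

(* Defs.v *)
(* Classical reals of the standard library, with Coquelicot.  Points of the
   plane are pairs of reals; complex vectors (gradients of complex-valued
   functions) are pairs of complex numbers. *)
From Stdlib Require Import Reals Factorial.
From Coquelicot Require Import Coquelicot.
Open Scope R_scope.

(** * Euclidean plane *)

Definition dot2 (x y : R * R) : R := fst x * fst y + snd x * snd y.
Definition norm2 (x : R * R) : R := sqrt (dot2 x x).
Definition sub2 (x y : R * R) : R * R := (fst x - fst y, snd x - snd y).
(* x + h n *)
Definition shift (x : R * R) (h : R) (n : R * R) : R * R :=
  (fst x + h * fst n, snd x + h * snd n).

(** * Topology of the plane *)

Definition closure2 (D : R * R -> Prop) (x : R * R) : Prop :=
  forall e : posreal, exists y : R * R, ball x e y /\ D y.

Definition frontier (D : R * R -> Prop) (x : R * R) : Prop :=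
  closure2 D x /\ closure2 (fun y => ~ D y) x.

Definition bounded2 (D : R * R -> Prop) : Prop :=
  exists M : R, forall x, D x -> norm2 x <= M.

Definition connected2 (D : R * R -> Prop) : Prop :=
  forall U V : R * R -> Prop, open U -> open V ->
    (forall x, D x -> U x \/ V x) ->
    (exists x, D x /\ U x) -> (exists x, D x /\ V x) ->
    exists x, D x /\ U x /\ V x.

Definition unit_interval (t : R) : Prop := 0 <= t <= 1.
Definition unit_square (p : R * R) : Prop :=
  unit_interval (fst p) /\ unit_interval (snd p).

Definition loops_contractible (D : R * R -> Prop) : Prop :=
  forall c : R -> R * R,
    continuous_on unit_interval c ->
    (forall t, unit_interval t -> D (c t)) ->
    c 0 = c 1 ->
    exists H : R * R -> R * R,
      continuous_on unit_square H /\
      (forall p, unit_square p -> D (H p)) /\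
      (forall t, unit_interval t -> H (t, 0) = c t) /\
      (forall t, unit_interval t -> H (t, 1) = H (0, 1)) /\
      (forall s, unit_interval s -> H (0, s) = H (1, s)).

Definition bounded_simply_connected_domain (D : R * R -> Prop) : Prop :=
  (exists x, D x) /\ open D /\ connected2 D /\ bounded2 D /\
  loops_contractible D.

(** * Closed curves of class C^2 *)

Definition class_C1 {V : NormedModule R_AbsRing} (f : R -> V) : Prop :=
  exists f' : R -> V,
    (forall t, is_derive f t (f' t)) /\ (forall t, continuous f' t).

Definition class_C2 {V : NormedModule R_AbsRing} (f : R -> V) : Prop :=
  exists f' : R -> V, (forall t, is_derive f t (f' t)) /\ class_C1 f'.

Definition velocity (gamma : R -> R * R) (t : R) : R * R :=
  (Derive (fun s => fst (gamma s)) t, Derive (fun s => snd (gamma s)) t).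

Definition speed (gamma : R -> R * R) (t : R) : R := norm2 (velocity gamma t).

(* gamma is a T-periodic regular C^2 parametrization, without
   self-intersections, of the closed curve G. *)
Definition C2_closed_curve (G : R * R -> Prop) (gamma : R -> R * R) (T : R)
  : Prop :=
  0 < T /\
  class_C2 (V := prod_NormedModule R_AbsRing R_NormedModule R_NormedModule)
    gamma /\
  (forall t, gamma (t + T) = gamma t) /\
  (forall s t, 0 <= s < T -> 0 <= t < T -> gamma s = gamma t -> s = t) /\
  (forall t, velocity gamma t <> (0, 0)) /\
  (forall x, G x <-> exists t, gamma t = x).

Definition C1_on_curve (gamma : R -> R * R) (phi : R * R -> C) : Prop :=
  class_C1 (V := C_R_NormedModule) (fun t => phi (gamma t)).

Definition outward_unit_normal
  (Omega : R * R -> Prop) (gamma : R -> R * R) (x n : R * R) : Prop :=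
  norm2 n = 1 /\
  (forall t, gamma t = x -> dot2 n (velocity gamma t) = 0) /\
  (exists h0, 0 < h0 /\ forall h, 0 < h < h0 ->
     Omega (shift x (- h) n) /\ ~ closure2 Omega (shift x h n)).

(** * Integrals with respect to arc length *)

Definition curve_integrand (gamma : R -> R * R) (f : R * R -> C) (t : R) : C :=
  (f (gamma t) * RtoC (speed gamma t))%C.

Definition curve_RInt (gamma : R -> R * R) (T : R) (f : R * R -> C) : C :=
  @RInt C_R_CompleteNormedModule (curve_integrand gamma f) 0 T.

Definition cut_off (x : R * R) (delta : R) (f : R * R -> C) (y : R * R) : C :=
  if Rlt_dec delta (norm2 (sub2 y x)) then f y else RtoC 0.

(* The truncated integrals are only required to exist for small delta. *)
Definition is_principal_value
  (gamma : R -> R * R) (T : R) (f : R * R -> C) (x : R * R) (l : C) : Prop :=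
  exists J : R -> C,
    at_right 0 (fun delta =>
      @is_RInt C_R_NormedModule
        (curve_integrand gamma (cut_off x delta f)) 0 T (J delta)) /\
    filterlim J (at_right 0) (locally l).

(** * Gradients of complex-valued functions of two real variables *)

Definition Derive_RC (f : R -> C) (t : R) : C :=
  (Derive (fun s => Re (f s)) t, Derive (fun s => Im (f s)) t).

Definition grad (f : R * R -> C) (x : R * R) : C * C :=
  (Derive_RC (fun s => f (s, snd x)) (fst x),
   Derive_RC (fun s => f (fst x, s)) (snd x)).

(* Real (Frechet) differentiability *)
Definition differentiable_at (f : R * R -> C) (x : R * R) : Prop :=
  @ex_filterdiff R_AbsRing
    (prod_NormedModule R_AbsRing R_NormedModule R_NormedModule)
    C_R_NormedModule f (locally x).

(** * Square root, logarithm, Hankel function *)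

(* Principal argument, in (-PI, PI] *)
Definition Arg (z : C) : R :=
  if Rle_dec 0 (Im z) then acos (Re z / Cmod z) else - acos (Re z / Cmod z).

Definition Clog (z : C) : C := (ln (Cmod z), Arg z).

(* Argument cut along {- i t : t >= 0}, with values in (-PI/2, 3PI/2) off the
   cut: the principal argument of z / i = - i z, turned by PI/2. *)
Definition arg_cut (z : C) : R := Arg (- Ci * z)%C + PI / 2.

Definition sqrt_cut (z : C) : C :=
  (sqrt (Cmod z) * cos (arg_cut z / 2), sqrt (Cmod z) * sin (arg_cut z / 2)).

Definition CSeries (a : nat -> C) : C :=
  (Series (fun n => Re (a n)), Series (fun n => Im (a n))).

Definition harmonic (n : nat) : R := sum_n_m (fun k => / INR k) 1 n.

Definition Euler_gamma : R :=
  real (Lim_seq (fun n => harmonic n - ln (INR n))).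

Definition BesselJ0 (z : C) : C :=
  CSeries (fun k =>
    RtoC ((-1) ^ k / INR (fact k) ^ 2) * Cpow (z / RtoC 2) (2 * k))%C.

(* The k = 0 term of the series vanishes since harmonic 0 = 0. *)
Definition BesselY0 (z : C) : C :=
  (RtoC (2 / PI) * (Clog (z / RtoC 2) + RtoC Euler_gamma) * BesselJ0 z
   - RtoC (2 / PI) * CSeries (fun k =>
       RtoC ((-1) ^ k * harmonic k / INR (fact k) ^ 2)
       * Cpow (z / RtoC 2) (2 * k)))%C.

Definition Hankel1_0 (z : C) : C := (BesselJ0 z + Ci * BesselY0 z)%C.

(** * Fundamental solution and single layer potential *)

Definition r_tilde (eps1 eps2 : C) (x y : R * R) : C :=
  sqrt_cut (eps1 * RtoC ((fst x - fst y) ^ 2)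
            + eps2 * RtoC ((snd x - snd y) ^ 2))%C.

Definition Phi (k0 : R) (eps1 eps2 : C) (x y : R * R) : C :=
  (Ci / RtoC 4 * sqrt_cut (eps1 * eps2)
   * Hankel1_0 (RtoC k0 * r_tilde eps1 eps2 x y))%C.

Definition single_layer (k0 : R) (eps1 eps2 : C)
  (gamma : R -> R * R) (T : R) (phi : R * R -> C) (x : R * R) : C :=
  curve_RInt gamma T (fun y => Phi k0 eps1 eps2 x y * phi y)%C.

(* A n with A = diag (1 / eps1, 1 / eps2) *)
Definition conormal (eps1 eps2 : C) (n : R * R) : C * C :=
  (RtoC (fst n) / eps1, RtoC (snd n) / eps2)%C.

(* bilinear, without conjugation *)
Definition dotC (n : R * R) (w : C * C) : C :=
  (RtoC (fst n) * fst w + RtoC (snd n) * snd w)%C.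

Definition e_vec (eps1 eps2 : C) (n : R * R) : C * C :=
  (RtoC (fst n) / dotC n (conormal eps1 eps2 n),
   RtoC (snd n) / dotC n (conormal eps1 eps2 n))%C.

Definition addC2 (u w : C * C) : C * C := (fst u + fst w, snd u + snd w)%C.
Definition scalC2 (a : C) (w : C * C) : C * C := (a * fst w, a * snd w)%C.

(* g is the principal value, at x, of the integral over y of
   grad_x Phi (x, y) phi (y). *)
Definition is_pv_grad_single_layer (k0 : R) (eps1 eps2 : C)
  (gamma : R -> R * R) (T : R) (phi : R * R -> C)
  (x : R * R) (g : C * C) : Prop :=
  is_principal_value gamma T
    (fun y => fst (grad (fun z => Phi k0 eps1 eps2 z y) x) * phi y)%C
    x (fst g) /\
  is_principal_value gamma T
    (fun y => snd (grad (fun z => Phi k0 eps1 eps2 z y) x) * phi y)%C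
    x (snd g).

(* Main.v *)
(* Near the curve the gradient of the fundamental solution is a combination of
   two Cauchy kernels plus a bounded remainder: [Q(X) = eps1 X1^2 + eps2 X2^2]
   factors into two real-linear maps [L+, L- : R^2 -> C], each an isomorphism,
   and [grad log Q = grad L+ / L+ + grad L- / L-].  Writing a point near the
   curve as [gamma t + h N t] and subtracting the kernel of the tangent line,
   frozen at [t], leaves an integrand that is bounded uniformly in [(t, h)] and
   continuous off the diagonal, so its integral converges as [h -> 0] to a value
   that is also the principal value on the curve.  The tangent-line integral is
   [int du / (u - r)] over a segment symmetric about [0], with [r = O(h)]; it
   tends to [+- i PI] according to the side from which [r] reaches the real axis.
   The two resulting jumps, added up, give the stated one. *)
From Stdlib Require Import Reals Ranalysis5 ZArith Lra Lia ClassicalEpsilon.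
From Coquelicot Require Import Coquelicot.
Require Import Defs.
Open Scope R_scope.

(** Positive imaginary parts send every nonzero X to Q(X) in the upper half plane, although the real
    part of Q is indefinite. There root and logarithm are smooth with explicit formulas, and |Q(X)|
    is comparable with |X|^2. Apart from a logarithm the Hankel series is even, so the kernel is a
    function of Q alone. The opposite signs of the real parts enter through sqrt(eps1 eps2) =
    sqrt(eps1) sqrt(eps2), which holds for this branch and fixes the constant in front of the
    singularity. L+ and L- have determinants of opposite sign, so r reaches the real axis from
    opposite sides for the two of them. Two mismatches shape the estimates. The principal value
    removes a Euclidean disc, whereas the tangent-line kernel is odd in the parameter; the two
    parameter lengths removed differ by O(d^2), so the logarithm of their ratio is O(d). And limits
    along normals do not give a continuous extension: all limits are proved locally uniformly in t,
    and the nearest point on the curve supplies the coordinates (t, h). *)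

Lemma norm2_Cmod (x : R * R) : norm2 x = Cmod x.
Proof. unfold norm2, dot2, Cmod. f_equal. ring. Qed.

Lemma Cmod_le_abs (z : C) : Cmod z <= Rabs (fst z) + Rabs (snd z).
Proof.
  destruct z as [a b].
  replace (a, b) with (RtoC a + RtoC b * Ci)%C
    by (unfold RtoC, Ci, Cmult, Cplus; simpl; f_equal; ring).
  eapply Rle_trans. apply Cmod_triangle.
  rewrite Cmod_mult, Cmod_Ci, !Cmod_R. simpl.
  apply Req_le. rewrite Rmult_1_r. f_equal; f_equal; ring.
Qed.

Lemma fst_le_Cmod (z : C) : Rabs (fst z) <= Cmod z.
Proof. eapply Rle_trans; [apply Rmax_l | apply Rmax_Cmod]. Qed.

Lemma snd_le_Cmod (z : C) : Rabs (snd z) <= Cmod z.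
Proof. eapply Rle_trans; [apply Rmax_r | apply Rmax_Cmod]. Qed.

Lemma Cmod_triangle_rev (x y : C) : Cmod x - Cmod y <= Cmod (x - y).
Proof.
  assert (H := Cmod_triangle (x - y) y).
  replace (x - y + y)%C with x in H by ring. lra.
Qed.

Lemma Cmod_minus_sym (x y : C) : Cmod (x - y) = Cmod (y - x).
Proof. rewrite <- Cmod_opp. f_equal. ring. Qed.

Lemma C_ball_Cmod (x y : C) (e : R) : Cmod (y - x) < e -> ball x e y.
Proof.
  intros H. split; unfold ball; simpl; unfold AbsRing_ball, abs, minus, plus, opp; simpl.
  - eapply Rle_lt_trans; [apply (fst_le_Cmod (y - x)) | exact H].
  - eapply Rle_lt_trans; [apply (snd_le_Cmod (y - x)) | exact H].
Qed.

(** Balls of [C] are sup-norm balls of the product, so passing to the modulus costs a factor 2; many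
    radii below are halved for this reason. *)
Lemma Cmod_C_ball (x y : C) (e : R) : ball x e y -> Cmod (y - x) < 2 * e.
Proof.
  intros [H1 H2]. unfold ball in H1, H2; simpl in H1, H2;
    unfold AbsRing_ball, abs, minus, plus, opp in H1, H2; simpl in H1, H2.
  eapply Rle_lt_trans; [apply Cmod_le_abs|]. simpl.
  unfold Rminus in *. lra.
Qed.

(** * Limits and continuity of complex-valued functions in terms of the modulus *)

Lemma filterlim_Cmod {T : Type} (F : (T -> Prop) -> Prop) {FF : Filter F}
  (f : T -> C) (l : C) :
  filterlim f F (locally l) <-> forall e, 0 < e -> F (fun y => Cmod (f y - l) < e).
Proof.
  split.
  - intros H e He.
    assert (He2 : 0 < e / 2) by lra.
    generalize (proj1 (filterlim_locally f l) H (mkposreal _ He2)).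
    apply filter_imp. intros y Hy. apply Cmod_C_ball in Hy. simpl in Hy. lra.
  - intros H. apply filterlim_locally. intros e.
    generalize (H e (cond_pos e)). apply filter_imp.
    intros y. apply C_ball_Cmod.
Qed.

Lemma continuous_Cmod_lt {U : UniformSpace} (f : U -> C) (x : U) :
  continuous f x <-> forall e, 0 < e -> locally x (fun y => Cmod (f y - f x) < e).
Proof. apply filterlim_Cmod. apply _. Qed.

Lemma continuous_Re {U : UniformSpace} (f : U -> C) (x : U) :
  continuous f x -> continuous (fun y => fst (f y)) x.
Proof. intros H. apply (continuous_comp f fst); auto. apply continuous_fst. Qed.

Lemma continuous_Im {U : UniformSpace} (f : U -> C) (x : U) :
  continuous f x -> continuous (fun y => snd (f y)) x.
Proof. intros H. apply (continuous_comp f snd); auto. apply continuous_snd. Qed.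

Lemma continuous_C {U : UniformSpace} (f : U -> C) (x : U) :
  continuous (fun y => fst (f y)) x -> continuous (fun y => snd (f y)) x ->
  continuous f x.
Proof.
  intros H1 H2.
  apply continuous_ext with (fun y => (fst (f y), snd (f y))).
  - intros y. now destruct (f y).
  - apply (continuous_comp_2 (fun y => fst (f y)) (fun y => snd (f y)) (fun a b => (a, b))); auto.
    apply continuous_ext with (fun p => p); [now intros [? ?]|apply continuous_id].
Qed.

Lemma continuous_Rmult {U : UniformSpace} (f g : U -> R) (x : U) :
  continuous f x -> continuous g x -> continuous (fun y => f y * g y) x.
Proof. intros Hf Hg. apply (continuous_mult (K := R_AbsRing) f g x); auto. Qed.

Lemma continuous_Rplus {U : UniformSpace} (f g : U -> R) (x : U) :
  continuous f x -> continuous g x -> continuous (fun y => f y + g y) x.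
Proof. intros Hf Hg. apply (continuous_plus (V := R_NormedModule) f g x); auto. Qed.

Lemma continuous_sqr {U : UniformSpace} (f : U -> R) (x : U) :
  continuous f x -> continuous (fun y => f y ^ 2) x.
Proof.
  intros Hf. simpl. apply continuous_Rmult; auto.
  apply continuous_Rmult; auto. apply continuous_const.
Qed.

Lemma continuous_Ropp {U : UniformSpace} (f : U -> R) (x : U) :
  continuous f x -> continuous (fun y => - f y) x.
Proof. intros Hf. apply (continuous_opp (V := R_NormedModule) f x); auto. Qed.

Lemma continuous_Rminus {U : UniformSpace} (f g : U -> R) (x : U) :
  continuous f x -> continuous g x -> continuous (fun y => f y - g y) x.
Proof. intros Hf Hg. apply (continuous_minus (V := R_NormedModule) f g x); auto. Qed.

Lemma continuous_Rcomp {U : UniformSpace} (f : U -> R) (g : R -> R) (x : U) :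
  continuous f x -> continuity_pt g (f x) -> continuous (fun y => g (f y)) x.
Proof.
  intros Hf Hg. apply (continuous_comp f g); auto.
  now apply continuity_pt_filterlim.
Qed.

Lemma continuous_inv_fun {U : UniformSpace} (f : U -> R) (x : U) :
  continuous f x -> f x <> 0 -> continuous (fun y => / f y) x.
Proof.
  intros Hf H0. apply (continuous_Rcomp f Rinv); auto.
  apply (continuity_pt_inv (fun x => x)); auto. apply continuity_pt_id.
Qed.

Lemma continuous_Cplus {U : UniformSpace} (f g : U -> C) (x : U) :
  continuous f x -> continuous g x -> continuous (fun y => f y + g y)%C x.
Proof.
  intros Hf Hg. apply continuous_C; simpl; apply continuous_Rplus;
    auto using continuous_Re, continuous_Im.
Qed.

Lemma continuous_Copp {U : UniformSpace} (f : U -> C) (x : U) :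
  continuous f x -> continuous (fun y => - f y)%C x.
Proof.
  intros Hf. apply continuous_C; simpl; apply continuous_Ropp;
    auto using continuous_Re, continuous_Im.
Qed.

Lemma continuous_Cminus {U : UniformSpace} (f g : U -> C) (x : U) :
  continuous f x -> continuous g x -> continuous (fun y => f y - g y)%C x.
Proof. intros Hf Hg. apply continuous_Cplus; auto using continuous_Copp. Qed.

Lemma continuous_Cmult {U : UniformSpace} (f g : U -> C) (x : U) :
  continuous f x -> continuous g x -> continuous (fun y => f y * g y)%C x.
Proof.
  intros Hf Hg. apply continuous_C; simpl;
    [apply continuous_Rminus | apply continuous_Rplus]; apply continuous_Rmult;
    auto using continuous_Re, continuous_Im.
Qed.

Lemma continuous_RtoC {U : UniformSpace} (f : U -> R) (x : U) :
  continuous f x -> continuous (fun y => RtoC (f y)) x.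
Proof. intros Hf. apply continuous_C; simpl; auto. apply continuous_const. Qed.

Lemma C_neq_0_sqr (z : C) : z <> 0 -> fst z ^ 2 + snd z ^ 2 <> 0.
Proof.
  intros Hz H. apply Hz. destruct z as [a b]; simpl in *.
  assert (a = 0) by nra. assert (b = 0) by nra. now subst.
Qed.

Lemma continuous_Cinv {U : UniformSpace} (f : U -> C) (x : U) :
  continuous f x -> f x <> 0 -> continuous (fun y => / f y)%C x.
Proof.
  intros Hf H0. apply C_neq_0_sqr in H0.
  assert (HR := continuous_Re _ _ Hf). assert (HI := continuous_Im _ _ Hf).
  assert (Hd : continuous (fun y => / (fst (f y) ^ 2 + snd (f y) ^ 2)) x).
  { apply continuous_inv_fun; auto.
    apply continuous_Rplus; now apply continuous_sqr. }
  apply continuous_C; simpl; apply continuous_Rmult; auto.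
  now apply continuous_Ropp.
Qed.

Lemma continuous_Cdiv {U : UniformSpace} (f g : U -> C) (x : U) :
  continuous f x -> continuous g x -> g x <> 0 -> continuous (fun y => f y / g y)%C x.
Proof. intros. apply continuous_Cmult; auto. now apply continuous_Cinv. Qed.

Lemma continuous_Cmod {U : UniformSpace} (f : U -> C) (x : U) :
  continuous f x -> continuous (fun y => Cmod (f y)) x.
Proof.
  intros Hf. unfold Cmod. apply (continuous_Rcomp (fun y => fst (f y) ^ 2 + snd (f y) ^ 2) sqrt).
  - apply continuous_Rplus; apply continuous_sqr.
    + now apply continuous_Re.
    + now apply continuous_Im.
  - apply continuity_pt_sqrt. nra.
Qed.

(** Descends through the arithmetic structure of the function; what remains are continuity goals for
    opaque subterms and the nonvanishing of denominators. *)
Ltac prove_continuous :=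
  repeat match goal with
  | H : continuous ?f ?x |- continuous ?f ?x => exact H
  | |- continuous (fun _ => ?c) ?x => apply continuous_const
  | |- continuous (fun y => y) ?x => apply continuous_id
  | |- continuous (fun y => fst y) ?x => apply continuous_fst
  | |- continuous (fun y => snd y) ?x => apply continuous_snd
  | |- continuous (fun y => Cplus (@?f y) (@?g y)) ?x => apply (continuous_Cplus f g x)
  | |- continuous (fun y => Cminus (@?f y) (@?g y)) ?x => apply (continuous_Cminus f g x)
  | |- continuous (fun y => Cmult (@?f y) (@?g y)) ?x => apply (continuous_Cmult f g x)
  | |- continuous (fun y => Cdiv (@?f y) (@?g y)) ?x => apply (continuous_Cdiv f g x)
  | |- continuous (fun y => Copp (@?f y)) ?x => apply (continuous_Copp f x)
  | |- continuous (fun y => RtoC (@?f y)) ?x => apply (continuous_RtoC f x)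
  | |- continuous (fun y => Cmod (@?f y)) ?x => apply (continuous_Cmod f x)
  | |- continuous (fun y => Rplus (@?f y) (@?g y)) ?x => apply (continuous_Rplus f g x)
  | |- continuous (fun y => Rminus (@?f y) (@?g y)) ?x => apply (continuous_Rminus f g x)
  | |- continuous (fun y => Rmult (@?f y) (@?g y)) ?x => apply (continuous_Rmult f g x)
  | |- continuous (fun y => Rdiv (@?f y) (@?g y)) ?x =>
      apply (continuous_Rmult f (fun y => / g y) x)
  | |- continuous (fun y => Rinv (@?f y)) ?x => apply (continuous_inv_fun f x)
  | |- continuous (fun y => Ropp (@?f y)) ?x => apply (continuous_Ropp f x)
  | |- continuous (fun y => pow (@?f y) 2) ?x => apply (continuous_sqr f x)
  | |- continuous (fun y => fst (@?f y)) ?x =>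
      apply (continuous_comp f fst x); [|apply continuous_fst]
  | |- continuous (fun y => snd (@?f y)) ?x =>
      apply (continuous_comp f snd x); [|apply continuous_snd]
  | H : forall s, continuous ?h s |- continuous ?h ?x => apply H
  | H : forall s, continuous ?h s |- continuous (fun y => ?h (@?f y)) ?x =>
      apply (continuous_comp f h x); [|apply H]
  end.

(** * Complex-valued integrals *)

Notation is_CInt := (@is_RInt C_R_NormedModule).
Notation ex_CInt := (@ex_RInt C_R_NormedModule).
Notation CInt := (@RInt C_R_CompleteNormedModule).

Lemma CInt_correct (f : R -> C) (a b : R) : ex_CInt f a b -> is_CInt f a b (CInt f a b).
Proof. apply (@RInt_correct C_R_CompleteNormedModule). Qed.

Lemma CInt_unique (f : R -> C) (a b : R) (l : C) : is_CInt f a b l -> CInt f a b = l.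
Proof. apply (@is_RInt_unique C_R_CompleteNormedModule). Qed.

Lemma ex_CInt_cont (f : R -> C) (a b : R) :
  a <= b -> (forall s, a <= s <= b -> continuous f s) -> ex_CInt f a b.
Proof.
  intros Hab H. apply (@ex_RInt_continuous C_R_CompleteNormedModule).
  intros z. rewrite Rmin_left, Rmax_right by lra. apply H.
Qed.

Lemma is_CInt_plus (f g : R -> C) (a b : R) (lf lg : C) :
  is_CInt f a b lf -> is_CInt g a b lg ->
  is_CInt (fun t => f t + g t)%C a b (lf + lg)%C.
Proof. apply (@is_RInt_plus C_R_NormedModule). Qed.

Lemma is_CInt_minus (f g : R -> C) (a b : R) (lf lg : C) :
  is_CInt f a b lf -> is_CInt g a b lg ->
  is_CInt (fun t => f t - g t)%C a b (lf - lg)%C.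
Proof. apply (@is_RInt_minus C_R_NormedModule). Qed.

Lemma is_CInt_scal (f : R -> C) (a b : R) (c lf : C) :
  is_CInt f a b lf -> is_CInt (fun t => c * f t)%C a b (c * lf)%C.
Proof.
  intros H.
  assert (H1 := is_RInt_fct_extend_fst (U := R_NormedModule) (V := R_NormedModule) _ _ _ _ H).
  assert (H2 := is_RInt_fct_extend_snd (U := R_NormedModule) (V := R_NormedModule) _ _ _ _ H).
  apply (is_RInt_fct_extend_pair (U := R_NormedModule) (V := R_NormedModule)); simpl.
  - apply (@is_RInt_minus R_NormedModule); apply (@is_RInt_scal R_NormedModule); auto.
  - apply (@is_RInt_plus R_NormedModule); apply (@is_RInt_scal R_NormedModule); auto.
Qed.

Lemma is_CInt_bound (f : R -> C) (a b M : R) (l : C) :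
  a <= b -> (forall t, a <= t <= b -> Cmod (f t) <= M) -> is_CInt f a b l ->
  Cmod l <= (b - a) * M.
Proof.
  intros Hab HM Hl. rewrite Cmod_norm.
  apply (@norm_RInt_le_const C_R_NormedModule f a b l M Hab); auto.
  intros x Hx. specialize (HM x Hx). rewrite Cmod_norm in HM. exact HM.
Qed.

Lemma is_CInt_Chasles (f : R -> C) (a b c : R) (l1 l2 : C) :
  is_CInt f a b l1 -> is_CInt f b c l2 -> is_CInt f a c (l1 + l2)%C.
Proof. apply (@is_RInt_Chasles C_R_NormedModule). Qed.

Lemma is_CInt_ext (f g : R -> C) (a b : R) (l : C) :
  a <= b -> (forall x, a < x < b -> f x = g x) -> is_CInt f a b l -> is_CInt g a b l.
Proof.
  intros Hab H. apply is_RInt_ext. intros x.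
  rewrite Rmin_left, Rmax_right by lra. apply H.
Qed.

Lemma is_CInt_translate (f : R -> C) (a b v : R) (l : C) :
  is_CInt f (a + v) (b + v) l -> is_CInt (fun y => f (y + v)) a b l.
Proof.
  intros H.
  apply is_RInt_ext with (fun y => scal 1 (f (1 * y + v))).
  { intros x _. rewrite (scal_one (V := C_R_NormedModule)). f_equal. ring. }
  apply (@is_RInt_comp_lin C_R_NormedModule).
  now rewrite !Rmult_1_l.
Qed.

(** * Compactness *)

(** Read [A y e] as: the scale [e] works at [y]. Scales that work locally are turned into a gauge by
    choice; a gauge bounded below on a cover of [[a, b]] yields one scale for all points.
    [compactness_value_1d] gives this only under a double negation, which is removed classically. *)
Lemma compact_uniform (a b : R) (A : R -> R -> Prop) :
  (forall y e e', A y e -> 0 < e' <= e -> A y e') ->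
  (forall x, a <= x <= b -> exists e, 0 < e /\
     forall y, a <= y <= b -> Rabs (y - x) < e -> A y e) ->
  exists e, 0 < e /\ forall y, a <= y <= b -> A y e.
Proof.
  intros Hmon Hloc.
  assert (Hch : forall x : R, {e : posreal | a <= x <= b ->
     forall y, a <= y <= b -> Rabs (y - x) < e -> A y e}).
  { intros x. apply constructive_indefinite_description.
    destruct (classic (a <= x <= b)) as [Hx|Hx].
    - destruct (Hloc x Hx) as [e [He H]]. exists (mkposreal e He). auto.
    - exists (mkposreal 1 Rlt_0_1). tauto. }
  destruct (compactness_value_1d a b (fun x => proj1_sig (Hch x))) as [d Hd].
  exists d. split. apply cond_pos.
  intros y Hy. apply NNPP. intros HA.
  apply (Hd y Hy). intros [t [Ht [H1 H2]]]. apply HA.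
  apply Hmon with (pos (proj1_sig (Hch t))).
  - apply (proj2_sig (Hch t)); auto.
  - split; auto. apply cond_pos.
Qed.

(** Tube lemma: continuity along a compact slice is uniform over the slice. The parameter [p] will
    be the pair [(t, h)] of normal coordinates, or a field point off the curve. *)
Lemma tube {U : UniformSpace} (a b : R) (H : R -> U -> C) (p0 : U) :
  (forall s, a <= s <= b ->
     continuous (fun q : R * U => H (fst q) (snd q)) (s, p0)) ->
  forall e, 0 < e -> exists d, 0 < d /\
    forall s, a <= s <= b -> forall p, ball p0 d p -> Cmod (H s p - H s p0) < e.
Proof.
  intros Hc e He.
  apply (compact_uniform a b
    (fun s d => forall p, ball p0 d p -> Cmod (H s p - H s p0) < e)).
  - intros y d d' HA Hd p Hp. apply HA. now apply ball_le with d'.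
  - intros x Hx. assert (He2 : 0 < e / 2) by lra.
    destruct (proj1 (continuous_Cmod_lt _ _) (Hc x Hx) _ He2) as [d Hd].
    exists d. split; [apply cond_pos|].
    intros y Hy Hyx p Hp. simpl in Hd.
    assert (H1 : Cmod (H y p - H x p0) < e / 2).
    { apply (Hd (y, p)). split; auto. }
    assert (H2 : Cmod (H y p0 - H x p0) < e / 2).
    { apply (Hd (y, p0)). split; auto. apply ball_center. }
    replace (H y p - H y p0)%C with ((H y p - H x p0) - (H y p0 - H x p0))%C by ring.
    eapply Rle_lt_trans. apply Cmod_triangle. rewrite Cmod_opp. lra.
Qed.

(** * Entire series with rapidly decreasing real coefficients *)

Definition summable (u : nat -> C) : Prop :=
  exists b : nat -> R, ex_series b /\ forall n, Cmod (u n) <= b n.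

Lemma summable_Re (u : nat -> C) : summable u -> ex_series (fun n => Re (u n)).
Proof.
  intros [b [Hb H]]. apply (ex_series_le (V := R_CompleteNormedModule) _ b); auto.
  intros n. eapply Rle_trans; [apply fst_le_Cmod | apply H].
Qed.

Lemma summable_Im (u : nat -> C) : summable u -> ex_series (fun n => Im (u n)).
Proof.
  intros [b [Hb H]]. apply (ex_series_le (V := R_CompleteNormedModule) _ b); auto.
  intros n. eapply Rle_trans; [apply snd_le_Cmod | apply H].
Qed.

Lemma summable_minus (u v : nat -> C) :
  summable u -> summable v -> summable (fun n => u n - v n)%C.
Proof.
  intros [b [Hb H]] [b' [Hb' H']]. exists (fun n => b n + b' n). split.
  - now apply (ex_series_plus (V := R_NormedModule)).
  - intros n. eapply Rle_trans. apply Cmod_triangle. rewrite Cmod_opp.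
    specialize (H n); specialize (H' n); lra.
Qed.

Lemma ex_series_Rscal (c : R) (b : nat -> R) :
  ex_series b -> ex_series (fun n => c * b n).
Proof. intros Hb. apply (ex_series_scal (V := R_NormedModule) c b Hb). Qed.

Lemma summable_scal (c : C) (u : nat -> C) :
  summable u -> summable (fun n => c * u n)%C.
Proof.
  intros [b [Hb H]]. exists (fun n => Cmod c * b n). split.
  - now apply ex_series_Rscal.
  - intros n. rewrite Cmod_mult. apply Rmult_le_compat_l; auto. apply Cmod_ge_0.
Qed.

Lemma CSeries_ext (u v : nat -> C) : (forall n, u n = v n) -> CSeries u = CSeries v.
Proof. intros H. unfold CSeries. f_equal; apply Series_ext; intros n; now rewrite H. Qed.

Lemma CSeries_minus (u v : nat -> C) :
  summable u -> summable v ->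
  CSeries (fun n => u n - v n)%C = (CSeries u - CSeries v)%C.
Proof.
  intros Hu Hv. unfold CSeries, Cminus, Cplus, Copp; simpl. f_equal.
  - apply (Series_minus (fun n => Re (u n)) (fun n => Re (v n))); now apply summable_Re.
  - apply (Series_minus (fun n => Im (u n)) (fun n => Im (v n))); now apply summable_Im.
Qed.

Lemma CSeries_scal (c : C) (u : nat -> C) :
  summable u -> CSeries (fun n => c * u n)%C = (c * CSeries u)%C.
Proof.
  intros Hu. assert (Hr := summable_Re _ Hu). assert (Hi := summable_Im _ Hu).
  unfold CSeries, Cmult; simpl. f_equal.
  - rewrite <- !Series_scal_l.
    apply (Series_minus (fun n => fst c * Re (u n)) (fun n => snd c * Im (u n)));
      now apply ex_series_Rscal.
  - rewrite <- !Series_scal_l.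
    apply (Series_plus (fun n => fst c * Im (u n)) (fun n => snd c * Re (u n)));
      now apply ex_series_Rscal.
Qed.

(** Real and imaginary parts are summed separately, whence the factor 2. *)
Lemma CSeries_bound (u : nat -> C) (b : nat -> R) :
  ex_series b -> (forall n, Cmod (u n) <= b n) -> Cmod (CSeries u) <= 2 * Series b.
Proof.
  intros Hb H. eapply Rle_trans. apply Cmod_le_abs.
  assert (Haux : forall c : nat -> R, (forall n, Rabs (c n) <= b n) ->
            Rabs (Series c) <= Series b).
  { intros c Hc.
    assert (He : ex_series (fun n => Rabs (c n))).
    { apply (ex_series_le (V := R_CompleteNormedModule) _ b); auto.
      intros n. unfold norm; simpl; unfold abs; simpl. now rewrite Rabs_Rabsolu. }
    eapply Rle_trans. apply Series_Rabs; auto.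
    apply Series_le; auto. intros n. split; auto. apply Rabs_pos. }
  assert (H1 := Haux (fun n => Re (u n)) (fun n => Rle_trans _ _ _ (fst_le_Cmod _) (H n))).
  assert (H2 := Haux (fun n => Im (u n)) (fun n => Rle_trans _ _ _ (snd_le_Cmod _) (H n))).
  unfold CSeries; simpl. lra.
Qed.

Lemma CSeries_shift (u : nat -> C) :
  summable u -> u O = 0%C -> CSeries u = CSeries (fun n => u (S n)).
Proof.
  intros Hu H0. unfold CSeries. f_equal.
  - rewrite Series_incr_1 by now apply summable_Re. rewrite H0. simpl. ring.
  - rewrite Series_incr_1 by now apply summable_Im. rewrite H0. simpl. ring.
Qed.

(** A class containing both series in the Hankel function and stable under termwise differentiation,
    because (n + 1) / (n + 1)! = 1 / n!. *)
Definition fact_bounded (a : nat -> R) : Prop := forall n, Rabs (a n) <= / INR (fact n).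

Definition entire (a : nat -> R) (w : C) : C := CSeries (fun n => RtoC (a n) * Cpow w n)%C.

Definition dcoef (a : nat -> R) (n : nat) : R := INR (S n) * a (S n).

Lemma fact_bounded_dcoef (a : nat -> R) : fact_bounded a -> fact_bounded (dcoef a).
Proof.
  intros Ha n. unfold dcoef. rewrite Rabs_mult, (Rabs_pos_eq (INR (S n))) by apply pos_INR.
  specialize (Ha (S n)). rewrite fact_simpl, mult_INR in Ha.
  assert (0 < INR (S n)) by (apply lt_0_INR; lia).
  apply Rmult_le_reg_l with (/ INR (S n)). now apply Rinv_0_lt_compat.
  rewrite <- Rmult_assoc, Rinv_l, Rmult_1_l by lra.
  rewrite <- Rinv_mult. exact Ha.
Qed.

Lemma ex_series_exp (r : R) : ex_series (fun n => r ^ n * / INR (fact n)).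
Proof.
  exists (exp r). generalize (is_exp_Reals r). unfold is_pseries.
  apply is_series_ext. intros n. rewrite pow_n_pow. reflexivity.
Qed.

Lemma INR_sqr_le_pow4 (n : nat) : INR n * INR n <= 4 ^ n.
Proof.
  assert (H : INR n <= 2 ^ n).
  { induction n as [|n IH]; [simpl; lra|].
    rewrite S_INR. simpl. assert (1 <= 2 ^ n) by (apply pow_R1_Rle; lra). lra. }
  replace 4 with (2 * 2) by ring. rewrite Rpow_mult_distr.
  apply Rmult_le_compat; auto; apply pos_INR.
Qed.

Lemma INR_le_pow4 (n : nat) : INR n <= 4 ^ n.
Proof.
  induction n as [|n IH]; [simpl; lra|].
  rewrite S_INR. simpl. assert (1 <= 4 ^ n) by (apply pow_R1_Rle; lra). lra.
Qed.

Lemma summable_entire (a : nat -> R) (w : C) :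
  fact_bounded a -> summable (fun n => RtoC (a n) * Cpow w n)%C.
Proof.
  intros Ha. exists (fun n => Cmod w ^ n * / INR (fact n)). split.
  - apply ex_series_exp.
  - intros n. rewrite Cmod_mult, Cmod_R, Cmod_pow, Rmult_comm.
    apply Rmult_le_compat_l; auto. apply pow_le, Cmod_ge_0.
Qed.

(** The remainders satisfy R(n + 1) = w' R(n) + n w^(n - 1) (w' - w)^2. With [1 <= rho] lower powers
    of [rho] may be raised to the exponent that the induction needs. *)
Lemma Cpow_taylor_bound (rho : R) (w w' : C) (n : nat) :
  1 <= rho -> Cmod w <= rho -> Cmod w' <= rho ->
  Cmod (Cpow w' n - Cpow w n - RtoC (INR n) * Cpow w (pred n) * (w' - w))%C
    <= INR n * INR n * rho ^ n * Cmod (w' - w) ^ 2.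
Proof.
  intros Hr Hw Hw'. induction n as [|n IH].
  - simpl. replace (_ - _ - _)%C with (RtoC 0) by ring.
    rewrite Cmod_0. lra.
  - destruct n as [|n].
    + simpl. replace (_ - _ - _)%C with (RtoC 0) by ring.
      rewrite Cmod_0. nra.
    + set (m := S n) in *.
      replace (Cpow w' (S m) - Cpow w (S m) - RtoC (INR (S m)) * Cpow w (pred (S m)) * (w' - w))%C
        with (w' * (Cpow w' m - Cpow w m - RtoC (INR m) * Cpow w (pred m) * (w' - w))
              + RtoC (INR m) * Cpow w (pred m) * ((w' - w) * (w' - w)))%C.
      2:{ rewrite (S_INR m), RtoC_plus. unfold m. simpl pred. simpl Cpow. ring. }
      eapply Rle_trans. apply Cmod_triangle.
      rewrite !Cmod_mult, Cmod_R, Cmod_pow, (Rabs_pos_eq (INR m)) by apply pos_INR.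
      set (d := Cmod (w' - w)) in *.
      assert (Hp : Cmod w ^ pred m <= rho ^ S m).
      { apply Rle_trans with (rho ^ pred m).
        - apply pow_incr. split; auto. apply Cmod_ge_0.
        - apply Rle_pow; auto. lia. }
      assert (H0 : 0 <= INR m) by apply pos_INR.
      apply Rle_trans with (rho * (INR m * INR m * rho ^ m * d ^ 2) + INR m * rho ^ S m * (d * d)).
      * apply Rplus_le_compat.
        -- apply Rmult_le_compat; [apply Cmod_ge_0 | apply Cmod_ge_0 | exact Hw' | exact IH].
        -- apply Rmult_le_compat_r; [nra|]. now apply Rmult_le_compat_l.
      * clearbody m. rewrite (S_INR m). change (rho ^ S m) with (rho * rho ^ m).
        assert (0 <= rho ^ m) by (apply pow_le; lra).
        assert (0 <= rho * rho ^ m * (d * d)) by (apply Rmult_le_pos; nra).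
        assert (Hx : 0 <= (INR m + 1) * (rho * rho ^ m * (d * d))) by (apply Rmult_le_pos; lra).
        apply Rminus_le_0. eapply Rle_trans; [exact Hx|]. apply Req_le. ring.
Qed.

(* The factor [4 ^ n] absorbs the [n ^ 2] of the termwise Taylor remainder. *)
Lemma entire_taylor (a : nat -> R) (rho : R) :
  fact_bounded a -> exists M, 0 < M /\ forall w w' : C,
    Cmod w <= rho -> Cmod w' <= rho ->
    Cmod (entire a w' - entire a w - entire (dcoef a) w * (w' - w))%C
      <= M * Cmod (w' - w) ^ 2.
Proof.
  (* [r] is at least 1, as the bound on powers requires; 2 comes from [CSeries_bound], and the
     exponential is the sum of (4 r)^n / n!. *)
  intros Ha. set (r := Rmax 1 rho). exists (2 * exp (4 * r)).
  split. { assert (H := exp_pos (4 * r)). lra. }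
  intros w w' Hw Hw'.
  assert (Hr : 1 <= r) by apply Rmax_l.
  assert (Hw1 : Cmod w <= r) by (eapply Rle_trans; [exact Hw | apply Rmax_r]).
  assert (Hw2 : Cmod w' <= r) by (eapply Rle_trans; [exact Hw' | apply Rmax_r]).
  assert (Hs := summable_entire a w Ha). assert (Hs' := summable_entire a w' Ha).
  (* The derivative series indexed like the original one. Its term of index 0 vanishes, so shifting
     by one gives [entire (dcoef a)]. *)
  set (v := fun n => (RtoC (a n * INR n) * Cpow w (pred n))%C).
  assert (Hv : summable v).
  { exists (fun n => (4 * r) ^ n * / INR (fact n)). split; [apply ex_series_exp|].
    intros n. unfold v. rewrite Cmod_mult, Cmod_R, Cmod_pow, Rabs_mult.
    rewrite (Rabs_pos_eq (INR n)) by apply pos_INR. rewrite Rpow_mult_distr.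
    assert (Hp : Cmod w ^ pred n <= r ^ n).
    { apply Rle_trans with (r ^ pred n).
      - apply pow_incr. split; auto. apply Cmod_ge_0.
      - apply Rle_pow; auto. lia. }
    replace (4 ^ n * r ^ n * / INR (fact n)) with (/ INR (fact n) * 4 ^ n * r ^ n) by ring.
    apply Rmult_le_compat; auto.
    - apply Rmult_le_pos; [apply Rabs_pos | apply pos_INR].
    - apply pow_le, Cmod_ge_0.
    - apply Rmult_le_compat; auto using Rabs_pos, pos_INR, INR_le_pow4. }
  assert (Hd : entire (dcoef a) w = CSeries v).
  { rewrite CSeries_shift; auto.
    - apply CSeries_ext. intros n. unfold v, dcoef. simpl pred. f_equal. f_equal. ring.
    - unfold v. simpl INR. rewrite Rmult_0_r. ring. }
  rewrite Hd, (Cmult_comm (CSeries v)).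
  unfold entire. rewrite <- CSeries_scal, <- !CSeries_minus; auto;
    try (apply summable_minus; auto); try (apply summable_scal; auto).
  eapply Rle_trans.
  - apply (CSeries_bound _ (fun n => Cmod (w' - w) ^ 2 * ((4 * r) ^ n * / INR (fact n)))).
    + apply ex_series_Rscal, ex_series_exp.
    + intros n. unfold v.
      replace (_ - _ - _)%C with
        (RtoC (a n) * (Cpow w' n - Cpow w n - RtoC (INR n) * Cpow w (pred n) * (w' - w)))%C
        by (rewrite RtoC_mult; ring).
      rewrite Cmod_mult, Cmod_R.
      assert (Hb := Cpow_taylor_bound r w w' n Hr Hw1 Hw2).
      assert (H4 := INR_sqr_le_pow4 n).
      rewrite Rpow_mult_distr.
      replace (Cmod (w' - w) ^ 2 * (4 ^ n * r ^ n * / INR (fact n)))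
        with (/ INR (fact n) * (4 ^ n * r ^ n * Cmod (w' - w) ^ 2)) by ring.
      apply Rmult_le_compat; auto using Rabs_pos, Cmod_ge_0.
      eapply Rle_trans; [exact Hb|].
      apply Rmult_le_compat_r; [apply pow2_ge_0|].
      apply Rmult_le_compat_r; [apply pow_le; lra | auto].
  - rewrite Series_scal_l. apply Req_le.
    assert (He : Series (fun n => (4 * r) ^ n * / INR (fact n)) = exp (4 * r)).
    { apply is_series_unique. generalize (is_exp_Reals (4 * r)). unfold is_pseries.
      apply is_series_ext. intros n. rewrite pow_n_pow. reflexivity. }
    rewrite He. ring.
Qed.

(** The Taylor bound reduces the claim to a bound [D] on the derivative over the disc, which is the
    same Taylor bound for [dcoef a], expanded at 0. [Rabs] keeps the constant positive for negative
    [rho], where nothing is claimed. *)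
Lemma entire_lipschitz (a : nat -> R) (rho : R) :
  fact_bounded a -> exists M, 0 < M /\ forall w w' : C,
    Cmod w <= rho -> Cmod w' <= rho ->
    Cmod (entire a w' - entire a w)%C <= M * Cmod (w' - w).
Proof.
  intros Ha.
  destruct (entire_taylor a rho Ha) as [M [HM H]].
  destruct (entire_taylor (dcoef a) rho (fact_bounded_dcoef a Ha)) as [M2 [HM2 H2]].
  set (D := Cmod (entire (dcoef a) 0) + Cmod (entire (dcoef (dcoef a)) 0) * rho + M2 * rho ^ 2).
  exists (Rabs D + M * (2 * Rabs rho) + 1). split.
  { assert (H0 := Rabs_pos D). assert (H1 := Rabs_pos rho). nra. }
  intros w w' Hw Hw'.
  assert (Hrho : 0 <= rho) by (eapply Rle_trans; [apply Cmod_ge_0 | exact Hw]).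
  rewrite (Rabs_pos_eq rho) by auto.
  assert (HD : Cmod (entire (dcoef a) w) <= D).
  { assert (Hz : Cmod 0%C <= rho) by now rewrite Cmod_0.
    specialize (H2 0%C w Hz Hw).
    replace (w - 0)%C with w in H2 by ring.
    assert (Hw2 : Cmod w ^ 2 <= rho ^ 2).
    { apply pow_incr. split; auto. apply Cmod_ge_0. }
    replace (entire (dcoef a) w) with
      (entire (dcoef a) w - entire (dcoef a) 0 - entire (dcoef (dcoef a)) 0 * w
       + (entire (dcoef a) 0 + entire (dcoef (dcoef a)) 0 * w))%C by ring.
    eapply Rle_trans. apply Cmod_triangle.
    eapply Rle_trans. apply Rplus_le_compat_l, Cmod_triangle.
    rewrite Cmod_mult. unfold D.
    assert (Cmod (entire (dcoef (dcoef a)) 0) * Cmod w <= Cmod (entire (dcoef (dcoef a)) 0) * rho)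
      by (apply Rmult_le_compat_l; auto; apply Cmod_ge_0).
    nra. }
  specialize (H w w' Hw Hw').
  replace (entire a w' - entire a w)%C with
    (entire a w' - entire a w - entire (dcoef a) w * (w' - w) + entire (dcoef a) w * (w' - w))%C
    by ring.
  eapply Rle_trans. apply Cmod_triangle. rewrite Cmod_mult.
  assert (Hd0 := Cmod_ge_0 (w' - w)).
  assert (Hd : Cmod (w' - w) <= 2 * rho).
  { eapply Rle_trans. apply Cmod_triangle. rewrite Cmod_opp. lra. }
  assert (HD' := Rle_abs D). set (d := Cmod (w' - w)) in *.
  assert (Cmod (entire (dcoef a) w) * d <= Rabs D * d) by (apply Rmult_le_compat_r; lra).
  assert (M * d ^ 2 <= M * (2 * rho) * d).
  { simpl. rewrite Rmult_1_r, <- Rmult_assoc. apply Rmult_le_compat_r; auto.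
    apply Rmult_le_compat_l; lra. }
  lra.
Qed.

Lemma continuous_entire {U : UniformSpace} (a : nat -> R) (f : U -> C) (x : U) :
  fact_bounded a -> continuous f x -> continuous (fun y => entire a (f y)) x.
Proof.
  intros Ha Hf. apply continuous_Cmod_lt. intros e He.
  destruct (entire_lipschitz a (Cmod (f x) + 1) Ha) as [M [HM H]].
  assert (Hm : 0 < Rmin 1 (e / (M + 1))).
  { apply Rmin_pos; [lra|]. apply Rdiv_lt_0_compat; lra. }
  generalize (proj1 (continuous_Cmod_lt f x) Hf _ Hm). apply filter_imp.
  intros y Hy.
  assert (H1 : Cmod (f y - f x) < 1) by (eapply Rlt_le_trans; [exact Hy | apply Rmin_l]).
  assert (H2 : Cmod (f y - f x) < e / (M + 1)) by (eapply Rlt_le_trans; [exact Hy | apply Rmin_r]).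
  assert (H3 := Cmod_triangle_rev (f y) (f x)).
  eapply Rle_lt_trans; [apply H; lra|].
  apply Rle_lt_trans with (M * (e / (M + 1))).
  - apply Rmult_le_compat_l; lra.
  - apply Rmult_lt_reg_r with (M + 1); [lra|].
    unfold Rdiv. field_simplify; [nra | lra].
Qed.

(** * Derivatives of complex functions of a real variable *)

Definition is_Cderive (f : R -> C) (t : R) (d : C) : Prop :=
  is_derive (fun s => fst (f s)) t (fst d) /\ is_derive (fun s => snd (f s)) t (snd d).

Lemma is_derive_bound (f : R -> R) (t d : R) :
  is_derive f t d -> forall e, 0 < e ->
  exists r, 0 < r /\ forall h, Rabs h < r -> Rabs (f (t + h) - f t - d * h) <= e * Rabs h.
Proof.
  intros H e He. apply is_derive_Reals in H. destruct (H e He) as [r Hr].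
  exists r. split; [apply cond_pos|]. intros h Hh.
  destruct (Req_dec h 0) as [->|H0].
  - rewrite Rplus_0_r, Rmult_0_r, !Rminus_diag, Rabs_R0. lra.
  - specialize (Hr h H0 Hh).
    replace (f (t + h) - f t - d * h) with (((f (t + h) - f t) / h - d) * h) by (field; auto).
    rewrite Rabs_mult. apply Rmult_le_compat_r; [apply Rabs_pos | lra].
Qed.

Lemma is_derive_of_bound (f : R -> R) (t d : R) :
  (forall e, 0 < e -> exists r, 0 < r /\
     forall h, Rabs h < r -> Rabs (f (t + h) - f t - d * h) <= e * Rabs h) ->
  is_derive f t d.
Proof.
  intros H. apply is_derive_Reals. intros e He.
  destruct (H (e / 2)) as [r [Hr Hb]]; [lra|].
  exists (mkposreal r Hr). intros h H0 Hh. specialize (Hb h Hh).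
  replace ((f (t + h) - f t) / h - d) with ((f (t + h) - f t - d * h) / h) by (field; auto).
  unfold Rdiv. rewrite Rabs_mult, Rabs_inv.
  assert (0 < Rabs h) by now apply Rabs_pos_lt.
  apply Rle_lt_trans with (e / 2); [|lra].
  apply Rmult_le_reg_r with (Rabs h); auto.
  rewrite Rmult_assoc, Rinv_l, Rmult_1_r; lra.
Qed.

(** The first-order expansion in the modulus allows [h = 0] and avoids quotients; chain rules and
    Frechet derivatives are obtained from it. *)
Lemma is_Cderive_bound (f : R -> C) (t : R) (d : C) :
  is_Cderive f t d <-> forall e, 0 < e -> exists r, 0 < r /\
    forall h, Rabs h < r -> Cmod (f (t + h)%R - f t - d * RtoC h)%C <= e * Rabs h.
Proof.
  split.
  - intros [H1 H2] e He. assert (He2 : 0 < e / 2) by lra.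
    destruct (is_derive_bound _ _ _ H1 _ He2) as [r1 [Hr1 Hb1]].
    destruct (is_derive_bound _ _ _ H2 _ He2) as [r2 [Hr2 Hb2]].
    exists (Rmin r1 r2). split; [now apply Rmin_pos|]. intros h Hh.
    eapply Rle_trans; [apply Cmod_le_abs|]. simpl.
    specialize (Hb1 h (Rlt_le_trans _ _ _ Hh (Rmin_l _ _))).
    specialize (Hb2 h (Rlt_le_trans _ _ _ Hh (Rmin_r _ _))).
    replace (fst (f (t + h)) + - fst (f t) + - (fst d * h - snd d * 0))
      with (fst (f (t + h)) - fst (f t) - fst d * h) by ring.
    replace (snd (f (t + h)) + - snd (f t) + - (fst d * 0 + snd d * h))
      with (snd (f (t + h)) - snd (f t) - snd d * h) by ring.
    lra.
  - intros H. split; apply is_derive_of_bound; intros e He;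
      destruct (H e He) as [r [Hr Hb]]; exists r; split; auto; intros h Hh;
      specialize (Hb h Hh); (eapply Rle_trans; [|exact Hb]).
    + eapply Rle_trans; [|apply fst_le_Cmod]. simpl. apply Req_le. f_equal. ring.
    + eapply Rle_trans; [|apply snd_le_Cmod]. simpl. apply Req_le. f_equal. ring.
Qed.

Lemma is_Cderive_ext (f g : R -> C) (t : R) (d : C) :
  locally t (fun s => f s = g s) -> is_Cderive f t d -> is_Cderive g t d.
Proof.
  intros Hl [H1 H2].
  split; [apply is_derive_ext_loc with (2 := H1) | apply is_derive_ext_loc with (2 := H2)];
    generalize Hl; apply filter_imp; intros s Hs; now rewrite Hs.
Qed.

Lemma is_Cderive_const (c : C) (t : R) : is_Cderive (fun _ => c) t 0%C.
Proof. split; simpl; apply (@is_derive_const R_AbsRing R_NormedModule). Qed.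

Lemma is_Cderive_plus (f g : R -> C) (t : R) (df dg : C) :
  is_Cderive f t df -> is_Cderive g t dg ->
  is_Cderive (fun s => f s + g s)%C t (df + dg)%C.
Proof.
  intros [H1 H2] [H3 H4]; split; simpl; apply (@is_derive_plus R_AbsRing R_NormedModule); auto.
Qed.

Lemma is_derive_Rmult (f g : R -> R) (t df dg : R) :
  is_derive f t df -> is_derive g t dg ->
  is_derive (fun s => f s * g s) t (df * g t + f t * dg).
Proof. intros Hf Hg. apply (is_derive_mult f g t df dg Hf Hg Rmult_comm). Qed.

Lemma is_derive_Rsqr (f : R -> R) (t df : R) :
  is_derive f t df -> is_derive (fun s => f s ^ 2) t (2 * f t * df).
Proof.
  intros Hf. replace (2 * f t * df) with (df * f t + f t * df) by ring.
  apply is_derive_ext with (fun s => f s * f s); [intros s; simpl; ring|].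
  now apply is_derive_Rmult.
Qed.

Lemma is_Cderive_mult (f g : R -> C) (t : R) (df dg : C) :
  is_Cderive f t df -> is_Cderive g t dg ->
  is_Cderive (fun s => f s * g s)%C t (df * g t + f t * dg)%C.
Proof.
  intros [H1 H2] [H3 H4]; split; simpl.
  - replace (_ + _) with
      ((fst df * fst (g t) + fst (f t) * fst dg) - (snd df * snd (g t) + snd (f t) * snd dg)) by ring.
    apply (@is_derive_minus R_AbsRing R_NormedModule); apply is_derive_Rmult; auto.
  - replace (_ + _) with
      ((fst df * snd (g t) + fst (f t) * snd dg) + (snd df * fst (g t) + snd (f t) * fst dg)) by ring.
    apply (@is_derive_plus R_AbsRing R_NormedModule); apply is_derive_Rmult; auto.
Qed.

(** The real chain rule comes directly from the quadratic Taylor bound, without a notion of complex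
    derivative. *)
Lemma is_Cderive_entire (a : nat -> R) (w : R -> C) (t : R) (dw : C) :
  fact_bounded a -> is_Cderive w t dw ->
  is_Cderive (fun s => entire a (w s)) t (entire (dcoef a) (w t) * dw)%C.
Proof.
  intros Ha Hw. apply is_Cderive_bound. intros e He.
  (* This radius contains [w (t + h)] for small |h| <= 1, since the increment is at most (|dw| + 1)
     |h|. Below, half of [e] pays for the quadratic remainder and half for the linearization error
     of [w]. *)
  destruct (entire_taylor a (Cmod (w t) + (Cmod dw + 1)) Ha) as [M [HM H]].
  set (D := Cmod (entire (dcoef a) (w t))).
  assert (HD : 0 <= D) by apply Cmod_ge_0.
  set (k := Cmod dw + 1). assert (Hk : 1 <= k) by (assert (H0 := Cmod_ge_0 dw); unfold k; lra).
  assert (He' : 0 < Rmin 1 (e / 2 / (D + 1))).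
  { apply Rmin_pos; [lra|]. apply Rdiv_lt_0_compat; lra. }
  destruct (proj1 (is_Cderive_bound _ _ _) Hw _ He') as [r [Hr Hb]].
  assert (Hm : 0 < e / 2 / (M * k ^ 2)).
  { apply Rdiv_lt_0_compat; [lra|]. apply Rmult_lt_0_compat; [lra|]. apply pow_lt; lra. }
  exists (Rmin r (Rmin 1 (e / 2 / (M * k ^ 2)))). split.
  { repeat apply Rmin_pos; auto; lra. }
  intros h Hh.
  assert (Hh1 := Rlt_le_trans _ _ _ Hh (Rmin_l _ _)).
  assert (Hh' := Rlt_le_trans _ _ _ Hh (Rmin_r _ _)).
  assert (Hh2 := Rlt_le_trans _ _ _ Hh' (Rmin_l _ _)).
  assert (Hh3 := Rlt_le_trans _ _ _ Hh' (Rmin_r _ _)). clear Hh Hh'.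
  specialize (Hb h Hh1).
  assert (Ha0 := Rabs_pos h).
  set (dl := (w (t + h)%R - w t)%C) in *.
  assert (Hdl : Cmod dl <= k * Rabs h).
  { replace dl with ((dl - dw * RtoC h) + dw * RtoC h)%C by ring.
    eapply Rle_trans. apply Cmod_triangle. rewrite Cmod_mult, Cmod_R.
    assert (Hm1 := Rmin_l 1 (e / 2 / (D + 1))). unfold k.
    assert (Rmin 1 (e / 2 / (D + 1)) * Rabs h <= 1 * Rabs h) by (apply Rmult_le_compat_r; auto).
    lra. }
  assert (Hw' : Cmod (w (t + h)) <= Cmod (w t) + (Cmod dw + 1)).
  { assert (H3 := Cmod_triangle_rev (w (t + h)) (w t)). fold dl in H3.
    fold k. assert (k * Rabs h <= k * 1) by (apply Rmult_le_compat_l; lra). lra. }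
  assert (Hw0 : Cmod (w t) <= Cmod (w t) + (Cmod dw + 1)).
  { fold k. lra. }
  specialize (H (w t) (w (t + h)) Hw0 Hw'). fold dl in H.
  replace (entire a (w (t + h)%R) - entire a (w t) - entire (dcoef a) (w t) * dw * RtoC h)%C
    with ((entire a (w (t + h)%R) - entire a (w t) - entire (dcoef a) (w t) * dl)
          + entire (dcoef a) (w t) * (dl - dw * RtoC h))%C by ring.
  eapply Rle_trans. apply Cmod_triangle. rewrite Cmod_mult. fold D.
  assert (H1 : M * Cmod dl ^ 2 <= e / 2 * Rabs h).
  { assert (Hp : Cmod dl ^ 2 <= (k * Rabs h) ^ 2).
    { apply pow_incr. split; auto. apply Cmod_ge_0. }
    apply Rle_trans with (M * (k * Rabs h) ^ 2); [apply Rmult_le_compat_l; lra|].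
    replace (M * (k * Rabs h) ^ 2) with (Rabs h * (M * k ^ 2) * Rabs h) by ring.
    apply Rmult_le_compat_r; auto.
    assert (Hpos : 0 < M * k ^ 2) by (apply Rmult_lt_0_compat; [lra|]; apply pow_lt; lra).
    apply Rmult_le_reg_r with (/ (M * k ^ 2)); [now apply Rinv_0_lt_compat|].
    rewrite Rmult_assoc, Rinv_r, Rmult_1_r by lra. unfold Rdiv in *. lra. }
  assert (H2 : D * Cmod (dl - dw * RtoC h) <= e / 2 * Rabs h).
  { apply Rle_trans with (D * (e / 2 / (D + 1) * Rabs h)).
    - apply Rmult_le_compat_l; auto. eapply Rle_trans; [exact Hb|].
      apply Rmult_le_compat_r; auto. apply Rmin_r.
    - rewrite <- Rmult_assoc. apply Rmult_le_compat_r; auto.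
      apply Rmult_le_reg_r with (D + 1); [lra|].
      field_simplify; [|lra]. nra. }
  lra.
Qed.

(** * Square root and logarithm on the upper half plane *)

(** A formula for the argument that is smooth on the whole upper half plane, with no case
    distinction. *)
Definition uarg (w : C) : R := PI / 2 - atan (Re w / Im w).

Lemma uarg_bounds (w : C) : 0 < uarg w < PI.
Proof. unfold uarg. assert (H := atan_bound (Re w / Im w)). lra. Qed.

Lemma Cmod_Im_pos (w : C) : 0 < Im w -> 0 < Cmod w.
Proof.
  intros H. apply Cmod_gt_0. intros E. rewrite E in H. simpl in H. lra.
Qed.

Lemma sqrt_ratio (w : C) : 0 < Im w -> sqrt (1 + (Re w / Im w)²) = Cmod w / Im w.
Proof.
  intros H. unfold Cmod, Re, Im in *.
  apply Rsqr_inj.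
  - apply sqrt_pos.
  - apply Rmult_le_pos; [apply sqrt_pos | left; now apply Rinv_0_lt_compat].
  - rewrite Rsqr_sqrt by (assert (H0 := Rle_0_sqr (fst w / snd w)); lra).
    rewrite (Rsqr_div' (sqrt _)), Rsqr_sqrt by nra.
    unfold Rsqr. field. lra.
Qed.

Lemma cos_uarg (w : C) : 0 < Im w -> cos (uarg w) = Re w / Cmod w.
Proof.
  intros H. unfold uarg. rewrite cos_shift, sin_atan, sqrt_ratio by auto.
  assert (H1 := Cmod_Im_pos w H). field. lra.
Qed.

Lemma sin_uarg (w : C) : 0 < Im w -> sin (uarg w) = Im w / Cmod w.
Proof.
  intros H. unfold uarg. rewrite sin_shift, cos_atan, sqrt_ratio by auto.
  assert (H1 := Cmod_Im_pos w H). field. lra.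
Qed.

Lemma atan_le (x y : R) : x <= y -> atan x <= atan y.
Proof.
  intros [H | ->]; [left; now apply atan_increasing | apply Rle_refl].
Qed.

(** If Im w > 0, the rotated point - i w has positive real part, so its angle lies within PI / 2 of
    0. [acos] recovers that angle up to sign, and the test in [Arg] on the sign of - Re w restores
    the sign. *)
Lemma arg_cut_upper (w : C) : 0 < Im w -> arg_cut w = uarg w.
Proof.
  intros H. assert (H1 := Cmod_Im_pos w H). unfold arg_cut, Arg, uarg.
  assert (Hr : Re (- Ci * w)%C = Im w) by (unfold Re, Im; simpl; ring).
  assert (Hi : Im (- Ci * w)%C = - Re w) by (unfold Re, Im; simpl; ring).
  assert (Hm : Cmod (- Ci * w)%C = Cmod w) by (rewrite Cmod_mult, Cmod_opp, Cmod_Ci; ring).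
  rewrite Hr, Hi, Hm.
  assert (Hc : Im w / Cmod w = cos (atan (Re w / Im w))).
  { rewrite cos_atan, sqrt_ratio by auto. field. lra. }
  rewrite Hc. assert (Hb := atan_bound (Re w / Im w)).
  destruct (Rle_dec 0 (- Re w)) as [Hs|Hs].
  - rewrite <- cos_neg, acos_cos; [ring|].
    assert (atan (Re w / Im w) <= atan 0); [|rewrite atan_0 in *; lra].
    apply atan_le. apply Rmult_le_reg_r with (Im w); auto. unfold Rdiv.
    rewrite Rmult_assoc, Rinv_l by lra. lra.
  - rewrite acos_cos; [ring|].
    assert (atan 0 <= atan (Re w / Im w)); [|rewrite atan_0 in *; lra].
    apply atan_le. apply Rmult_le_reg_r with (Im w); auto. unfold Rdiv.
    rewrite Rmult_assoc, Rinv_l by lra. lra.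
Qed.

Lemma sqrt_cut_upper (w : C) : 0 < Im w ->
  sqrt_cut w = (sqrt (Cmod w) * cos (uarg w / 2), sqrt (Cmod w) * sin (uarg w / 2)).
Proof. intros H. unfold sqrt_cut. now rewrite arg_cut_upper. Qed.

Lemma sqrt_cut_sqr (w : C) : 0 < Im w -> (sqrt_cut w * sqrt_cut w)%C = w.
Proof.
  intros H. rewrite sqrt_cut_upper by auto.
  assert (H1 := Cmod_Im_pos w H).
  assert (Hs : sqrt (Cmod w) * sqrt (Cmod w) = Cmod w) by (apply sqrt_sqrt; lra).
  assert (Hc := cos_uarg w H). assert (Hsn := sin_uarg w H).
  assert (Hd : uarg w = 2 * (uarg w / 2)) by field.
  rewrite Hd, cos_2a in Hc. rewrite Hd, sin_2a in Hsn.
  unfold Cmult; simpl. destruct w as [x y]; unfold Re, Im in *; simpl in *. f_equal.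
  - replace (_ - _) with (sqrt (Cmod (x, y)) * sqrt (Cmod (x, y)) *
      (cos (uarg (x, y) / 2) * cos (uarg (x, y) / 2) - sin (uarg (x, y) / 2) * sin (uarg (x, y) / 2)))
      by ring.
    rewrite Hs, Hc. field. lra.
  - replace (_ + _) with (sqrt (Cmod (x, y)) * sqrt (Cmod (x, y)) *
      (2 * sin (uarg (x, y) / 2) * cos (uarg (x, y) / 2))) by ring.
    rewrite Hs, Hsn. field. lra.
Qed.

Lemma Cmod_sqrt_cut (w : C) : Cmod (sqrt_cut w) = sqrt (Cmod w).
Proof.
  unfold sqrt_cut, Cmod at 1; simpl.
  assert (H := sin2_cos2 (arg_cut w / 2)). unfold Rsqr in H.
  replace (_ + _) with (sqrt (Cmod w) * sqrt (Cmod w) *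
    (sin (arg_cut w / 2) * sin (arg_cut w / 2) + cos (arg_cut w / 2) * cos (arg_cut w / 2))) by ring.
  rewrite H, Rmult_1_r. apply sqrt_square, sqrt_pos.
Qed.

(** The logarithm of the square root of w, written so that it can be differentiated directly in
    w. *)
Definition half_log (w : C) : C := (ln (Cmod w) / 2, uarg w / 2).

(** The root has argument in (0, PI / 2), inside the range of the principal branch, so no multiple
    of 2 PI appears. *)
Lemma Clog_sqrt_cut (r : R) (w : C) : 0 < r -> 0 < Im w ->
  Clog (RtoC r * sqrt_cut w)%C = (RtoC (ln r) + half_log w)%C.
Proof.
  intros Hr H. assert (Hm := Cmod_Im_pos w H).
  assert (Hsq : 0 < sqrt (Cmod w)) by now apply sqrt_lt_R0.
  assert (HM : Cmod (RtoC r * sqrt_cut w)%C = r * sqrt (Cmod w)).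
  { rewrite Cmod_mult, Cmod_R, Cmod_sqrt_cut, Rabs_pos_eq; lra. }
  assert (Hb := uarg_bounds w).
  apply injective_projections.
  - change (ln (Cmod (RtoC r * sqrt_cut w)%C) = ln r + ln (Cmod w) / 2).
    rewrite HM, ln_mult by lra. f_equal.
    assert (E : ln (Cmod w) = ln (sqrt (Cmod w)) + ln (sqrt (Cmod w))).
    { rewrite <- ln_mult, sqrt_sqrt by lra. reflexivity. }
    lra.
  - change (Arg (RtoC r * sqrt_cut w)%C = 0 + uarg w / 2).
    unfold Arg. rewrite HM. rewrite sqrt_cut_upper by auto. unfold Re, Im; simpl.
    assert (Hs : 0 < sin (uarg w / 2)) by (apply sin_gt_0; lra).
    destruct (Rle_dec _ _) as [Hi|Hi].
    + replace ((r * (sqrt (Cmod w) * cos (uarg w / 2)) - 0 * (sqrt (Cmod w) * sin (uarg w / 2)))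
        / (r * sqrt (Cmod w))) with (cos (uarg w / 2)) by (field; lra).
      rewrite acos_cos; lra.
    + exfalso. apply Hi.
      assert (0 < r * (sqrt (Cmod w) * sin (uarg w / 2))) by (repeat apply Rmult_lt_0_compat; auto).
      lra.
Qed.

Lemma is_Cderive_half_log (w : R -> C) (t : R) (dw : C) :
  0 < Im (w t) -> is_Cderive w t dw ->
  is_Cderive (fun s => half_log (w s)) t (RtoC (1 / 2) * dw / w t)%C.
Proof.
  intros H [H1 H2].
  assert (Hpos : 0 < fst (w t) ^ 2 + snd (w t) ^ 2) by (unfold Im in H; nra).
  assert (Hsp : 0 < sqrt (fst (w t) ^ 2 + snd (w t) ^ 2)) by now apply sqrt_lt_R0.
  assert (Hss : sqrt (fst (w t) ^ 2 + snd (w t) ^ 2) * sqrt (fst (w t) ^ 2 + snd (w t) ^ 2)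
                = fst (w t) ^ 2 + snd (w t) ^ 2) by (apply sqrt_sqrt; lra).
  set (x := fun s => fst (w s)) in *. set (y := fun s => snd (w s)) in *.
  assert (E1 : ex_derive x t) by now exists (fst dw).
  assert (E2 : ex_derive y t) by now exists (snd dw).
  change (fst (w t)) with (x t) in *. change (snd (w t)) with (y t) in *.
  change (Im (w t)) with (y t) in H.
  split; unfold half_log, Cmod, uarg, Re, Im; simpl fst; simpl snd.
  - apply is_derive_ext with (fun s => ln (sqrt (x s ^ 2 + y s ^ 2)) / 2); [reflexivity|].
    evar_last; [auto_derive; repeat split; auto|].
    change (fun s => x s) with x. change (fun s => y s) with y.
    rewrite (is_derive_unique x t _ H1), (is_derive_unique y t _ H2).
    change (fst (w t)) with (x t). change (snd (w t)) with (y t).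
    simpl in *. rewrite !Rmult_1_r in *.
    set (q := sqrt (x t * x t + y t * y t)) in *.
    clearbody q. rewrite <- Hss. field. lra.
  - apply is_derive_ext with (fun s => (PI / 2 - atan (x s / y s)) / 2); [reflexivity|].
    evar_last; [auto_derive; repeat split; auto; lra|].
    change (fun s => x s) with x. change (fun s => y s) with y.
    rewrite (is_derive_unique x t _ H1), (is_derive_unique y t _ H2).
    change (fst (w t)) with (x t). change (snd (w t)) with (y t).
    simpl in *. field. split; nra.
Qed.

Lemma continuous_half_log {U : UniformSpace} (f : U -> C) (x : U) :
  continuous f x -> 0 < Im (f x) -> continuous (fun y => half_log (f y)) x.
Proof.
  intros Hf H. assert (Hm := Cmod_Im_pos _ H).
  apply continuous_C; unfold half_log; simpl.
  - apply (continuous_Rmult (fun y => ln (Cmod (f y))) (fun _ => / 2)); prove_continuous.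
    apply (continuous_Rcomp (fun y => Cmod (f y)) ln); prove_continuous.
    apply derivable_continuous_pt. exists (/ Cmod (f x)). now apply derivable_pt_lim_ln.
  - apply (continuous_Rmult (fun y => uarg (f y)) (fun _ => / 2)); prove_continuous.
    apply (continuous_Rminus (fun _ => PI / 2) (fun y => atan (Re (f y) / Im (f y))));
      prove_continuous.
    apply (continuous_Rcomp (fun y => fst (f y) / snd (f y)) atan).
    + prove_continuous. unfold Im in H. lra.
    + apply derivable_continuous_pt, derivable_pt_atan.
Qed.

(** * The Hankel function *)

(** Coefficients in the variable (z / 2)^2, of J_0 and of the harmonic-number series in Y_0. *)
Definition coefJ (k : nat) : R := (-1) ^ k / INR (fact k) ^ 2.
Definition coefS (k : nat) : R := (-1) ^ k * harmonic k / INR (fact k) ^ 2.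

Lemma Rabs_pow_m1 (k : nat) : Rabs ((-1) ^ k) = 1.
Proof. rewrite <- RPow_abs, Rabs_left by lra. replace (- -1) with 1 by lra. apply pow1. Qed.

Lemma INR_fact_ge_1 (k : nat) : 1 <= INR (fact k).
Proof. apply (le_INR 1). apply lt_O_fact. Qed.

(** The crude bound suffices: it uses up one of the two factorials in [coefS] and leaves 1 / k!. *)
Lemma harmonic_bound (k : nat) : 0 <= harmonic k <= INR (fact k).
Proof.
  assert (H : 0 <= harmonic k <= INR k).
  { unfold harmonic. induction k as [|k IH].
    - rewrite sum_n_m_zero by lia. unfold zero; simpl. lra.
    - rewrite sum_n_Sm by lia. set (s := sum_n_m _ 1 k) in *.
      change (0 <= s + / INR (S k) <= INR (S k)). rewrite S_INR.
      assert (H2 : 0 < / (INR k + 1)) by (apply Rinv_0_lt_compat; lra).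
      assert (H3 : / (INR k + 1) <= / 1) by (apply Rinv_le_contravar; lra).
      rewrite Rinv_1 in H3. lra. }
  split; [apply H|]. eapply Rle_trans; [apply H|].
  apply le_INR. clear H. destruct k as [|k]; [simpl; lia|].
  change (fact (S k)) with (S k * fact k)%nat.
  assert (H1 := lt_O_fact k). nia.
Qed.

Lemma fact_bounded_coefJ : fact_bounded coefJ.
Proof.
  intros k. unfold coefJ, Rdiv. assert (H := INR_fact_ge_1 k).
  rewrite Rabs_mult, Rabs_pow_m1, Rmult_1_l, Rabs_pos_eq.
  - apply Rinv_le_contravar; [lra|]. nra.
  - left. apply Rinv_0_lt_compat. nra.
Qed.

Lemma fact_bounded_coefS : fact_bounded coefS.
Proof.
  intros k. unfold coefS, Rdiv. assert (H := INR_fact_ge_1 k).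
  assert (Hh := harmonic_bound k).
  assert (Hi : 0 < / INR (fact k) ^ 2) by (apply Rinv_0_lt_compat; nra).
  rewrite !Rabs_mult, Rabs_pow_m1, Rmult_1_l.
  rewrite (Rabs_pos_eq (/ INR (fact k) ^ 2)), (Rabs_pos_eq (harmonic k)) by lra.
  apply Rle_trans with (INR (fact k) * / INR (fact k) ^ 2).
  - apply Rmult_le_compat_r; lra.
  - apply Req_le. field. lra.
Qed.

Lemma entire_at_0 (a : nat -> R) : fact_bounded a -> entire a 0 = RtoC (a O).
Proof.
  intros Ha. assert (Hs := summable_entire a 0 Ha).
  apply injective_projections.
  - change (Series (fun n => Re (RtoC (a n) * Cpow 0 n)%C) = a O).
    rewrite (Series_incr_1 _ (summable_Re _ Hs)).
    rewrite (Series_ext _ (fun n => 0 * 0)) by (intros; simpl; ring).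
    rewrite Series_scal_l. simpl. ring.
  - change (Series (fun n => Im (RtoC (a n) * Cpow 0 n)%C) = 0).
    rewrite (Series_incr_1 _ (summable_Im _ Hs)).
    rewrite (Series_ext _ (fun n => 0 * 0)) by (intros; simpl; ring).
    rewrite Series_scal_l. simpl. ring.
Qed.

Lemma entire_coefJ_0 : entire coefJ 0 = 1%C.
Proof.
  rewrite entire_at_0 by apply fact_bounded_coefJ. unfold coefJ. simpl. f_equal. field.
Qed.

Lemma Cpow_double (z : C) (k : nat) : Cpow z (2 * k) = Cpow (z * z)%C k.
Proof.
  induction k as [|k IH]; [reflexivity|].
  replace (2 * S k)%nat with (S (S (2 * k))) by lia.
  cbn [Cpow]. rewrite IH. ring.
Qed.

(** Both series are even in z = k0 sqrt(w) / 2, hence series in z^2 = k0^2 w / 4; only the logarithm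
    sees the root itself, and it becomes [half_log w] plus a constant. *)
Lemma Hankel1_0_sqrt_cut (k0 : R) (w : C) : 0 < k0 -> 0 < Im w ->
  Hankel1_0 (RtoC k0 * sqrt_cut w)%C =
  ((1 + Ci * RtoC (2 / PI) * (half_log w + RtoC (ln (k0 / 2) + Euler_gamma)))
     * entire coefJ (RtoC (k0 ^ 2 / 4) * w)
   - Ci * RtoC (2 / PI) * entire coefS (RtoC (k0 ^ 2 / 4) * w))%C.
Proof.
  intros Hk Hw. unfold Hankel1_0, BesselY0, BesselJ0.
  set (z := (RtoC k0 * sqrt_cut w / 2)%C).
  assert (Hz : z = (RtoC (k0 / 2) * sqrt_cut w)%C).
  { unfold z. rewrite RtoC_div. field. lra. }
  assert (Hz2 : (z * z)%C = (RtoC (k0 ^ 2 / 4) * w)%C).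
  { rewrite <- (sqrt_cut_sqr w Hw) at 1. rewrite Hz.
    replace (RtoC (k0 ^ 2 / 4)) with (RtoC (k0 / 2) * RtoC (k0 / 2))%C
      by (rewrite <- RtoC_mult; f_equal; field).
    ring. }
  assert (HJ : forall c, CSeries (fun k => RtoC (c k) * Cpow z (2 * k))%C
                 = entire c (RtoC (k0 ^ 2 / 4) * w)%C).
  { intros c. unfold entire. apply CSeries_ext. intros k. now rewrite Cpow_double, Hz2. }
  assert (H1 := HJ coefJ). assert (H2 := HJ coefS). unfold coefJ at 1 in H1. unfold coefS at 1 in H2.
  rewrite H1, H2. rewrite Hz.
  rewrite Clog_sqrt_cut by lra. rewrite RtoC_plus. ring.
Qed.

(** * The anisotropic kernel *)

Lemma Ci_sqr : (Ci * Ci)%C = (- (1))%C.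
Proof. unfold Ci, Cmult, Copp, RtoC; simpl; f_equal; ring. Qed.

(** Both roots have arguments in (0, PI / 2), so these differ by less than PI / 2. This makes the
    two linear factors of Q invertible over the reals. *)
Lemma Re_conj_sqrt_cut (w1 w2 : C) : 0 < Im w1 -> 0 < Im w2 ->
  0 < Re (Cconj (sqrt_cut w1) * sqrt_cut w2)%C.
Proof.
  intros H1 H2. rewrite !sqrt_cut_upper by auto. unfold Re, Cconj; simpl.
  assert (Hm1 := sqrt_lt_R0 _ (Cmod_Im_pos w1 H1)).
  assert (Hm2 := sqrt_lt_R0 _ (Cmod_Im_pos w2 H2)).
  assert (B1 := uarg_bounds w1). assert (B2 := uarg_bounds w2).
  assert (Hc : 0 < cos (uarg w1 / 2 - uarg w2 / 2)) by (apply cos_gt_0; lra).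
  rewrite cos_minus in Hc.
  replace (_ - _) with (sqrt (Cmod w1) * sqrt (Cmod w2) *
    (cos (uarg w1 / 2) * cos (uarg w2 / 2) + sin (uarg w1 / 2) * sin (uarg w2 / 2))) by ring.
  repeat apply Rmult_lt_0_compat; auto.
Qed.

(** The arguments add up to an angle [th] in (0, 2 PI), which could cross the cut at 3 PI / 2. Since
    Re (w1 w2) = Re w1 Re w2 - Im w1 Im w2 < 0, the cosine of [th] is negative, and [th] stays on
    the branch. *)
Lemma sqrt_cut_mult (w1 w2 : C) :
  Re w1 * Re w2 < 0 -> 0 < Im w1 -> 0 < Im w2 ->
  sqrt_cut (w1 * w2)%C = (sqrt_cut w1 * sqrt_cut w2)%C.
Proof.
  intros Hre H1 H2.
  assert (Hm1 := Cmod_Im_pos w1 H1). assert (Hm2 := Cmod_Im_pos w2 H2).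
  assert (B1 := uarg_bounds w1). assert (B2 := uarg_bounds w2).
  set (th := uarg w1 + uarg w2).
  assert (HD : Cmod (w1 * w2)%C = Cmod w1 * Cmod w2) by apply Cmod_mult.
  assert (Hcos : cos th = Re (w1 * w2)%C / Cmod (w1 * w2)%C).
  { unfold th. rewrite cos_plus, !cos_uarg, !sin_uarg, HD by auto.
    unfold Re, Im; simpl. field. lra. }
  assert (Hsin : sin th = Im (w1 * w2)%C / Cmod (w1 * w2)%C).
  { unfold th. rewrite sin_plus, !cos_uarg, !sin_uarg, HD by auto.
    unfold Re, Im; simpl. field. lra. }
  assert (HDp : 0 < Cmod (w1 * w2)%C) by (rewrite HD; now apply Rmult_lt_0_compat).
  assert (HReD : Re (w1 * w2)%C < 0) by (unfold Re, Im in *; simpl; nra).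
  assert (Hneg : cos th < 0).
  { rewrite Hcos. apply Rmult_lt_reg_r with (Cmod (w1 * w2)%C); auto.
    unfold Rdiv. rewrite Rmult_assoc, Rinv_l by lra. lra. }
  assert (Hth : PI / 2 <= th <= 3 * (PI / 2)).
  { split; apply Rnot_lt_le; intros Hlt.
    - assert (0 <= cos th); [apply cos_ge_0; unfold th in *; lra | lra].
    - assert (0 <= cos th); [apply cos_ge_0_3PI2; unfold th in *; lra | lra]. }
  assert (Harg : arg_cut (w1 * w2)%C = th).
  { unfold arg_cut, Arg.
    assert (Hr : Re (- Ci * (w1 * w2))%C = Im (w1 * w2)%C) by (unfold Re, Im; simpl; ring).
    assert (Hi : Im (- Ci * (w1 * w2))%C = - Re (w1 * w2)%C) by (unfold Re, Im; simpl; ring).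
    assert (Hm : Cmod (- Ci * (w1 * w2))%C = Cmod (w1 * w2)%C)
      by (rewrite Cmod_mult, Cmod_opp, Cmod_Ci; ring).
    rewrite Hr, Hi, Hm. destruct (Rle_dec _ _) as [_|Hn]; [|exfalso; apply Hn; lra].
    rewrite <- Hsin.
    replace (sin th) with (cos (th - PI / 2)).
    - rewrite acos_cos; lra.
    - replace (th - PI / 2) with (- (PI / 2 - th)) by ring. now rewrite cos_neg, cos_shift. }
  unfold sqrt_cut at 1. rewrite Harg, HD, sqrt_mult by lra.
  rewrite !sqrt_cut_upper by auto. unfold th.
  replace ((uarg w1 + uarg w2) / 2) with (uarg w1 / 2 + uarg w2 / 2) by field.
  rewrite cos_plus, sin_plus. unfold Cmult; simpl. f_equal; ring.
Qed.

Definition linmap (p q : C) (X : C) : C := (p * RtoC (fst X) + q * RtoC (snd X))%C.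

Lemma linmap_minus (p q X Y : C) : linmap p q (X - Y)%C = (linmap p q X - linmap p q Y)%C.
Proof. unfold linmap. simpl. rewrite !RtoC_plus, !RtoC_opp. ring. Qed.

Lemma linmap_upper (p q X : C) : Cmod (linmap p q X) <= (Cmod p + Cmod q) * Cmod X.
Proof.
  unfold linmap. eapply Rle_trans. apply Cmod_triangle. rewrite !Cmod_mult, !Cmod_R.
  assert (H1 := fst_le_Cmod X). assert (H2 := snd_le_Cmod X).
  assert (H3 := Cmod_ge_0 p). assert (H4 := Cmod_ge_0 q). nra.
Qed.

(** [Im (Cconj p * q)] is the determinant of the real-linear map X -> p X1 + q X2; Cramer's rule
    recovers both coordinates of X from its value. *)
Lemma linmap_lower (p q : C) : Im (Cconj p * q)%C <> 0 ->
  exists c, 0 < c /\ forall X, c * Cmod X <= Cmod (linmap p q X).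
Proof.
  intros Hm. set (m := Im (Cconj p * q)%C) in *.
  set (s := Cmod p + Cmod q).
  assert (Hs : 0 <= s) by (unfold s; assert (H3 := Cmod_ge_0 p); assert (H4 := Cmod_ge_0 q); lra).
  assert (Hpos : 0 < Rabs m) by now apply Rabs_pos_lt.
  exists (Rabs m / (s + 1)). split; [apply Rdiv_lt_0_compat; lra|].
  intros X. set (l := linmap p q X).
  assert (H1 : m * fst X = Im (Cconj l * q)%C).
  { unfold m, l, linmap, Im, Cconj; simpl. ring. }
  assert (H2 : m * snd X = Im (Cconj p * l)%C).
  { unfold m, l, linmap, Im, Cconj; simpl. ring. }
  assert (H3 : Rabs m * Rabs (fst X) <= Cmod q * Cmod l).
  { rewrite <- Rabs_mult, H1. eapply Rle_trans; [apply snd_le_Cmod|].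
    rewrite Cmod_mult, Cmod_conj. lra. }
  assert (H4 : Rabs m * Rabs (snd X) <= Cmod p * Cmod l).
  { rewrite <- Rabs_mult, H2. eapply Rle_trans; [apply snd_le_Cmod|].
    rewrite Cmod_mult, Cmod_conj. lra. }
  assert (H5 := Cmod_le_abs X). assert (H6 := Cmod_ge_0 l).
  assert (H7 : Rabs m * Cmod X <= s * Cmod l) by (unfold s; nra).
  apply Rmult_le_reg_r with (s + 1); [lra|].
  replace (Rabs m / (s + 1) * Cmod X * (s + 1)) with (Rabs m * Cmod X) by (field; lra).
  lra.
Qed.

Lemma linmap_neq_0 (p q X : C) : Im (Cconj p * q)%C <> 0 -> X <> 0 -> linmap p q X <> 0.
Proof.
  intros Hm HX. destruct (linmap_lower p q Hm) as [c [Hc H]].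
  apply Cmod_gt_0. apply Cmod_gt_0 in HX. specialize (H X).
  apply Rlt_le_trans with (2 := H). now apply Rmult_lt_0_compat.
Qed.

Lemma continuous_linmap {U : UniformSpace} (p q : C) (f : U -> C) (x : U) :
  continuous f x -> continuous (fun y => linmap p q (f y)) x.
Proof.
  intros Hf. unfold linmap. prove_continuous.
Qed.

Lemma entire_bounded (a : nat -> R) (rho : R) : fact_bounded a ->
  exists M, 0 < M /\ forall w, Cmod w <= rho -> Cmod (entire a w) <= M.
Proof.
  intros Ha. destruct (entire_lipschitz a rho Ha) as [M [HM H]].
  exists (Cmod (entire a 0) + M * Rabs rho + 1). split.
  { assert (H1 := Cmod_ge_0 (entire a 0)). assert (H2 := Rabs_pos rho). nra. }
  intros w Hw. assert (Hrho : 0 <= rho) by (eapply Rle_trans; [apply Cmod_ge_0 | exact Hw]).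
  assert (H1 : Cmod 0%C <= rho) by now rewrite Cmod_0.
  specialize (H 0%C w H1 Hw). replace (w - 0)%C with w in H by ring.
  assert (H2 := Cmod_triangle_rev (entire a w) (entire a 0)).
  rewrite Rabs_pos_eq by auto.
  assert (M * Cmod w <= M * rho) by (apply Rmult_le_compat_l; lra). lra.
Qed.

(** Crude, but after multiplication by a length comparable with [y] the right-hand side is bounded
    near 0. *)
Lemma abs_ln_bound (y : R) : 0 < y -> Rabs (ln y) <= y + / y.
Proof.
  intros Hy. assert (Hi : 0 < / y) by now apply Rinv_0_lt_compat.
  assert (Haux : forall z, 0 < z -> ln z <= z).
  { intros z Hz. assert (H := exp_ineq1_le (ln z)). rewrite exp_ln in H by auto. lra. }
  assert (H1 := Haux y Hy). assert (H2 := Haux (/ y) Hi). rewrite ln_Rinv in H2 by auto.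
  unfold Rabs. destruct (Rcase_abs (ln y)); lra.
Qed.

Section Kernel.

Variables (k0 : R) (eps1 eps2 : C).
Hypothesis Hk0 : 0 < k0.
Hypothesis Hre : Re eps1 * Re eps2 < 0.
Hypothesis Him1 : 0 < Im eps1.
Hypothesis Him2 : 0 < Im eps2.

Definition quad (X : C) : C :=
  (eps1 * RtoC (fst X ^ 2) + eps2 * RtoC (snd X ^ 2))%C.

Definition kernel (X : C) : C :=
  (Ci / RtoC 4 * sqrt_cut (eps1 * eps2)
   * Hankel1_0 (RtoC k0 * sqrt_cut (quad X)))%C.

(** Holds by conversion, because [R * R] and [C] are the same type: from here on points of the plane
    are treated as complex numbers. *)
Lemma Phi_kernel (x y : R * R) : Phi k0 eps1 eps2 x y = kernel (Cminus x y).
Proof. reflexivity. Qed.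

Lemma Im_quad_pos (X : C) : X <> 0 -> 0 < Im (quad X).
Proof.
  intros HX. apply C_neq_0_sqr in HX.
  assert (H1 := pow2_ge_0 (fst X)). assert (H2 := pow2_ge_0 (snd X)).
  set (u := fst X ^ 2) in *. set (v := snd X ^ 2) in *.
  replace (Im (quad X)) with (Im eps1 * u + Im eps2 * v) by (unfold quad, Im; simpl; unfold u, v; ring).
  destruct (Req_dec u 0) as [E|E]; [nra|].
  assert (0 < Im eps1 * u) by (apply Rmult_lt_0_compat; lra).
  assert (0 <= Im eps2 * v) by (apply Rmult_le_pos; lra). lra.
Qed.

Lemma quad_neq_0 (X : C) : X <> 0 -> quad X <> 0.
Proof. intros HX E. apply Im_quad_pos in HX. rewrite E in HX. simpl in HX. lra. Qed.

Let a1 := sqrt_cut eps1.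
Let a2 := sqrt_cut eps2.

(** With the next lemma: L+ preserves orientation and L- reverses it. Hence their tangent-line
    integrals pick up values i PI of opposite sign. *)
Lemma cross_plus : 0 < Im (Cconj a1 * (Ci * a2))%C.
Proof.
  assert (H := Re_conj_sqrt_cut _ _ Him1 Him2). fold a1 a2 in H.
  unfold Re, Im, Cconj in *; simpl in *. lra.
Qed.

Lemma cross_minus : Im (Cconj a1 * (- Ci * a2))%C < 0.
Proof.
  assert (H := Re_conj_sqrt_cut _ _ Him1 Him2). fold a1 a2 in H.
  unfold Re, Im, Cconj in *; simpl in *. lra.
Qed.

Lemma quad_factor (X : C) :
  quad X = (linmap a1 (Ci * a2) X * linmap a1 (- Ci * a2) X)%C.
Proof.
  unfold quad. rewrite <- (sqrt_cut_sqr eps1 Him1), <- (sqrt_cut_sqr eps2 Him2).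
  fold a1 a2. unfold linmap. simpl pow. rewrite !Rmult_1_r, !RtoC_mult.
  replace ((a1 * RtoC (fst X) + Ci * a2 * RtoC (snd X)) *
           (a1 * RtoC (fst X) + - Ci * a2 * RtoC (snd X)))%C
    with (a1 * a1 * (RtoC (fst X) * RtoC (fst X))
          - (Ci * Ci) * (a2 * a2) * (RtoC (snd X) * RtoC (snd X)))%C by ring.
  rewrite Ci_sqr. ring.
Qed.

(** The lower bound holds in spite of the indefinite real part of Q, because each of its two linear
    factors is bounded below. *)
Lemma quad_bounds : exists c M, 0 < c /\ 0 < M /\
  forall X, (c * Cmod X) ^ 2 <= Cmod (quad X) <= (M * Cmod X) ^ 2.
Proof.
  destruct (linmap_lower a1 (Ci * a2)%C) as [c1 [Hc1 H1]].
  { apply Rgt_not_eq, cross_plus. }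
  destruct (linmap_lower a1 (- Ci * a2)%C) as [c2 [Hc2 H2]].
  { apply Rlt_not_eq, cross_minus. }
  set (s1 := Cmod a1 + Cmod (Ci * a2)). set (s2 := Cmod a1 + Cmod (- Ci * a2)).
  assert (Hs1 : 0 <= s1) by (apply Rplus_le_le_0_compat; apply Cmod_ge_0).
  assert (Hs2 : 0 <= s2) by (apply Rplus_le_le_0_compat; apply Cmod_ge_0).
  exists (Rmin c1 c2), (s1 + s2 + 1).
  split; [now apply Rmin_pos|]. split; [lra|].
  intros X. rewrite quad_factor, Cmod_mult.
  specialize (H1 X). specialize (H2 X).
  assert (U1 := linmap_upper a1 (Ci * a2)%C X). fold s1 in U1.
  assert (U2 := linmap_upper a1 (- Ci * a2)%C X). fold s2 in U2.
  assert (HX := Cmod_ge_0 X). assert (m1 := Rmin_l c1 c2). assert (m2 := Rmin_r c1 c2).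
  assert (m0 : 0 < Rmin c1 c2) by now apply Rmin_pos.
  set (c := Rmin c1 c2) in *. set (x := Cmod X) in *. simpl. rewrite !Rmult_1_r. split.
  - apply Rmult_le_compat; try (apply Rmult_le_pos; lra);
      (eapply Rle_trans; [|eassumption]); apply Rmult_le_compat_r; auto.
  - apply Rmult_le_compat; try apply Cmod_ge_0;
      (eapply Rle_trans; [eassumption|]); apply Rmult_le_compat_r; lra.
Qed.

Let coef0 : C := (Ci / RtoC 4 * sqrt_cut (eps1 * eps2))%C.
Let kk : C := RtoC (k0 ^ 2 / 4).
Let cst : C := RtoC (ln (k0 / 2) + Euler_gamma).
Let alpha : C := (Ci * RtoC (2 / PI))%C.

Lemma kernel_eq (X : C) : X <> 0 ->
  kernel X = (coef0 * ((1 + alpha * (half_log (quad X) + cst)) * entire coefJ (kk * quad X)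
                       - alpha * entire coefS (kk * quad X)))%C.
Proof.
  intros HX. unfold kernel. rewrite Hankel1_0_sqrt_cut; auto. now apply Im_quad_pos.
Qed.

(** Derivative of the kernel as a function of w = Q(X). The first summand carries the pole 1 / w,
    which comes from [half_log]; the other one is at most logarithmic. *)
Definition kernel_deriv (w : C) : C :=
  (coef0 * (alpha * (RtoC (1 / 2) / w) * entire coefJ (kk * w)
   + ((1 + alpha * (half_log w + cst)) * entire (dcoef coefJ) (kk * w)
      - alpha * entire (dcoef coefS) (kk * w)) * kk))%C.

Definition grad_kernel1 (X : C) : C := (kernel_deriv (quad X) * (RtoC 2 * eps1 * RtoC (fst X)))%C.
Definition grad_kernel2 (X : C) : C := (kernel_deriv (quad X) * (RtoC 2 * eps2 * RtoC (snd X)))%C.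

Lemma is_Cderive_quad (X : R -> C) (t : R) (dX : C) :
  is_Cderive X t dX ->
  is_Cderive (fun s => quad (X s)) t
    (RtoC 2 * eps1 * RtoC (fst (X t)) * RtoC (fst dX)
     + RtoC 2 * eps2 * RtoC (snd (X t)) * RtoC (snd dX))%C.
Proof.
  intros [H1 H2].
  assert (Hsq : forall (f : R -> R) (l : R) (c : C), is_derive f t l ->
            is_Cderive (fun s => c * RtoC (f s ^ 2))%C t (RtoC 2 * c * RtoC (f t) * RtoC l)%C).
  { intros f l c Hf.
    replace (RtoC 2 * c * RtoC (f t) * RtoC l)%C
      with (0 * RtoC (f t ^ 2) + c * RtoC (2 * f t * l))%C
      by (rewrite !RtoC_mult; ring).
    apply (is_Cderive_mult (fun _ => c) (fun s => RtoC (f s ^ 2))).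
    - apply is_Cderive_const.
    - split; simpl.
      + exact (is_derive_Rsqr f t l Hf).
      + apply (@is_derive_const R_AbsRing R_NormedModule). }
  unfold quad. apply is_Cderive_plus.
  - apply (Hsq (fun s => fst (X s))); auto.
  - apply (Hsq (fun s => snd (X s))); auto.
Qed.

Lemma is_Cderive_kernel (X : R -> C) (t : R) (dX : C) :
  is_Cderive X t dX -> X t <> 0 ->
  is_Cderive (fun s => kernel (X s)) t
    (grad_kernel1 (X t) * RtoC (fst dX) + grad_kernel2 (X t) * RtoC (snd dX))%C.
Proof.
  intros HX H0.
  (* The series form [kernel_eq] is available only off the origin, so the path has to avoid 0 on a
     whole neighbourhood of [t]. *)
  assert (Hnz : locally t (fun s => X s <> 0)).
  { destruct (proj1 (is_Cderive_bound _ _ _) HX 1 Rlt_0_1) as [r [Hr Hb]].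
    apply Cmod_gt_0 in H0. set (k := Cmod dX + 1).
    assert (Hk : 0 < k) by (assert (Hd := Cmod_ge_0 dX); unfold k; lra).
    assert (He : 0 < Rmin r (Cmod (X t) / k)).
    { apply Rmin_pos; auto. now apply Rdiv_lt_0_compat. }
    exists (mkposreal _ He). intros s Hs.
    change (Rabs (s - t) < Rmin r (Cmod (X t) / k)) in Hs.
    assert (Hs1 := Rlt_le_trans _ _ _ Hs (Rmin_l _ _)).
    assert (Hs2 := Rlt_le_trans _ _ _ Hs (Rmin_r _ _)).
    specialize (Hb (s - t) Hs1). rewrite Rplus_minus in Hb.
    intros E. rewrite E in Hb.
    assert (Hd : Cmod (X t) <= k * Rabs (s - t)).
    { replace (X t) with (- (0 - X t - dX * RtoC (s - t)) - dX * RtoC (s - t))%C by ring.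
      eapply Rle_trans. apply Cmod_triangle. rewrite !Cmod_opp, Cmod_mult, Cmod_R.
      unfold k. lra. }
    apply (Rmult_lt_compat_l k) in Hs2; auto. unfold Rdiv in Hs2.
    rewrite (Rmult_comm (Cmod (X t))), <- Rmult_assoc, Rinv_r, Rmult_1_l in Hs2 by lra. lra. }
  assert (Hq := is_Cderive_quad X t dX HX).
  set (dq := (_ + _)%C) in Hq.
  assert (Hkq : is_Cderive (fun s => kk * quad (X s))%C t (0 * quad (X t) + kk * dq)%C).
  { apply (is_Cderive_mult (fun _ => kk) (fun s => quad (X s))); auto. apply is_Cderive_const. }
  assert (Hl := is_Cderive_half_log (fun s => quad (X s)) t dq (Im_quad_pos _ H0) Hq).
  assert (HJ := is_Cderive_entire coefJ _ t _ fact_bounded_coefJ Hkq).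
  assert (HS := is_Cderive_entire coefS _ t _ fact_bounded_coefS Hkq).
  apply is_Cderive_ext with (fun s =>
    coef0 * ((1 + alpha * (half_log (quad (X s)) + cst)) * entire coefJ (kk * quad (X s))
             + (- alpha) * entire coefS (kk * quad (X s))))%C.
  { generalize Hnz. apply filter_imp. intros s Hs. rewrite kernel_eq by auto. ring. }
  evar_last.
  - apply (is_Cderive_mult (fun _ => coef0)); [apply is_Cderive_const|].
    apply (is_Cderive_plus (fun s => (1 + alpha * (half_log (quad (X s)) + cst)) * entire coefJ (kk * quad (X s)))%C).
    + apply (is_Cderive_mult (fun s => 1 + alpha * (half_log (quad (X s)) + cst))%C); [|exact HJ].
      apply (is_Cderive_plus (fun _ => 1%C)); [apply is_Cderive_const|].
      apply (is_Cderive_mult (fun _ => alpha)); [apply is_Cderive_const|].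
      apply (is_Cderive_plus _ (fun _ => cst)); [exact Hl | apply is_Cderive_const].
    + apply (is_Cderive_mult (fun _ => (- alpha)%C)); [apply is_Cderive_const | exact HS].
  - unfold grad_kernel1, grad_kernel2, kernel_deriv, dq. simpl. field. now apply quad_neq_0.
Qed.

Lemma continuous_quad {U : UniformSpace} (f : U -> C) (x : U) :
  continuous f x -> continuous (fun y => quad (f y)) x.
Proof.
  intros Hf. unfold quad. prove_continuous.
Qed.

Lemma continuous_kernel_deriv {U : UniformSpace} (f : U -> C) (x : U) :
  continuous f x -> f x <> 0 -> continuous (fun y => kernel_deriv (quad (f y))) x.
Proof.
  intros Hf H0. assert (Hq := continuous_quad f x Hf).
  assert (Hi := Im_quad_pos _ H0). assert (Hn := quad_neq_0 _ H0).
  set (w := fun y => quad (f y)) in *.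
  assert (Hkq : continuous (fun y => kk * w y)%C x) by prove_continuous.
  assert (Hl : continuous (fun y => half_log (w y)) x) by now apply continuous_half_log.
  assert (HJ := continuous_entire coefJ _ x fact_bounded_coefJ Hkq).
  assert (HJ' := continuous_entire _ _ x (fact_bounded_dcoef _ fact_bounded_coefJ) Hkq).
  assert (HS' := continuous_entire _ _ x (fact_bounded_dcoef _ fact_bounded_coefS) Hkq).
  unfold kernel_deriv. fold (w x) in *. prove_continuous. exact Hn.
Qed.

Lemma continuous_grad_kernel (eps : C) (pr : C -> R) (X : C) :
  continuous pr X -> X <> 0 ->
  continuous (fun Y => kernel_deriv (quad Y) * (RtoC 2 * eps * RtoC (pr Y)))%C X.
Proof.
  intros Hpr HX.
  assert (Hd := continuous_kernel_deriv (fun Y => Y) X (continuous_id X) HX).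
  apply (continuous_Cmult (fun Y => kernel_deriv (quad Y))); auto.
  apply (continuous_Cmult (fun _ : C => RtoC 2 * eps)%C); prove_continuous.
Qed.

Lemma continuous_kernel {U : UniformSpace} (f : U -> C) (x : U) :
  continuous f x -> f x <> 0 -> continuous (fun y => kernel (f y)) x.
Proof.
  intros Hf H0. assert (Hq := continuous_quad f x Hf).
  assert (Hi := Im_quad_pos _ H0).
  set (w := fun y => quad (f y)) in *.
  assert (Hkq : continuous (fun y => kk * w y)%C x) by prove_continuous.
  assert (Hl : continuous (fun y => half_log (w y)) x) by now apply continuous_half_log.
  assert (HJ := continuous_entire coefJ _ x fact_bounded_coefJ Hkq).
  assert (HS := continuous_entire coefS _ x fact_bounded_coefS Hkq).
  apply continuous_ext_loc with (fun y =>
    coef0 * ((1 + alpha * (half_log (w y) + cst)) * entire coefJ (kk * w y)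
             - alpha * entire coefS (kk * w y)))%C.
  { apply Cmod_gt_0 in H0.
    generalize (proj1 (continuous_Cmod_lt f x) Hf _ H0). apply filter_imp.
    intros y Hy. rewrite kernel_eq; [reflexivity|]. intros E. rewrite E in Hy.
    replace (0 - f x)%C with (- f x)%C in Hy by ring. rewrite Cmod_opp in Hy. lra. }
  prove_continuous.
Qed.

(** J has value 1 at 0, so (J(kk w) - 1) / w is bounded by the Lipschitz estimate, and what is left
    besides is O(1 + |log|). The factor |X| makes this bounded; the gradient of Q will supply it. *)
Lemma kernel_deriv_remainder (rho : R) : exists M, 0 < M /\
  forall X : C, X <> 0 -> Cmod X <= rho ->
    Cmod (kernel_deriv (quad X) - coef0 * alpha * (RtoC (1 / 2) / quad X))%C * Cmod X <= M.
Proof.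
  destruct quad_bounds as [c [B [Hc [HB Hq]]]].
  set (r := Cmod kk * (B * rho) ^ 2).
  destruct (entire_lipschitz coefJ r fact_bounded_coefJ) as [M1 [HM1 H1]].
  destruct (entire_bounded _ r (fact_bounded_dcoef _ fact_bounded_coefJ)) as [M2 [HM2 H2]].
  destruct (entire_bounded _ r (fact_bounded_dcoef _ fact_bounded_coefS)) as [M3 [HM3 H3]].
  assert (C0 := Cmod_ge_0 coef0). assert (CA := Cmod_ge_0 alpha).
  assert (CK := Cmod_ge_0 kk). assert (CC := Cmod_ge_0 cst).
  (* [T1], [T2], [T3] bound, after multiplication by |X| <= rho, the contributions of (J - 1) / w,
     of the term with [half_log], and of the series [coefS]. *)
  set (T1 := Cmod alpha * (1 / 2 * (M1 * Cmod kk)) * Rabs rho).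
  set (T2 := (Rabs rho + Cmod alpha * (B * rho ^ 2 + / c + (PI / 2 + Cmod cst) * Rabs rho)) * M2).
  set (T3 := Cmod alpha * M3 * Rabs rho).
  exists (Rabs (Cmod coef0 * (T1 + (T2 + T3) * Cmod kk)) + 1). split.
  { assert (H := Rabs_pos (Cmod coef0 * (T1 + (T2 + T3) * Cmod kk))). lra. }
  intros X HX Hr.
  assert (Hx : 0 < Cmod X) by now apply Cmod_gt_0.
  set (w := quad X) in *. assert (Hw : w <> 0) by now apply quad_neq_0.
  assert (Hwp : 0 < Cmod w) by now apply Cmod_gt_0.
  destruct (Hq X) as [Hq1 Hq2]. fold w in Hq1, Hq2.
  assert (Hkw : Cmod (kk * w)%C <= r).
  { rewrite Cmod_mult. unfold r. apply Rmult_le_compat_l; auto.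
    eapply Rle_trans; [exact Hq2|]. apply pow_incr. split.
    - apply Rmult_le_pos; lra.
    - apply Rmult_le_compat_l; lra. }
  assert (Hr0 : Cmod 0%C <= r) by (rewrite Cmod_0; eapply Rle_trans; [apply Cmod_ge_0|exact Hkw]).
  assert (HJ : Cmod ((entire coefJ (kk * w) - 1) / w)%C <= M1 * Cmod kk).
  { rewrite Cmod_div by auto. apply Rmult_le_reg_r with (Cmod w); auto.
    unfold Rdiv. rewrite Rmult_assoc, Rinv_l, Rmult_1_r by lra.
    specialize (H1 0%C (kk * w)%C Hr0 Hkw). rewrite entire_coefJ_0 in H1.
    replace (kk * w - 0)%C with (kk * w)%C in H1 by ring. rewrite Cmod_mult in H1. lra. }
  specialize (H2 _ Hkw). specialize (H3 _ Hkw).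
  assert (HL : Cmod (half_log w) * Cmod X <= B * rho ^ 2 + / c + PI / 2 * rho).
  (* [y] is comparable with |X| by [quad_bounds], and the real part of [half_log w] is ln y. *)
  { set (y := sqrt (Cmod w)).
    assert (Hy : 0 < y) by now apply sqrt_lt_R0.
    assert (Hyy : y * y = Cmod w) by (apply sqrt_sqrt; lra).
    assert (Hy1 : c * Cmod X <= y).
    { apply Rsqr_incr_0_var; [|lra]. unfold Rsqr. rewrite Hyy. simpl in Hq1. lra. }
    assert (Hy2 : y <= B * Cmod X).
    { apply Rsqr_incr_0_var; [|apply Rmult_le_pos; lra]. unfold Rsqr. rewrite Hyy.
      simpl in Hq2. lra. }
    assert (Hl : Cmod (half_log w) <= y + / y + PI / 2).
    { eapply Rle_trans. apply Cmod_le_abs. unfold half_log; simpl.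
      assert (Hb := uarg_bounds w). rewrite (Rabs_pos_eq (uarg w / 2)) by lra.
      assert (E : ln (Cmod w) / 2 = ln y).
      { rewrite <- Hyy, ln_mult by auto. field. }
      rewrite E. assert (Hln := abs_ln_bound y Hy). lra. }
    apply Rle_trans with ((y + / y + PI / 2) * Cmod X); [apply Rmult_le_compat_r; lra|].
    assert (P1 : y * Cmod X <= B * rho ^ 2).
    { apply Rle_trans with (B * Cmod X * Cmod X); [apply Rmult_le_compat_r; lra|].
      rewrite Rmult_assoc. apply Rmult_le_compat_l; [lra|]. simpl. rewrite Rmult_1_r.
      apply Rmult_le_compat; lra. }
    assert (P2 : / y * Cmod X <= / c).
    { apply Rmult_le_reg_l with (y * c); [now apply Rmult_lt_0_compat|].
      replace (y * c * (/ y * Cmod X)) with (c * Cmod X) by (field; lra).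
      replace (y * c * / c) with y by (field; lra). exact Hy1. }
    assert (P3 : PI / 2 * Cmod X <= PI / 2 * rho).
    { apply Rmult_le_compat_l; [assert (Hpi := PI_RGT_0); lra | lra]. }
    lra. }
  unfold kernel_deriv.
  replace (_ - _)%C with
    (coef0 * (alpha * (RtoC (1 / 2) * ((entire coefJ (kk * w) - 1) / w))
     + ((1 + alpha * (half_log w + cst)) * entire (dcoef coefJ) (kk * w)
      - alpha * entire (dcoef coefS) (kk * w)) * kk))%C by (field; auto).
  set (z1 := ((entire coefJ (kk * w) - 1) / w)%C) in *.
  set (z2 := entire (dcoef coefJ) (kk * w)) in *.
  set (z3 := entire (dcoef coefS) (kk * w)) in *.
  set (l := half_log w) in *. set (x := Cmod X) in *.
  eapply Rle_trans; [|eapply Rle_trans; [apply Rle_abs | apply Rlt_le, Rlt_plus_1]].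
  rewrite Cmod_mult, Rmult_assoc. apply Rmult_le_compat_l; auto.
  assert (Hsum : forall a b : C, Cmod (a + b)%C * x <= Cmod a * x + Cmod b * x).
  { intros a b. rewrite <- Rmult_plus_distr_r.
    apply Rmult_le_compat_r; [lra | apply Cmod_triangle]. }
  assert (ra : Rabs rho = rho) by (apply Rabs_pos_eq; lra).
  eapply Rle_trans; [apply Hsum|]. apply Rplus_le_compat.
  - unfold T1. rewrite ra. rewrite !Cmod_mult, Cmod_R, (Rabs_pos_eq (1 / 2)) by lra.
    apply Rmult_le_compat; try lra.
    + repeat apply Rmult_le_pos; try lra; apply Cmod_ge_0.
    + apply Rmult_le_compat_l; auto. apply Rmult_le_compat_l; lra.
  - rewrite Cmod_mult, Rmult_assoc, (Rmult_comm (Cmod kk)), <- Rmult_assoc.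
    apply Rmult_le_compat_r; auto.
    eapply Rle_trans; [apply Hsum|]. rewrite Cmod_opp. apply Rplus_le_compat.
    + unfold T2. rewrite ra, Cmod_mult, Rmult_assoc, (Rmult_comm (Cmod z2)), <- Rmult_assoc.
      apply Rmult_le_compat; auto using Cmod_ge_0.
      * apply Rmult_le_pos; [apply Cmod_ge_0 | lra].
      * eapply Rle_trans; [apply Hsum|]. rewrite Cmod_1, Rmult_1_l.
        apply Rplus_le_compat; auto.
        rewrite Cmod_mult, Rmult_assoc. apply Rmult_le_compat_l; auto.
        eapply Rle_trans; [apply Hsum|].
        assert (Cmod cst * x <= Cmod cst * rho) by (apply Rmult_le_compat_l; auto). lra.
    + unfold T3. rewrite ra, Cmod_mult. apply Rmult_le_compat; auto; try lra.
      * apply Rmult_le_pos; auto using Cmod_ge_0.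
      * apply Rmult_le_compat_l; auto.
Qed.

(* The leading singularity [- a1 a2 / (2 PI) eps X / Q(X)] of the gradient, in
   partial fractions. *)
Definition sing_coef (p : C) : C := (- (a1 * a2 * p) / RtoC (4 * PI))%C.

Definition sing_part (p q : C) (X : C) : C :=
  (sing_coef p / linmap a1 (Ci * a2) X + sing_coef q / linmap a1 (- Ci * a2) X)%C.

Lemma RtoC_neq_0 (x : R) : x <> 0 -> RtoC x <> 0.
Proof. intros H E. apply H. now apply RtoC_inj. Qed.

(** Putting the fractions over Q = L+ L- leaves a comparison of constants: (i / 4) a1 a2 (2 i / PI)
    = - a1 a2 / (2 PI), where the product a1 a2 is the branch identity [sqrt_cut_mult]. *)
Lemma sing_part_eq (p q X : C) : X <> 0 ->
  sing_part p q X =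
  (coef0 * alpha * (RtoC (1 / 2) / quad X)
   * (p * linmap a1 (- Ci * a2) X + q * linmap a1 (Ci * a2) X))%C.
Proof.
  intros HX. unfold sing_part, sing_coef, coef0, alpha.
  rewrite sqrt_cut_mult by auto. fold a1 a2. rewrite quad_factor.
  assert (Hp : RtoC PI <> 0) by apply RtoC_neq_0, PI_neq0.
  assert (H1 : linmap a1 (Ci * a2) X <> 0).
  { apply linmap_neq_0; auto. apply Rgt_not_eq, cross_plus. }
  assert (H2 : linmap a1 (- Ci * a2) X <> 0).
  { apply linmap_neq_0; auto. apply Rlt_not_eq, cross_minus. }
  rewrite RtoC_mult, !RtoC_div by (try apply PI_neq0; lra).
  replace (Ci / 4 * (a1 * a2) * (Ci * (2 / PI)))%C
    with ((Ci * Ci) * (a1 * a2) * 2 / (4 * PI))%C.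
  2:{ field. repeat split; auto; apply RtoC_neq_0; lra. }
  rewrite Ci_sqr. field. repeat split; auto; apply RtoC_neq_0; lra.
Qed.

(** [p] and [q] are the partial derivatives of L+ and L- in one coordinate direction, so the second
    hypothesis is the Leibniz rule for Q = L+ L-. The partial derivative of Q is O(|X|), which turns
    the previous remainder estimate into a bound. *)
Lemma grad_kernel_remainder (eps p q : C) (pr : C -> R) (rho : R) :
  (forall X, Rabs (pr X) <= Cmod X) ->
  (forall X, p * linmap a1 (- Ci * a2) X + q * linmap a1 (Ci * a2) X
             = RtoC 2 * eps * RtoC (pr X))%C ->
  exists M, 0 < M /\ forall X : C, X <> 0 -> Cmod X <= rho ->
    Cmod (kernel_deriv (quad X) * (RtoC 2 * eps * RtoC (pr X)) - sing_part p q X)%C <= M.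
Proof.
  intros Hpr Hpq. destruct (kernel_deriv_remainder rho) as [M [HM H]].
  assert (He : 0 <= Cmod (RtoC 2 * eps)%C) by apply Cmod_ge_0.
  exists (M * (Cmod (RtoC 2 * eps)%C + 1)). split; [apply Rmult_lt_0_compat; lra|].
  intros X HX Hr. rewrite sing_part_eq, Hpq by auto.
  replace (_ - _)%C with ((kernel_deriv (quad X) - coef0 * alpha * (RtoC (1 / 2) / quad X))
    * (RtoC 2 * eps * RtoC (pr X)))%C by ring.
  rewrite !Cmod_mult with (y := (_ * RtoC (pr X))%C).
  rewrite Cmod_mult with (y := RtoC (pr X)), Cmod_R.
  specialize (H X HX Hr). specialize (Hpr X).
  set (z := Cmod (_ - _)%C) in *. assert (Hz : 0 <= z) by apply Cmod_ge_0.
  apply Rle_trans with (z * Cmod X * Cmod (RtoC 2 * eps)%C).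
  - rewrite Rmult_assoc. apply Rmult_le_compat_l; auto. rewrite Rmult_comm.
    apply Rmult_le_compat_r; auto.
  - assert (0 <= z * Cmod X) by (apply Rmult_le_pos; auto; apply Cmod_ge_0).
    apply Rmult_le_compat; auto; lra.
Qed.

Lemma grad_kernel1_remainder (rho : R) : exists M, 0 < M /\
  forall X : C, X <> 0 -> Cmod X <= rho ->
    Cmod (grad_kernel1 X - sing_part a1 a1 X)%C <= M.
Proof.
  apply (grad_kernel_remainder eps1 a1 a1 fst); [exact fst_le_Cmod|].
  intros X. rewrite <- (sqrt_cut_sqr eps1 Him1). fold a1. unfold linmap. ring.
Qed.

Lemma grad_kernel2_remainder (rho : R) : exists M, 0 < M /\
  forall X : C, X <> 0 -> Cmod X <= rho ->
    Cmod (grad_kernel2 X - sing_part (Ci * a2) (- Ci * a2) X)%C <= M.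
Proof.
  apply (grad_kernel_remainder eps2 (Ci * a2) (- Ci * a2) snd); [exact snd_le_Cmod|].
  intros X. rewrite <- (sqrt_cut_sqr eps2 Him2). fold a2. unfold linmap.
  transitivity (- (2) * (Ci * Ci) * (a2 * a2) * RtoC (snd X))%C; [ring|].
  rewrite Ci_sqr. ring.
Qed.

End Kernel.

(** * Periodic functions and regular closed curves *)

Lemma periodic_Z {A : Type} (f : R -> A) (T : R) :
  (forall t, f (t + T) = f t) -> forall (k : Z) (t : R), f (t + IZR k * T) = f t.
Proof.
  intros Hf.
  assert (Hn : forall (n : nat) t, f (t + INR n * T) = f t).
  { induction n as [|n IH]; intros t.
    - simpl. f_equal. ring.
    - rewrite S_INR. replace (t + (INR n + 1) * T) with (t + INR n * T + T) by ring.
      now rewrite Hf. }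
  intros k t. destruct (Z_le_gt_dec 0 k) as [Hk|Hk].
  - rewrite <- (Z2Nat.id k) by auto. rewrite <- INR_IZR_INZ. apply Hn.
  - rewrite <- (Hn (Z.to_nat (- k))). f_equal. rewrite INR_IZR_INZ, Z2Nat.id by lia.
    rewrite opp_IZR. ring.
Qed.

Lemma period_reduce (T a t : R) : 0 < T -> exists k : Z, a <= t + IZR k * T < a + T.
Proof.
  intros HT. exists (- Int_part ((t - a) / T))%Z.
  destruct (base_Int_part ((t - a) / T)) as [H1 H2].
  set (r := IZR (Int_part ((t - a) / T))) in *.
  rewrite opp_IZR. fold r.
  assert (E : t - a = (t - a) / T * T) by (field; lra).
  set (q := (t - a) / T) in *. split; nra.
Qed.

(** C^2 regularity is recorded as a Lipschitz constant [B] of the derivative, the form in which the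
    estimates use it. *)
Definition regular_curve (g g' : R -> C) (T B : R) : Prop :=
  0 < T /\ 0 < B /\
  (forall t, is_Cderive g t (g' t)) /\
  (forall s t, Cmod (g' s - g' t)%C <= B * Rabs (s - t)) /\
  (forall t, g (t + T) = g t) /\
  (forall s t, 0 <= s < T -> 0 <= t < T -> g s = g t -> s = t) /\
  (forall t, g' t <> 0).

(** The tangent turned by + PI / 2. Whether it points out of the domain depends on the orientation
    and is settled in [sides] by a global sign. *)
Definition normal (g' : R -> C) (t : R) : C := (Ci * g' t / RtoC (Cmod (g' t)))%C.

Lemma is_Cderive_continuous (f : R -> C) (t : R) (d : C) :
  is_Cderive f t d -> continuous f t.
Proof.
  intros [H1 H2].
  apply continuous_C; apply (@ex_derive_continuous R_AbsRing R_NormedModule);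
    eexists; eassumption.
Qed.

Lemma is_Cderive_unique (f : R -> C) (t : R) (d e : C) :
  is_Cderive f t d -> is_Cderive f t e -> d = e.
Proof.
  intros [H1 H2] [H3 H4]. apply injective_projections.
  - rewrite <- (is_derive_unique _ _ _ H1). now apply is_derive_unique.
  - rewrite <- (is_derive_unique _ _ _ H2). now apply is_derive_unique.
Qed.

Lemma is_Cderive_periodic (f d : R -> C) (T : R) :
  (forall t, f (t + T) = f t) -> (forall t, is_Cderive f t (d t)) ->
  forall t, d (t + T) = d t.
Proof.
  intros Hf Hd t. apply is_Cderive_unique with f t; auto.
  apply is_Cderive_bound. intros e He.
  destruct (proj1 (is_Cderive_bound _ _ _) (Hd (t + T)) e He) as [r [Hr Hb]].
  exists r. split; auto. intros h Hh. specialize (Hb h Hh).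
  replace (t + T + h) with (t + h + T) in Hb by ring. now rewrite !Hf in Hb.
Qed.

Lemma periodic_Cderive_lipschitz (f d : R -> C) (T : R) :
  0 < T -> (forall t, f (t + T) = f t) ->
  (forall t, is_Cderive f t (d t)) -> (forall t, continuous d t) ->
  exists L, 0 < L /\ forall s t, Cmod (f s - f t)%C <= L * Rabs (s - t).
Proof.
  intros HT Hf Hd Hc.
  assert (Hdp := is_Cderive_periodic f d T Hf Hd).
  assert (Hcp : forall c, 0 <= c <= T -> continuity_pt (fun s => Cmod (d s)) c).
  { intros c _. apply continuity_pt_filterlim. apply (continuous_Cmod d c), Hc. }
  destruct (continuity_ab_maj (fun s => Cmod (d s)) 0 T (Rlt_le _ _ HT) Hcp) as [m [Hm _]].
  assert (Hbd : forall t, Cmod (d t) <= Cmod (d m)).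
  { intros t. destruct (period_reduce T 0 t HT) as [k Hk].
    rewrite <- (periodic_Z d T Hdp k t). apply Hm. lra. }
  exists (2 * Cmod (d m) + 1). split; [assert (H := Cmod_ge_0 (d m)); lra|].
  intros s t.
  assert (Haux : forall F dF : R -> R, (forall x, is_derive F x (dF x)) ->
    (forall x, Rabs (dF x) <= Cmod (d m)) -> Rabs (F s - F t) <= Cmod (d m) * Rabs (s - t)).
  { intros F dF HF Hl. destruct (MVT_gen F t s dF) as [c [_ E]].
    - intros x _. apply HF.
    - intros x _. apply derivable_continuous_pt. exists (dF x). apply is_derive_Reals, HF.
    - rewrite E, Rabs_mult. apply Rmult_le_compat_r; [apply Rabs_pos | apply Hl]. }
  eapply Rle_trans; [apply Cmod_le_abs|].
  assert (H1 := Haux (fun s => fst (f s)) (fun s => fst (d s)) (fun s => proj1 (Hd s))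
     (fun s => Rle_trans _ _ _ (fst_le_Cmod (d s)) (Hbd s))).
  assert (H2 := Haux (fun s => snd (f s)) (fun s => snd (d s)) (fun s => proj2 (Hd s))
     (fun s => Rle_trans _ _ _ (snd_le_Cmod (d s)) (Hbd s))).
  assert (H0 := Rabs_pos (s - t)).
  simpl in *. unfold Rminus in *. lra.
Qed.

Lemma periodic_lipschitz_bounded (f : R -> C) (T L : R) :
  0 < T -> 0 < L -> (forall t, f (t + T) = f t) ->
  (forall s t, Cmod (f s - f t)%C <= L * Rabs (s - t)) ->
  forall t, Cmod (f t) <= Cmod (f 0) + L * T.
Proof.
  intros HT HL Hf Hl t. destruct (period_reduce T 0 t HT) as [k Hk].
  rewrite <- (periodic_Z f T Hf k t). set (s := t + IZR k * T) in *.
  assert (H1 := Hl s 0). rewrite Rminus_0_r, Rabs_pos_eq in H1 by lra.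
  assert (H2 := Cmod_triangle_rev (f s) (f 0)).
  assert (L * s <= L * T) by (apply Rmult_le_compat_l; lra). lra.
Qed.

Section Curve.

Variables (g g' : R -> C) (T B : R).
Hypothesis Hg : regular_curve g g' T B.

Let HT : 0 < T := proj1 Hg.
Let HB : 0 < B := proj1 (proj2 Hg).
Let Hder := proj1 (proj2 (proj2 Hg)).
Let Hlip := proj1 (proj2 (proj2 (proj2 Hg))).
Let Hper := proj1 (proj2 (proj2 (proj2 (proj2 Hg)))).
Let Hinj := proj1 (proj2 (proj2 (proj2 (proj2 (proj2 Hg))))).
Let Hreg := proj2 (proj2 (proj2 (proj2 (proj2 (proj2 Hg))))).

Lemma curve_continuous (t : R) : continuous g t.
Proof. apply is_Cderive_continuous with (g' t), Hder. Qed.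

Lemma curve_deriv_continuous (t : R) : continuous g' t.
Proof.
  apply continuous_Cmod_lt. intros e He.
  assert (Hd : 0 < e / B) by now apply Rdiv_lt_0_compat.
  exists (mkposreal _ Hd). intros s Hs. change (Rabs (s - t) < e / B) in Hs.
  eapply Rle_lt_trans; [apply Hlip|].
  apply (Rmult_lt_compat_l B) in Hs; auto. unfold Rdiv in Hs.
  rewrite (Rmult_comm e), <- Rmult_assoc, Rinv_r, Rmult_1_l in Hs by lra. exact Hs.
Qed.

Lemma curve_deriv_periodic (t : R) : g' (t + T) = g' t.
Proof. now apply (is_Cderive_periodic g g' T). Qed.

Lemma Cmod_deriv_pos (t : R) : 0 < Cmod (g' t).
Proof. apply Cmod_gt_0, Hreg. Qed.

Lemma normal_continuous (t : R) : continuous (normal g') t.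
Proof.
  assert (Hc := curve_deriv_continuous t).
  unfold normal. prove_continuous.
  apply RtoC_neq_0, Rgt_not_eq, Cmod_deriv_pos.
Qed.

Lemma Cmod_normal (t : R) : Cmod (normal g' t) = 1.
Proof.
  assert (H := Cmod_deriv_pos t). unfold normal.
  rewrite Cmod_div by (apply RtoC_neq_0; lra).
  rewrite Cmod_mult, Cmod_Ci, Cmod_R, Rabs_pos_eq by lra. field. lra.
Qed.

(** The mean value theorem is applied to each coordinate, whence 2 B. *)
Lemma curve_taylor (t u : R) :
  Cmod (g (t + u)%R - g t - RtoC u * g' t)%C <= 2 * B * u ^ 2.
Proof.
  assert (Haux : forall f f' : R -> R, (forall s, is_derive f s (f' s)) ->
    (forall s, Rabs (f' s - f' t) <= B * Rabs (s - t)) ->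
    Rabs (f (t + u) - f t - u * f' t) <= B * u ^ 2).
  { intros f f' Hd Hl. destruct (MVT_gen f t (t + u) f') as [c [Hc E]].
    - intros x _. apply Hd.
    - intros x _. apply derivable_continuous_pt. exists (f' x). apply is_derive_Reals, Hd.
    - rewrite E. replace (f' c * (t + u - t) - u * f' t) with (u * (f' c - f' t)) by ring.
      rewrite Rabs_mult.
      assert (Hcu : Rabs (c - t) <= Rabs u).
      { unfold Rmin, Rmax in Hc. destruct (Rle_dec t (t + u)); unfold Rabs;
          destruct (Rcase_abs (c - t)); destruct (Rcase_abs u); lra. }
      specialize (Hl c). assert (H0 := Rabs_pos u).
      rewrite <- (pow2_abs u). simpl. rewrite Rmult_1_r.
      apply Rle_trans with (Rabs u * (B * Rabs u)); [|lra].
      apply Rmult_le_compat_l; auto. eapply Rle_trans; [exact Hl|].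
      apply Rmult_le_compat_l; lra. }
  eapply Rle_trans; [apply Cmod_le_abs|].
  assert (H1 := Haux (fun s => fst (g s)) (fun s => fst (g' s)) (fun s => proj1 (Hder s))
     (fun s => Rle_trans _ _ _ (fst_le_Cmod (g' s - g' t)) (Hlip s t))).
  assert (H2 := Haux (fun s => snd (g s)) (fun s => snd (g' s)) (fun s => proj2 (Hder s))
     (fun s => Rle_trans _ _ _ (snd_le_Cmod (g' s - g' t)) (Hlip s t))).
  simpl in *.
  replace (fst (g (t + u)) + - fst (g t) + - (u * fst (g' t) - 0 * snd (g' t)))
    with (fst (g (t + u)) - fst (g t) - u * fst (g' t)) by ring.
  replace (snd (g (t + u)) + - snd (g t) + - (u * snd (g' t) + 0 * fst (g' t)))
    with (snd (g (t + u)) - snd (g t) - u * snd (g' t)) by ring.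
  lra.
Qed.

Lemma curve_deriv_bounds :
  exists m M, 0 < m /\ 0 < M /\ forall t, m <= Cmod (g' t) <= M.
Proof.
  assert (Hcp : forall c, 0 <= c <= T -> continuity_pt (fun s => Cmod (g' s)) c).
  { intros c _. apply continuity_pt_filterlim.
    apply (continuous_Cmod g' c), curve_deriv_continuous. }
  destruct (continuity_ab_min (fun s => Cmod (g' s)) 0 T (Rlt_le _ _ HT) Hcp) as [a [Ha _]].
  destruct (continuity_ab_maj (fun s => Cmod (g' s)) 0 T (Rlt_le _ _ HT) Hcp) as [b [Hb _]].
  exists (Cmod (g' a)), (Cmod (g' b)). split; [apply Cmod_deriv_pos|].
  split; [apply Cmod_deriv_pos|]. intros t.
  destruct (period_reduce T 0 t HT) as [k Hk].
  rewrite <- (periodic_Z g' T curve_deriv_periodic k t).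
  split; [apply Ha | apply Hb]; lra.
Qed.

Lemma curve_lipschitz : exists L, 0 < L /\ forall s t, Cmod (g s - g t)%C <= L * Rabs (s - t).
Proof. exact (periodic_Cderive_lipschitz g g' T HT Hper Hder curve_deriv_continuous). Qed.

Lemma curve_inj (s t : R) : g s = g t -> exists k : Z, s = t + IZR k * T.
Proof.
  intros E. destruct (period_reduce T 0 s HT) as [k Hk].
  destruct (period_reduce T 0 t HT) as [l Hl].
  assert (H : s + IZR k * T = t + IZR l * T).
  { apply Hinj; try lra. now rewrite !periodic_Z. }
  exists (l - k)%Z. rewrite minus_IZR. lra.
Qed.

(** Injectivity made quantitative and uniform: for u in [d, T - d] the difference u of the
    parameters is not a multiple of T, so the distance is positive. Compactness is used first in
    [u], then in [t], the Lipschitz bound carrying each estimate to neighbouring parameters. *)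
Lemma curve_far (d : R) : 0 < d -> exists m, 0 < m /\
  forall t u, d <= u <= T - d -> m <= Cmod (g (t + u)%R - g t)%C.
Proof.
  intros Hd. destruct curve_lipschitz as [L [HL Hlg]].
  assert (Hloc : exists e, 0 < e /\ forall t, 0 <= t <= T ->
    forall u, d <= u <= T - d -> e <= Cmod (g (t + u)%R - g t)%C).
  { apply (compact_uniform 0 T (fun t e => forall u, d <= u <= T - d -> e <= Cmod (g (t + u)%R - g t)%C)).
    - intros y e e' H He u Hu. specialize (H u Hu). lra.
    - intros t _.
      assert (Hu : exists e, 0 < e /\ forall u, d <= u <= T - d -> e <= Cmod (g (t + u)%R - g t)%C).
      { apply (compact_uniform d (T - d) (fun u e => e <= Cmod (g (t + u)%R - g t)%C)).
        - intros; lra.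
        - intros u Hu. set (r := Cmod (g (t + u)%R - g t)%C).
          assert (Hr : 0 < r).
          { apply Cmod_gt_0. intros E.
            assert (E' : g (t + u) = g t).
            { replace (g (t + u)) with (g (t + u)%R - g t + g t)%C by ring. rewrite E. ring. }
            destruct (curve_inj _ _ E') as [k Hk].
            assert (0 < IZR k) by (apply Rmult_lt_reg_r with T; lra).
            assert (IZR k < 1) by (apply Rmult_lt_reg_r with T; lra).
            apply (lt_IZR 0) in H. apply (lt_IZR _ 1) in H0. lia. }
          exists (Rmin (r / 2) (r / 2 / L)). split.
          { apply Rmin_pos; [lra|]. apply Rdiv_lt_0_compat; lra. }
          intros y _ Hy. assert (Hy2 := Rlt_le_trans _ _ _ Hy (Rmin_r _ _)).
          eapply Rle_trans; [apply Rmin_l|].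
          assert (Hd1 : Cmod (g (t + u)%R - g (t + y)%R)%C <= r / 2).
          { eapply Rle_trans; [apply Hlg|].
            replace (t + u - (t + y)) with (- (y - u)) by ring. rewrite Rabs_Ropp.
            apply Rlt_le in Hy2. apply (Rmult_le_compat_l L) in Hy2; [|lra].
            replace (L * (r / 2 / L)) with (r / 2) in Hy2 by (field; lra). exact Hy2. }
          assert (Ht := Cmod_triangle (g (t + u)%R - g (t + y)%R) (g (t + y)%R - g t)).
          replace (g (t + u)%R - g (t + y)%R + (g (t + y)%R - g t))%C
            with (g (t + u)%R - g t)%C in Ht by ring.
          fold r in Ht. lra. }
      destruct Hu as [r [Hr Hu]].
      exists (Rmin (r / 2) (r / 2 / (2 * L))). split.
      { apply Rmin_pos; [lra|]. apply Rdiv_lt_0_compat; lra. }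
      intros y _ Hy u Hud. assert (Hy2 := Rlt_le_trans _ _ _ Hy (Rmin_r _ _)).
      eapply Rle_trans; [apply Rmin_l|].
      assert (Hy3 : 2 * L * Rabs (y - t) <= r / 2).
      { apply Rlt_le in Hy2. apply (Rmult_le_compat_l (2 * L)) in Hy2; [|lra].
        replace (2 * L * (r / 2 / (2 * L))) with (r / 2) in Hy2 by (field; lra). exact Hy2. }
      specialize (Hu u Hud).
      assert (H1 := Hlg (t + u) (y + u)). replace (t + u - (y + u)) with (- (y - t)) in H1 by ring.
      assert (H2 := Hlg y t). rewrite Rabs_Ropp in H1.
      assert (Ht := Cmod_triangle (g (t + u)%R - g (y + u)%R + (g y - g t)) (g (y + u)%R - g y)).
      assert (Ht2 := Cmod_triangle (g (t + u)%R - g (y + u)%R) (g y - g t)).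
      replace (g (t + u)%R - g (y + u)%R + (g y - g t) + (g (y + u)%R - g y))%C
        with (g (t + u)%R - g t)%C in Ht by ring.
      lra. }
  destruct Hloc as [e [He H]]. exists e. split; auto. intros t u Hu.
  destruct (period_reduce T 0 t HT) as [k Hk].
  rewrite <- (periodic_Z g T Hper k t), <- (periodic_Z g T Hper k (t + u)).
  replace (t + u + IZR k * T) with (t + IZR k * T + u) by ring.
  apply H; lra.
Qed.

(** The vector from a point of the tangent line at [g t] to the point at height [h] on the normal;
    [chord] below is the same with the curve itself. *)
Definition chord_model (t h u : R) : C := (RtoC h * normal g' t - RtoC u * g' t)%C.

(** Tangent and normal are orthogonal: up to a rotation the vector is (- u |g'|, h). *)
Lemma chord_model_lower : exists c, 0 < c /\
  forall t h u, c * (Rabs h + Rabs u) <= Cmod (chord_model t h u).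
Proof.
  destruct curve_deriv_bounds as [m [M [Hm [HM Hb]]]].
  exists (Rmin 1 m / 2). split; [assert (0 < Rmin 1 m) by (apply Rmin_pos; lra); lra|].
  intros t h u. specialize (Hb t).
  assert (E : chord_model t h u = (((- (u * Cmod (g' t)))%R, h) * (g' t / RtoC (Cmod (g' t))))%C).
  { unfold chord_model, normal. set (r := Cmod (g' t)) in *.
    replace ((- (u * r), h) : C) with (- (RtoC u * RtoC r) + RtoC h * Ci)%C.
    2:{ unfold Ci, RtoC, Cmult, Copp, Cplus; simpl. f_equal; ring. }
    field. apply RtoC_neq_0. lra. }
  rewrite E, Cmod_mult, Cmod_div by (apply RtoC_neq_0; lra).
  rewrite Cmod_R, (Rabs_pos_eq (Cmod (g' t))) by lra.
  replace (Cmod (g' t) / Cmod (g' t)) with 1 by (field; lra). rewrite Rmult_1_r.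
  assert (H1 := fst_le_Cmod (- (u * Cmod (g' t)), h)).
  assert (H2 := snd_le_Cmod (- (u * Cmod (g' t)), h)).
  simpl in H1, H2. rewrite Rabs_Ropp, Rabs_mult, (Rabs_pos_eq (Cmod (g' t))) in H1 by lra.
  assert (m1 := Rmin_l 1 m). assert (m2 := Rmin_r 1 m).
  assert (p1 := Rabs_pos h). assert (p2 := Rabs_pos u).
  assert (Rmin 1 m * Rabs h <= 1 * Rabs h) by (apply Rmult_le_compat_r; auto).
  assert (Rmin 1 m * Rabs u <= Cmod (g' t) * Rabs u) by (apply Rmult_le_compat_r; lra).
  lra.
Qed.

Definition chord (t h u : R) : C := (g t + RtoC h * normal g' t - g (t + u)%R)%C.

Lemma chord_chord_model (t h u : R) : Cmod (chord t h u - chord_model t h u)%C <= 2 * B * u ^ 2.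
Proof.
  unfold chord, chord_model. rewrite <- Cmod_opp.
  replace (- (g t + RtoC h * normal g' t - g (t + u)%R - (RtoC h * normal g' t - RtoC u * g' t)))%C
    with (g (t + u)%R - g t - RtoC u * g' t)%C by ring.
  apply curve_taylor.
Qed.

(** For small [u] the chord is a perturbation of order u^2 of the model, absorbed by half of the
    model bound. For the other [u] the curve is at distance at least [m] from [g t], and a height of
    at most m / 2 cannot close that gap. *)
Lemma chord_lower : exists c h0, 0 < c /\ 0 < h0 /\
  forall t h u, Rabs h <= h0 -> Rabs u <= T / 2 -> c * (Rabs h + Rabs u) <= Cmod (chord t h u).
Proof.
  destruct chord_model_lower as [c [Hc Hm]].
  set (d := Rmin (c / (4 * B)) (T / 2)).
  assert (Hd : 0 < d) by (apply Rmin_pos; [apply Rdiv_lt_0_compat|]; lra).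
  destruct (curve_far d Hd) as [m [Hmp Hf]].
  (* The second entry is the distance m / 2 divided by the largest possible |h| + |u|. *)
  set (c' := Rmin (c / 2) (m / 2 / (m / 2 + T / 2))).
  assert (Hc' : 0 < c').
  { apply Rmin_pos; [lra|]. apply Rdiv_lt_0_compat; lra. }
  exists c', (m / 2). split; auto. split; [lra|].
  intros t h u Hh Hu. assert (p1 := Rabs_pos h). assert (p2 := Rabs_pos u).
  destruct (Rle_lt_dec (Rabs u) d) as [Hud|Hud].
  - assert (H1 := chord_chord_model t h u). specialize (Hm t h u).
    assert (H2 := Cmod_triangle_rev (chord_model t h u) (chord t h u)).
    rewrite Cmod_minus_sym in H2.
    assert (H4 : 2 * B * u ^ 2 <= c / 2 * Rabs u).
    { rewrite <- pow2_abs. simpl. rewrite Rmult_1_r, <- Rmult_assoc.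
      apply Rmult_le_compat_r; auto.
      assert (Hd1 : Rabs u <= c / (4 * B)) by (eapply Rle_trans; [exact Hud | apply Rmin_l]).
      apply (Rmult_le_compat_l (2 * B)) in Hd1; [|lra].
      replace (2 * B * (c / (4 * B))) with (c / 2) in Hd1 by (field; lra). exact Hd1. }
    assert (H5 : c' * (Rabs h + Rabs u) <= c / 2 * (Rabs h + Rabs u))
      by (apply Rmult_le_compat_r; [lra | apply Rmin_l]).
    nra.
  - assert (Hfar : m <= Cmod (g t - g (t + u)%R)%C).
    {
      rewrite Cmod_minus_sym. destruct (Rle_lt_dec 0 u) as [Hs|Hs].
      - rewrite Rabs_pos_eq in * by lra. apply Hf. lra.
      - rewrite Rabs_left in * by lra. rewrite <- (Hper (t + u)).
        replace (t + u + T) with (t + (u + T)) by ring. apply Hf. lra. }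
    assert (H1 := Cmod_triangle (chord t h u) (- (RtoC h * normal g' t))).
    replace (chord t h u + - (RtoC h * normal g' t))%C with (g t - g (t + u)%R)%C in H1
      by (unfold chord; ring).
    rewrite Cmod_opp, Cmod_mult, Cmod_R, Cmod_normal, Rmult_1_r in H1.
    apply Rle_trans with (m / 2); [|lra].
    apply Rle_trans with (m / 2 / (m / 2 + T / 2) * (m / 2 + T / 2)).
    + apply Rmult_le_compat; try lra. apply Rmin_r.
    + apply Req_le. field. lra.
Qed.

(** [s] selects one of the two arcs leaving [g t]. With A the chord up to [u] and D the increment
    from [u] to [v], a nonnegative inner product of A and D together with D <> 0 gives |A| < |A +
    D|. *)
Lemma chord_increasing : exists d, 0 < d <= T / 2 /\
  forall t s u v, s = 1 \/ s = -1 -> 0 <= u < v -> v <= d ->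
    Cmod (g (t + s * u)%R - g t)%C < Cmod (g (t + s * v)%R - g t)%C.
Proof.
  destruct curve_deriv_bounds as [m [M [Hm [HM Hb]]]].
  destruct chord_lower as [c [h0 [Hc [Hh0 Hch]]]].
  (* This makes the deviations of A and D from multiples of [g' t] at most a quarter of their size,
     and 1 / 4 + 1 / 4 + 1 / 16 < 1 leaves the inner product nonnegative. *)
  set (d := Rmin (T / 2) (m / (12 * B))).
  assert (Hd : 0 < d) by (apply Rmin_pos; [lra|]; apply Rdiv_lt_0_compat; lra).
  assert (Hd1 : d <= T / 2) by apply Rmin_l.
  assert (Hd2 : 3 * B * d <= m / 4).
  { assert (H := Rmin_r (T / 2) (m / (12 * B))). fold d in H.
    apply (Rmult_le_compat_l (3 * B)) in H; [|lra].
    replace (3 * B * (m / (12 * B))) with (m / 4) in H by (field; lra). exact H. }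
  exists d. split; [lra|]. intros t s u v Hs Huv Hv.
  assert (Hss : s * s = 1) by (destruct Hs as [-> | ->]; ring).
  assert (Hsabs : Rabs s = 1).
  { destruct Hs as [-> | ->]; [apply Rabs_R1 | rewrite Rabs_left; lra]. }
  set (A := (g (t + s * u)%R - g t)%C). set (D := (g (t + s * v)%R - g (t + s * u)%R)%C).
  replace (g (t + s * v)%R - g t)%C with (A + D)%C by (unfold A, D; ring).
  assert (HD : 0 < Cmod D).
  { assert (H := Hch (t + s * u) 0 (s * (v - u))). rewrite Rabs_R0, Rabs_mult, Hsabs, Rmult_1_l in H.
    unfold chord in H. replace (t + s * u + s * (v - u)) with (t + s * v) in H by ring.
    replace (g (t + s * u)%R + RtoC 0 * normal g' (t + s * u)%R - g (t + s * v)%R)%C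
      with (- D)%C in H by (unfold D; ring). rewrite Cmod_opp in H.
    rewrite Rabs_pos_eq in H by lra.
    eapply Rlt_le_trans; [|apply H; lra]. apply Rmult_lt_0_compat; lra. }
  (* Both increments are nearly parallel to [g' t]. *)
  set (e1 := (A - RtoC (s * u) * g' t)%C).
  set (e2 := (D - RtoC (s * (v - u)) * g' t)%C).
  assert (He1 : Cmod e1 <= u * (m / 4)).
  { assert (H := curve_taylor t (s * u)). fold A in H. unfold e1.
    eapply Rle_trans; [exact H|].
    replace (2 * B * (s * u) ^ 2) with (u * (2 * B * u) * (s * s)) by ring. rewrite Hss, Rmult_1_r.
    apply Rmult_le_compat_l; [lra|]. nra. }
  assert (He2 : Cmod e2 <= (v - u) * (m / 4)).
  { assert (H := curve_taylor (t + s * u) (s * (v - u))).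
    replace (t + s * u + s * (v - u)) with (t + s * v) in H by ring. fold D in H.
    assert (H2 := Hlip (t + s * u) t).
    replace (t + s * u - t) with (s * u) in H2 by ring.
    rewrite Rabs_mult, Hsabs, Rmult_1_l, Rabs_pos_eq in H2 by lra.
    replace e2 with ((D - RtoC (s * (v - u)) * g' (t + s * u)%R)
                     + RtoC (s * (v - u)) * (g' (t + s * u)%R - g' t))%C by (unfold e2; ring).
    eapply Rle_trans; [apply Cmod_triangle|].
    rewrite Cmod_mult, Cmod_R, Rabs_mult, Hsabs, Rmult_1_l, (Rabs_pos_eq (v - u)) by lra.
    replace (2 * B * (s * (v - u)) ^ 2) with ((v - u) * (2 * B * (v - u)) * (s * s)) in H by ring.
    rewrite Hss, Rmult_1_r in H.
    apply Rle_trans with ((v - u) * (2 * B * (v - u)) + (v - u) * (B * u)).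
    - apply Rplus_le_compat; auto. apply Rmult_le_compat_l; lra.
    - rewrite <- Rmult_plus_distr_l. apply Rmult_le_compat_l; [lra|]. nra. }
  specialize (Hb t).
  set (G := g' t) in *. set (r := Cmod G) in *.
  assert (Hre : 0 <= Re (Cconj A * D)%C).
  { replace A with (RtoC (s * u) * G + e1)%C by (unfold e1; ring).
    replace D with (RtoC (s * (v - u)) * G + e2)%C by (unfold e2; ring).
    assert (E : Re (Cconj (RtoC (s * u) * G + e1) * (RtoC (s * (v - u)) * G + e2))%C =
       (s * s) * u * (v - u) * (r * r) + Re (RtoC (s * u) * (Cconj G * e2))%C
       + Re (RtoC (s * (v - u)) * (Cconj e1 * G))%C + Re (Cconj e1 * e2)%C).
    { assert (Hr : r * r = fst G * fst G + snd G * snd G).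
      { unfold r, Cmod. rewrite sqrt_sqrt; [ring|].
        apply Rplus_le_le_0_compat; apply pow2_ge_0. }
      rewrite Hr. unfold Re, Cconj; simpl. ring. }
    rewrite E, Hss.
    assert (Hlow : forall z : C, - Cmod z <= Re z).
    { intros z. assert (H := re_le_Cmod z). unfold Rabs in H. destruct (Rcase_abs (Re z)); lra. }
    assert (L1 := Hlow (RtoC (s * u) * (Cconj G * e2))%C).
    assert (L2 := Hlow (RtoC (s * (v - u)) * (Cconj e1 * G))%C).
    assert (L3 := Hlow (Cconj e1 * e2)%C).
    rewrite !Cmod_mult, Cmod_R, !Cmod_conj, Rabs_mult, Hsabs, Rmult_1_l in L1, L2.
    rewrite Cmod_mult, Cmod_conj in L3. fold r in L1, L2.
    rewrite Rabs_pos_eq in L1, L2 by lra.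
    assert (P0 : 0 <= u * (v - u)) by (apply Rmult_le_pos; lra).
    assert (Q1 : u * (r * Cmod e2) <= u * (v - u) * (r * (r / 4))).
    { replace (u * (v - u) * (r * (r / 4))) with (u * (r * ((v - u) * (r / 4)))) by ring.
      apply Rmult_le_compat_l; [lra|]. apply Rmult_le_compat_l; [lra|].
      eapply Rle_trans; [exact He2|]. apply Rmult_le_compat_l; lra. }
    assert (Q2 : (v - u) * (Cmod e1 * r) <= u * (v - u) * (r * (r / 4))).
    { replace (u * (v - u) * (r * (r / 4))) with ((v - u) * (u * (r / 4) * r)) by ring.
      apply Rmult_le_compat_l; [lra|]. apply Rmult_le_compat_r; [lra|].
      eapply Rle_trans; [exact He1|]. apply Rmult_le_compat_l; lra. }
    assert (Q3 : Cmod e1 * Cmod e2 <= u * (v - u) * (r / 4 * (r / 4))).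
    { replace (u * (v - u) * (r / 4 * (r / 4))) with (u * (r / 4) * ((v - u) * (r / 4))) by ring.
      apply Rmult_le_compat; try apply Cmod_ge_0.
      - eapply Rle_trans; [exact He1|]. apply Rmult_le_compat_l; lra.
      - eapply Rle_trans; [exact He2|]. apply Rmult_le_compat_l; lra. }
    assert (Q4 : 0 <= u * (v - u) * (r * r)) by (apply Rmult_le_pos; [auto | nra]).
    lra. }
  unfold Cmod at 1 2. apply sqrt_lt_1_alt. split.
  - apply Rplus_le_le_0_compat; apply pow2_ge_0.
  - assert (HDD : 0 < fst D * fst D + snd D * snd D).
    { assert (Hne : D <> 0) by now apply Cmod_gt_0. apply C_neq_0_sqr in Hne. nra. }
    unfold Re, Cconj in Hre; simpl in *. nra.
Qed.

(** A small circle around [g t] meets each arc once: the intermediate value theorem provides the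
    crossing, monotonicity makes it unique up to [b], and beyond [b] the distance exceeds c b. The
    last estimate, r |g'| = d + O(r^2), is what later compares the two arcs. *)
Lemma cut_radius : exists d0 c, 0 < d0 /\ 0 < c /\
  forall t s d, s = 1 \/ s = -1 -> 0 < d < d0 ->
  exists r, 0 < r <= T / 2 /\ c * r <= d /\ Cmod (g (t + s * r)%R - g t)%C = d /\
    Rabs (r * Cmod (g' t) - d) <= 2 * B * r ^ 2 /\
    forall u, 0 <= u <= T / 2 -> (d < Cmod (g (t + s * u)%R - g t)%C <-> r < u).
Proof.
  destruct chord_increasing as [b [Hb Hinc]].
  destruct chord_lower as [c [h0 [Hc [Hh0 Hch]]]].
  exists (c * b), c. split; [apply Rmult_lt_0_compat; lra|]. split; auto.
  intros t s d Hs Hd.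
  assert (Hsabs : Rabs s = 1).
  { destruct Hs as [-> | ->]; [apply Rabs_R1 | rewrite Rabs_left; lra]. }
  assert (Hlow : forall u, 0 <= u <= T / 2 -> c * u <= Cmod (g (t + s * u)%R - g t)%C).
  { intros u Hu. assert (H := Hch t 0 (s * u)).
    rewrite Rabs_R0, Rabs_mult, Hsabs, Rmult_1_l, Rabs_pos_eq in H by lra.
    unfold chord in H. rewrite Cmod_minus_sym in H.
    replace (g (t + s * u)%R - (g t + RtoC 0 * normal g' t))%C
      with (g (t + s * u)%R - g t)%C in H by ring.
    rewrite Rplus_0_l in H. apply H; lra. }
  set (f := fun u => Cmod (g (t + s * u)%R - g t)%C - d).
  assert (Hf : continuity f).
  { intros u. apply continuity_pt_filterlim.
    assert (Hgc := curve_continuous).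
    change (continuous f u). unfold f. prove_continuous. }
  assert (Hf0 : f 0 < 0).
  { unfold f. rewrite Rmult_0_r, Rplus_0_r. replace (g t - g t)%C with (RtoC 0) by ring.
    rewrite Cmod_0. lra. }
  assert (Hfb : 0 < f b) by (unfold f; assert (H := Hlow b ltac:(lra)); lra).
  destruct (IVT f 0 b Hf ltac:(lra) Hf0 Hfb) as [r [Hr E]].
  assert (Er : Cmod (g (t + s * r)%R - g t)%C = d) by (unfold f in E; lra).
  assert (Hr0 : 0 < r).
  { destruct (proj1 Hr) as [H|H]; auto. rewrite <- H in E. lra. }
  exists r. split; [lra|]. split; [rewrite <- Er; apply Hlow; lra|].
  split; [exact Er|]. split.
  - rewrite <- Er. assert (H := curve_taylor t (s * r)).
    assert (Hss : s * s = 1) by (destruct Hs as [-> | ->]; ring).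
    replace (2 * B * (s * r) ^ 2) with (2 * B * r ^ 2 * (s * s)) in H by ring.
    rewrite Hss, Rmult_1_r in H. eapply Rle_trans; [|exact H].
    assert (E2 : Cmod (RtoC (s * r) * g' t)%C = r * Cmod (g' t)).
    { rewrite Cmod_mult, Cmod_R, Rabs_mult, Hsabs, Rmult_1_l, Rabs_pos_eq; lra. }
    rewrite <- E2.
    assert (T1 := Cmod_triangle_rev (g (t + s * r)%R - g t) (RtoC (s * r) * g' t)).
    assert (T2 := Cmod_triangle_rev (RtoC (s * r) * g' t) (g (t + s * r)%R - g t)).
    rewrite (Cmod_minus_sym (RtoC (s * r) * g' t)) in T2.
    apply Rabs_le. lra.
  - intros u Hu. destruct (Rle_lt_dec u b) as [Hub|Hub].
    + split; intros H.
      * apply Rnot_le_lt. intros [Hle|Hle].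
        -- assert (Hx := Hinc t s u r Hs ltac:(lra) ltac:(lra)). lra.
        -- rewrite Hle in H. lra.
      * rewrite <- Er. apply Hinc; auto; lra.
    + assert (H := Hlow u Hu). assert (c * b < c * u) by (apply Rmult_lt_compat_l; auto).
      split; intros; lra.
Qed.

(* The two arcs cut out by a small disc around [g t] have asymptotically equal
   lengths; this makes the Cauchy principal value independent of the choice
   between Euclidean and parameter-symmetric truncation. *)
Lemma cut_interval : exists d0 C0, 0 < d0 /\ 0 < C0 /\
  forall t d, 0 < d < d0 -> exists r1 r2,
    0 < r1 <= T / 2 /\ 0 < r2 <= T / 2 /\ r1 <= C0 * d /\ r2 <= C0 * d /\
    Rabs (ln r2 - ln r1) <= C0 * d /\
    forall u, - (T / 2) <= u <= T / 2 ->
      (d < Cmod (g (t + u)%R - g t)%C <-> u < - r1 \/ r2 < u).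
Proof.
  destruct cut_radius as [d0 [c [Hd0 [Hc Hcut]]]].
  destruct curve_deriv_bounds as [m [M [Hm [HM Hb]]]].
  destruct curve_lipschitz as [L [HL Hlg]].
  (* From |r2 - r1| <= 4 B d^2 / (m c^2) and r >= d / L: their quotient [D d] bounds the difference
     of the logarithms. *)
  set (D := 4 * B * L / (m * c ^ 2)).
  assert (Hmc : 0 < m * c ^ 2) by (apply Rmult_lt_0_compat; auto; apply pow_lt; auto).
  assert (HD : 0 < D) by (apply Rdiv_lt_0_compat; [repeat apply Rmult_lt_0_compat; lra | auto]).
  assert (Hic : 0 < / c) by now apply Rinv_0_lt_compat.
  exists d0, (/ c + D). split; auto. split; [lra|].
  intros t d Hd.
  destruct (Hcut t (-1) d ltac:(now right) Hd) as [r1 [H1 [C1 [E1 [T1 I1]]]]].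
  destruct (Hcut t 1 d ltac:(now left) Hd) as [r2 [H2 [C2 [E2 [T2 I2]]]]].
  assert (Hr : forall r, c * r <= d -> r <= / c * d).
  { intros r Hx. apply Rmult_le_reg_l with c; auto.
    rewrite <- Rmult_assoc, Rinv_r, Rmult_1_l by lra. exact Hx. }
  assert (R1 := Hr r1 C1). assert (R2 := Hr r2 C2).
  assert (HDd : 0 <= D * d) by (apply Rmult_le_pos; lra).
  assert (L1 : d <= L * r1).
  { rewrite <- E1. eapply Rle_trans; [apply Hlg|].
    replace (t + -1 * r1 - t) with (- r1) by ring. rewrite Rabs_Ropp, Rabs_pos_eq; lra. }
  assert (L2 : d <= L * r2).
  { rewrite <- E2. eapply Rle_trans; [apply Hlg|].
    replace (t + 1 * r2 - t) with r2 by ring. rewrite Rabs_pos_eq; lra. }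
  assert (Hsq : forall r, 0 < r -> c * r <= d -> r ^ 2 <= d ^ 2 / c ^ 2).
  { intros r Hr0 Hx. apply Rmult_le_reg_l with (c ^ 2); [apply pow_lt; auto|].
    replace (c ^ 2 * (d ^ 2 / c ^ 2)) with (d ^ 2) by (field; lra).
    rewrite <- Rpow_mult_distr. apply pow_incr. split; auto. apply Rmult_le_pos; lra. }
  assert (S1 := Hsq r1 ltac:(lra) C1). assert (S2 := Hsq r2 ltac:(lra) C2).
  assert (Hdiff : Rabs (r2 - r1) <= 4 * B * (d ^ 2 / c ^ 2) / m).
  { specialize (Hb t).
    apply Rmult_le_reg_r with m; auto.
    replace (4 * B * (d ^ 2 / c ^ 2) / m * m) with (4 * B * (d ^ 2 / c ^ 2)) by (field; lra).
    apply Rle_trans with (Rabs (r2 - r1) * Cmod (g' t)).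
    - apply Rmult_le_compat_l; [apply Rabs_pos | lra].
    - rewrite <- (Rabs_pos_eq (Cmod (g' t))) at 1 by lra. rewrite <- Rabs_mult.
      replace ((r2 - r1) * Cmod (g' t)) with ((r2 * Cmod (g' t) - d) - (r1 * Cmod (g' t) - d)) by ring.
      unfold Rminus at 1. eapply Rle_trans; [apply Rabs_triang|]. rewrite Rabs_Ropp.
      assert (2 * B * r1 ^ 2 <= 2 * B * (d ^ 2 / c ^ 2)) by (apply Rmult_le_compat_l; lra).
      assert (2 * B * r2 ^ 2 <= 2 * B * (d ^ 2 / c ^ 2)) by (apply Rmult_le_compat_l; lra).
      lra. }
  assert (Hln : forall x y, 0 < x -> 0 < y -> d <= L * x ->
            Rabs (y - x) <= 4 * B * (d ^ 2 / c ^ 2) / m -> ln y - ln x <= D * d).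
  { intros x y Hx Hy HLx Hxy.
    assert (Hq : 0 < y / x) by now apply Rdiv_lt_0_compat.
    assert (E : ln y - ln x = ln (y / x)) by (unfold Rdiv; rewrite ln_mult, ln_Rinv; auto;
      now apply Rinv_0_lt_compat).
    rewrite E. assert (He := exp_ineq1_le (ln (y / x))). rewrite exp_ln in He by auto.
    apply Rle_trans with (y / x - 1); [lra|].
    apply Rmult_le_reg_r with x; auto.
    replace ((y / x - 1) * x) with (y - x) by (field; lra).
    apply Rle_trans with (4 * B * (d ^ 2 / c ^ 2) / m).
    - eapply Rle_trans; [apply Rle_abs | exact Hxy].
    - replace (4 * B * (d ^ 2 / c ^ 2) / m) with (4 * B * d / (m * c ^ 2) * d) by (field; lra).
      replace (D * d * x) with (4 * B * d / (m * c ^ 2) * (L * x)) by (unfold D; field; lra).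
      apply Rmult_le_compat_l; auto. left. apply Rdiv_lt_0_compat; auto.
      repeat apply Rmult_lt_0_compat; lra. }
  exists r1, r2. split; auto. split; auto. split; [lra|]. split; [lra|]. split.
  - assert (X1 := Hln r1 r2 ltac:(lra) ltac:(lra) L1 Hdiff).
    rewrite Rabs_minus_sym in Hdiff.
    assert (X2 := Hln r2 r1 ltac:(lra) ltac:(lra) L2 Hdiff).
    apply Rabs_le. lra.
  - intros u Hu. destruct (Rle_lt_dec 0 u) as [Hs|Hs].
    + specialize (I2 u ltac:(lra)). rewrite Rmult_1_l in I2. rewrite I2. lra.
    + specialize (I1 (- u) ltac:(lra)). replace (-1 * - u) with u in I1 by ring.
      rewrite I1. lra.
Qed.

Lemma nearest_point (z : C) : exists t, forall s, Cmod (z - g t)%C <= Cmod (z - g s)%C.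
Proof.
  assert (Hcp : forall c, 0 <= c <= T -> continuity_pt (fun s => Cmod (z - g s)%C) c).
  { intros c _. apply continuity_pt_filterlim.
    assert (Hgc := curve_continuous).
    change (continuous (fun s => Cmod (z - g s)%C) c). prove_continuous. }
  destruct (continuity_ab_min _ 0 T (Rlt_le _ _ HT) Hcp) as [t [Ht _]].
  exists t. intros s. destruct (period_reduce T 0 s HT) as [k Hk].
  rewrite <- (periodic_Z g T Hper k s). apply Ht. lra.
Qed.

(** At a minimum of the squared distance the derivative vanishes, so z - g t is orthogonal to the
    tangent. *)
Lemma nearest_point_normal (z : C) (t : R) :
  (forall s, Cmod (z - g t)%C <= Cmod (z - g s)%C) ->
  exists h, z = (g t + RtoC h * normal g' t)%C.
Proof.
  intros Hmin. destruct (Hder t) as [H1 H2].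
  set (w := (z - g t)%C).
  assert (Hd : is_derive (fun s => (fst z - fst (g s)) ^ 2 + (snd z - snd (g s)) ^ 2) t
                 (- (2 * (fst w * fst (g' t) + snd w * snd (g' t))))).
  { assert (Haux : forall (f : R -> R) l x, is_derive f t l ->
       is_derive (fun s => (x - f s) ^ 2) t (2 * (x - f t) * (0 - l))).
    { intros f l x Hf. apply (is_derive_Rsqr (fun s => x - f s)).
      apply (@is_derive_minus R_AbsRing R_NormedModule (fun _ => x)); auto.
      apply (@is_derive_const R_AbsRing R_NormedModule). }
    evar_last.
    - apply (@is_derive_plus R_AbsRing R_NormedModule);
        [apply (Haux _ _ (fst z) H1) | apply (Haux _ _ (snd z) H2)].
    - unfold w; simpl. unfold plus; simpl. ring. }
  assert (Hz : - (2 * (fst w * fst (g' t) + snd w * snd (g' t))) = 0).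
  { apply is_derive_Reals in Hd.
    assert (pr := exist _ _ Hd : derivable_pt (fun s => (fst z - fst (g s)) ^ 2 + (snd z - snd (g s)) ^ 2) t).
    rewrite <- (deriv_minimum _ (t - 1) (t + 1) t pr); try lra.
    - symmetry. apply derive_pt_eq_0. exact Hd.
    - intros s _ _.
      assert (Hm := Hmin s). unfold Cmod in Hm. apply sqrt_le_0 in Hm; [exact Hm | |];
        apply Rplus_le_le_0_compat; apply pow2_ge_0. }
  assert (Hp := Cmod_deriv_pos t).
  set (r := Cmod (g' t)) in *.
  assert (Hr : r * r = fst (g' t) ^ 2 + snd (g' t) ^ 2).
  { unfold r, Cmod. apply sqrt_sqrt. nra. }
  exists ((fst (g' t) * snd w - snd (g' t) * fst w) / r).
  assert (E : w = (RtoC ((fst (g' t) * snd w - snd (g' t) * fst w) / r) * normal g' t)%C).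
  { unfold normal. fold r.
    replace (RtoC ((fst (g' t) * snd w - snd (g' t) * fst w) / r) * (Ci * g' t / RtoC r))%C
      with (RtoC ((fst (g' t) * snd w - snd (g' t) * fst w) / (r * r)) * (Ci * g' t))%C.
    2:{ rewrite !RtoC_div by (try apply Rmult_integral_contrapositive; lra).
        rewrite !RtoC_mult. field. apply RtoC_neq_0; lra. }
    set (k := (fst (g' t) * snd w - snd (g' t) * fst w) / (r * r)).
    assert (Hk : k * (r * r) = fst (g' t) * snd w - snd (g' t) * fst w).
    { unfold k. field. lra. }
    assert (Hrr : r * r <> 0) by (apply Rmult_integral_contrapositive; lra).
    assert (Hz' : fst w * fst (g' t) + snd w * snd (g' t) = 0) by lra.
    clearbody w k. apply injective_projections; simpl.
    - apply Rmult_eq_reg_r with (r * r); auto.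
      replace ((k * (0 * fst (g' t) - 1 * snd (g' t)) - 0 * (0 * snd (g' t) + 1 * fst (g' t))) * (r * r))
        with (- snd (g' t) * (k * (r * r))) by ring.
      rewrite Hk, Hr. apply Rminus_diag_uniq.
      transitivity (fst (g' t) * (fst w * fst (g' t) + snd w * snd (g' t))); [ring|].
      rewrite Hz'. ring.
    - apply Rmult_eq_reg_r with (r * r); auto.
      replace ((k * (0 * snd (g' t) + 1 * fst (g' t)) + 0 * (0 * fst (g' t) - 1 * snd (g' t))) * (r * r))
        with (fst (g' t) * (k * (r * r))) by ring.
      rewrite Hk, Hr. apply Rminus_diag_uniq.
      transitivity (snd (g' t) * (fst w * fst (g' t) + snd w * snd (g' t))); [ring|].
      rewrite Hz'. ring. }
  rewrite <- E. unfold w. ring.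
Qed.

End Curve.

Lemma curve_periodic (g g' : R -> C) (T B : R) :
  regular_curve g g' T B -> forall t, g (t + T) = g t.
Proof. now intros [_ [_ [_ [_ [H _]]]]]. Qed.

Lemma curve_deriv_neq_0 (g g' : R -> C) (T B : R) :
  regular_curve g g' T B -> forall t, g' t <> 0.
Proof. now intros [_ [_ [_ [_ [_ [_ H]]]]]]. Qed.

(** * Limits of singular integrals along the curve *)

Lemma is_CInt_periodic (f : R -> C) (T b : R) (l : C) :
  0 < T -> (forall t, f (t + T) = f t) -> is_CInt f b (b + T) l -> is_CInt f 0 T l.
Proof.
  intros HT Hf Hl. destruct (period_reduce T 0 b HT) as [k Hk].
  set (b' := b + IZR k * T) in *.
  assert (Hl' : is_CInt f b' (b' + T) l).
  { apply is_CInt_ext with (fun y => f (y + - (IZR k * T))).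
    - lra.
    - intros x _. rewrite <- (periodic_Z f T Hf k (x + - (IZR k * T))). f_equal. ring.
    - apply is_CInt_translate. unfold b'.
      replace (b + IZR k * T + - (IZR k * T)) with b by ring.
      replace (b + IZR k * T + T + - (IZR k * T)) with (b + T) by ring. exact Hl. }
  assert (Hex : ex_CInt f b' (b' + T)) by now exists l.
  assert (H1 : ex_CInt f b' T).
  { apply (@ex_RInt_Chasles_1 C_R_CompleteNormedModule f b' T (b' + T)); [lra | exact Hex]. }
  assert (H2 : ex_CInt f T (b' + T)).
  { apply (@ex_RInt_Chasles_2 C_R_CompleteNormedModule f b' T (b' + T)); [lra | exact Hex]. }
  apply CInt_correct in H1. apply CInt_correct in H2.
  assert (E : l = (CInt f T (b' + T) + CInt f b' T)%C).
  { rewrite <- (CInt_unique _ _ _ _ Hl').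
    rewrite (CInt_unique _ _ _ _ (is_CInt_Chasles _ _ _ _ _ _ H1 H2)). ring. }
  rewrite E. apply is_CInt_Chasles with b'; auto.
  apply is_CInt_ext with (fun y => f (y + T)); [lra | intros; apply Hf |].
  apply is_CInt_translate. rewrite Rplus_0_l. exact H2.
Qed.

(** Puts the singular parameter in the middle of the interval of integration, as the symmetric
    tangent-line integral requires. *)
Lemma is_CInt_recenter (f : R -> C) (T t : R) (l : C) :
  0 < T -> (forall s, f (s + T) = f s) ->
  is_CInt (fun u => f (t + u)) (- (T / 2)) (T / 2) l -> is_CInt f 0 T l.
Proof.
  intros HT Hf Hl. apply is_CInt_periodic with (t - T / 2); auto.
  apply is_CInt_ext with (fun y => f (t + (y + - t))); [lra | intros; f_equal; ring |].
  apply (is_CInt_translate (fun u => f (t + u))).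
  replace (t - T / 2 + - t) with (- (T / 2)) by ring.
  replace (t - T / 2 + T + - t) with (T / 2) by field. exact Hl.
Qed.

Lemma CInt_Chasles (f : R -> C) (a b c : R) :
  ex_CInt f a b -> ex_CInt f b c -> CInt f a c = (CInt f a b + CInt f b c)%C.
Proof.
  intros H1 H2. apply CInt_unique. apply is_CInt_Chasles with b; now apply CInt_correct.
Qed.

Lemma CInt_bound (f : R -> C) (a b M : R) :
  a <= b -> ex_CInt f a b -> (forall t, a <= t <= b -> Cmod (f t) <= M) ->
  Cmod (CInt f a b) <= (b - a) * M.
Proof.
  intros Hab Hex HM. apply is_CInt_bound with (f := f); auto. now apply CInt_correct.
Qed.

Lemma CInt_minus (f g : R -> C) (a b : R) : ex_CInt f a b -> ex_CInt g a b ->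
  CInt (fun s => f s - g s)%C a b = (CInt f a b - CInt g a b)%C.
Proof.
  intros H1 H2. apply CInt_unique. apply is_CInt_minus; now apply CInt_correct.
Qed.

Lemma is_RInt_opp_inv (b c : R) : b <= c -> 0 < b \/ c < 0 ->
  is_RInt (fun u => - / u) b c (ln (Rabs b) - ln (Rabs c)).
Proof.
  intros Hbc Hor.
  replace (ln (Rabs b) - ln (Rabs c)) with (minus (- ln (Rabs c)) (- ln (Rabs b)))
    by (unfold minus, plus, opp; simpl; ring).
  apply (is_RInt_derive (fun u => - ln (Rabs u))).
  - intros x. rewrite Rmin_left, Rmax_right by lra. intros Hx.
    destruct Hor as [Hp|Hn].
    + apply is_derive_ext_loc with (fun u => - ln u).
      { assert (Hx0 : 0 < x) by lra. exists (mkposreal x Hx0). intros y Hy.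
        change (Rabs (y - x) < x) in Hy. apply Rabs_def2 in Hy.
        now rewrite Rabs_pos_eq by lra. }
      auto_derive; [lra | field; lra].
    + apply is_derive_ext_loc with (fun u => - ln (- u)).
      { assert (Hx0 : 0 < - x) by lra. exists (mkposreal (- x) Hx0). intros y Hy.
        change (Rabs (y - x) < - x) in Hy. apply Rabs_def2 in Hy.
        now rewrite Rabs_left by lra. }
      auto_derive; [lra | field; lra].
  - intros x. rewrite Rmin_left, Rmax_right by lra. intros Hx.
    prove_continuous. lra.
Qed.

(** * Kernels that differ from a homogeneous Cauchy-type kernel by a bounded remainder *)

Section Jump.

Variables (g g' : R -> C) (T B : R).
Hypothesis Hg : regular_curve g g' T B.

Variable w : R -> C.
Variables Wb Wl : R.
Hypothesis Hw_bound : forall t, Cmod (w t) <= Wb.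
Hypothesis Hw_lip : forall s t, Cmod (w s - w t)%C <= Wl * Rabs (s - t).
Hypothesis Hw_per : forall t, w (t + T) = w t.

Variables kappa k : C -> C.
Variable K : R.
Hypothesis HK : 0 < K.
Hypothesis Hkappa_cont : forall X : C, X <> 0 -> continuous kappa X.
Hypothesis Hk_cont : forall X : C, X <> 0 -> continuous k X.
Hypothesis Hk_bound : forall X : C, X <> 0 -> Cmod (k X) <= K / Cmod X.
Hypothesis Hk_diff : forall X Y : C, X <> 0 -> Y <> 0 ->
  Cmod (k X - k Y)%C <= K * Cmod (X - Y)%C / (Cmod X * Cmod Y).
Hypothesis Hk_hom : forall (x : R) (X : C), x <> 0 -> X <> 0 -> k (RtoC x * X)%C = (k X / RtoC x)%C.
Hypothesis Hrem : forall rho, exists M, 0 < M /\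
  forall X : C, X <> 0 -> Cmod X <= rho -> Cmod (kappa X - k X)%C <= M.

Let HT : 0 < T := proj1 Hg.
Let HB : 0 < B := proj1 (proj2 Hg).
Let Hper : forall t, g (t + T) = g t := curve_periodic _ _ _ _ Hg.
Let a := T / 2.

Local Notation chrd := (chord g g').
Local Notation chrdm := (chord_model g').

Lemma density_continuous (t : R) : continuous w t.
Proof.
  apply continuous_Cmod_lt. intros e He.
  assert (Hl : 0 <= Wl).
  { assert (H := Hw_lip 1 0). replace (1 - 0) with 1 in H by ring. rewrite Rabs_R1 in H.
    assert (H0 := Cmod_ge_0 (w 1 - w 0)). lra. }
  assert (Hd : 0 < e / (Wl + 1)) by (apply Rdiv_lt_0_compat; lra).
  exists (mkposreal _ Hd). intros s Hs. change (Rabs (s - t) < e / (Wl + 1)) in Hs.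
  eapply Rle_lt_trans; [apply Hw_lip|]. assert (H0 := Rabs_pos (s - t)).
  apply (Rmult_lt_compat_l (Wl + 1)) in Hs; [|lra].
  replace ((Wl + 1) * (e / (Wl + 1))) with e in Hs by (field; lra). lra.
Qed.

Definition regularized (t h u : R) : C :=
  (w (t + u)%R * kappa (chrd t h u) - w t * k (chrdm t h u))%C.

Lemma chord_model_neq_0 (t h u : R) : 0 < Rabs h + Rabs u -> chrdm t h u <> 0.
Proof.
  intros H. destruct (chord_model_lower g g' T B Hg) as [c [Hc Hm]].
  apply Cmod_gt_0. eapply Rlt_le_trans; [|apply Hm]. now apply Rmult_lt_0_compat.
Qed.

(** Splits into w (kappa - k)(X), w (k X - k Y) and (w(t + u) - w(t)) k(Y), with X the chord and Y
    its model. With r = |h| + |u| these are O(1), O(u^2 / r^2) and O(|u| / r), uniformly in [t]. *)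
Lemma regularized_bound : exists M h0, 0 < M /\ 0 < h0 /\
  forall t h u, Rabs h <= h0 -> Rabs u <= a -> 0 < Rabs h + Rabs u ->
    chrd t h u <> 0 /\ Cmod (regularized t h u) <= M.
Proof.
  destruct (chord_lower g g' T B Hg) as [c1 [h0 [Hc1 [Hh0 Hch]]]].
  destruct (chord_model_lower g g' T B Hg) as [c2 [Hc2 Hcm]].
  destruct (curve_lipschitz g g' T B Hg) as [L [HL Hlg]].
  (* The radius bounds the length of every chord with |h| <= h0 and |u| <= a. *)
  destruct (Hrem (h0 + L * a)) as [M [HM HR]].
  assert (Hl : 0 <= Wl).
  { assert (H := Hw_lip 1 0). replace (1 - 0) with 1 in H by ring. rewrite Rabs_R1 in H.
    assert (H0 := Cmod_ge_0 (w 1 - w 0)). lra. }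
  assert (Hb : 0 <= Wb) by (eapply Rle_trans; [apply Cmod_ge_0 | apply (Hw_bound 0)]).
  assert (HP : 0 <= Wb * M) by (apply Rmult_le_pos; lra).
  assert (HQ : 0 <= Wb * (K * (2 * B) / (c1 * c2))).
  { apply Rmult_le_pos; [lra|]. left. apply Rdiv_lt_0_compat; repeat apply Rmult_lt_0_compat; lra. }
  assert (HS : 0 <= Wl * (K / c2)).
  { apply Rmult_le_pos; [lra|]. left. apply Rdiv_lt_0_compat; lra. }
  exists (Wb * M + Wb * (K * (2 * B) / (c1 * c2)) + Wl * (K / c2) + 1), h0.
  split; [lra|]. split; [auto|].
  intros t h u Hh Hu Hpos.
  assert (p1 := Rabs_pos h). assert (p2 := Rabs_pos u).
  specialize (Hch t h u Hh Hu). specialize (Hcm t h u).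
  set (r := Rabs h + Rabs u) in *. set (X := chrd t h u) in *. set (Y := chrdm t h u) in *.
  assert (HXp : 0 < Cmod X) by (eapply Rlt_le_trans; [|exact Hch]; now apply Rmult_lt_0_compat).
  assert (HYp : 0 < Cmod Y) by (eapply Rlt_le_trans; [|exact Hcm]; now apply Rmult_lt_0_compat).
  assert (HX : X <> 0) by now apply Cmod_gt_0.
  assert (HY : Y <> 0) by now apply Cmod_gt_0.
  split; auto.
  assert (HXr : Cmod X <= h0 + L * a).
  { unfold X, chord.
    replace (g t + RtoC h * normal g' t - g (t + u)%R)%C
      with (RtoC h * normal g' t + (g t - g (t + u)%R))%C by ring.
    eapply Rle_trans; [apply Cmod_triangle|].
    rewrite Cmod_mult, Cmod_R, (Cmod_normal g g' T B Hg), Rmult_1_r.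
    assert (H := Hlg t (t + u)). replace (t - (t + u)) with (- u) in H by ring.
    rewrite Rabs_Ropp in H.
    assert (L * Rabs u <= L * a) by (apply Rmult_le_compat_l; lra). lra. }
  assert (B2 : Cmod (k X - k Y)%C <= K * (2 * B) / (c1 * c2)).
  { eapply Rle_trans; [apply Hk_diff; auto|].
    assert (Hxy := chord_chord_model g g' T B Hg t h u). fold X Y in Hxy.
    assert (Hu2 : u ^ 2 <= r * r).
    { rewrite <- pow2_abs. simpl. rewrite Rmult_1_r. unfold r. nra. }
    assert (Hprod : c1 * c2 * (r * r) <= Cmod X * Cmod Y).
    { replace (c1 * c2 * (r * r)) with ((c1 * r) * (c2 * r)) by ring.
      apply Rmult_le_compat; auto; apply Rmult_le_pos; lra. }
    assert (Hcc : 0 < c1 * c2) by now apply Rmult_lt_0_compat.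
    assert (Hxyp : 0 < Cmod X * Cmod Y) by now apply Rmult_lt_0_compat.
    apply Rmult_le_reg_r with (Cmod X * Cmod Y * (c1 * c2)); [now apply Rmult_lt_0_compat|].
    replace (K * Cmod (X - Y) / (Cmod X * Cmod Y) * (Cmod X * Cmod Y * (c1 * c2)))
      with (K * (Cmod (X - Y) * (c1 * c2))) by (field; lra).
    replace (K * (2 * B) / (c1 * c2) * (Cmod X * Cmod Y * (c1 * c2)))
      with (K * (2 * B * (Cmod X * Cmod Y))) by (field; lra).
    apply Rmult_le_compat_l; [lra|].
    apply Rle_trans with (2 * B * (r * r) * (c1 * c2)).
    - apply Rmult_le_compat_r; [lra|]. eapply Rle_trans; [exact Hxy|].
      apply Rmult_le_compat_l; lra.
    - replace (2 * B * (r * r) * (c1 * c2)) with (2 * B * (c1 * c2 * (r * r))) by ring.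
      apply Rmult_le_compat_l; lra. }
  assert (B3 : Cmod (w (t + u)%R - w t)%C * Cmod (k Y) <= Wl * (K / c2)).
  { assert (H1 := Hw_lip (t + u) t). replace (t + u - t) with u in H1 by ring.
    apply Rle_trans with (Wl * Rabs u * (K / Cmod Y)).
    - apply Rmult_le_compat; auto; apply Cmod_ge_0.
    - rewrite Rmult_assoc. apply Rmult_le_compat_l; auto.
      apply Rmult_le_reg_r with (Cmod Y * c2); [now apply Rmult_lt_0_compat|].
      replace (Rabs u * (K / Cmod Y) * (Cmod Y * c2)) with (K * (c2 * Rabs u)) by (field; lra).
      replace (K / c2 * (Cmod Y * c2)) with (K * Cmod Y) by (field; lra).
      apply Rmult_le_compat_l; [lra|]. eapply Rle_trans; [|exact Hcm].
      apply Rmult_le_compat_l; unfold r; lra. }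
  unfold regularized. fold X Y.
  replace (w (t + u)%R * kappa X - w t * k Y)%C with
    (w (t + u)%R * (kappa X - k X) + w (t + u)%R * (k X - k Y) + (w (t + u)%R - w t) * k Y)%C by ring.
  eapply Rle_trans; [apply Cmod_triangle|].
  eapply Rle_trans; [apply Rplus_le_compat_r, Cmod_triangle|].
  rewrite !Cmod_mult.
  assert (C1 : Cmod (w (t + u)%R) * Cmod (kappa X - k X)%C <= Wb * M)
    by (apply Rmult_le_compat; auto using Cmod_ge_0).
  assert (C2 : Cmod (w (t + u)%R) * Cmod (k X - k Y)%C <= Wb * (K * (2 * B) / (c1 * c2)))
    by (apply Rmult_le_compat; auto using Cmod_ge_0).
  lra.
Qed.

Lemma regularized_continuous (t h u : R) :
  0 < Rabs h + Rabs u -> chrd t h u <> 0 ->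
  continuous (fun q : R * (R * R) => regularized (fst (snd q)) (snd (snd q)) (fst q)) (u, (t, h)).
Proof.
  intros Hpos HX. assert (HY := chord_model_neq_0 t h u Hpos).
  assert (Cg := curve_continuous g g' T B Hg). assert (CN := normal_continuous g g' T B Hg).
  assert (Cg' := curve_deriv_continuous g g' T B Hg). assert (Cw := density_continuous).
  unfold regularized.
  apply (continuous_Cminus
    (fun q : R * (R * R) => w (fst (snd q) + fst q)%R * kappa (chrd (fst (snd q)) (snd (snd q)) (fst q)))%C
    (fun q => w (fst (snd q)) * k (chrdm (fst (snd q)) (snd (snd q)) (fst q)))%C);
    prove_continuous.
  - apply (continuous_comp
      (fun q : R * (R * R) => chrd (fst (snd q)) (snd (snd q)) (fst q)) kappa); auto.
    unfold chord. prove_continuous.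
  - apply (continuous_comp
      (fun q : R * (R * R) => chrdm (fst (snd q)) (snd (snd q)) (fst q)) k); auto.
    unfold chord_model. prove_continuous.
Qed.

Lemma regularized_continuous_u (t h u : R) :
  0 < Rabs h + Rabs u -> chrd t h u <> 0 -> continuous (regularized t h) u.
Proof.
  intros H1 H2.
  apply (continuous_comp (fun v : R => (v, (t, h)))
    (fun q : R * (R * R) => regularized (fst (snd q)) (snd (snd q)) (fst q))).
  - apply (continuous_comp_2 (fun v : R => v) (fun _ => (t, h)) (fun x y => (x, y))).
    + apply continuous_id.
    + apply continuous_const.
    + apply continuous_ext with (fun p => p); [now intros [? ?] | apply continuous_id].
  - now apply regularized_continuous.
Qed.

(** The two radii are independent, because a Euclidean disc generally cuts different parameter
    lengths from the two arcs. *)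
Definition punctured (t h r1 r2 : R) : C :=
  (CInt (regularized t h) (- a) (- r1) + CInt (regularized t h) r2 a)%C.

Section WithBounds.

Variables M h0 : R.
Hypothesis HM : 0 < M.
Hypothesis Hh0 : 0 < h0.
Hypothesis HMb : forall t h u, Rabs h <= h0 -> Rabs u <= a -> 0 < Rabs h + Rabs u ->
    chrd t h u <> 0 /\ Cmod (regularized t h u) <= M.

Lemma regularized_ex (t h b c : R) : Rabs h <= h0 -> - a <= b -> b <= c -> c <= a ->
  (h <> 0 \/ 0 < b \/ c < 0) -> ex_CInt (regularized t h) b c.
Proof.
  intros Hh Hb Hbc Hc Hor. apply ex_CInt_cont; auto. intros s Hs.
  assert (Hpos : 0 < Rabs h + Rabs s).
  { assert (p1 := Rabs_pos h). assert (p2 := Rabs_pos s).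
    destruct Hor as [Hn|Hn].
    - assert (0 < Rabs h) by now apply Rabs_pos_lt. lra.
    - assert (0 < Rabs s) by (apply Rabs_pos_lt; lra). lra. }
  apply regularized_continuous_u; auto.
  apply (HMb t h s); auto. apply Rabs_le. lra.
Qed.

Lemma regularized_CInt_bound (t h b c : R) : Rabs h <= h0 -> - a <= b -> b <= c -> c <= a ->
  (h <> 0 \/ 0 < b \/ c < 0) -> Cmod (CInt (regularized t h) b c) <= (c - b) * M.
Proof.
  intros Hh Hb Hbc Hc Hor. apply CInt_bound; auto.
  - now apply regularized_ex.
  - intros s Hs. apply HMb; auto.
    + apply Rabs_le. lra.
    + assert (p1 := Rabs_pos h). assert (p2 := Rabs_pos s). destruct Hor as [Hn|Hn].
      * assert (0 < Rabs h) by now apply Rabs_pos_lt. lra.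
      * assert (0 < Rabs s) by (apply Rabs_pos_lt; lra). lra.
Qed.

Lemma punctured_cauchy (t r1 r2 s1 s2 : R) :
  0 < s1 <= r1 -> 0 < s2 <= r2 -> r1 <= a -> r2 <= a ->
  Cmod (punctured t 0 r1 r2 - punctured t 0 s1 s2)%C <= (r1 + r2) * M.
Proof.
  intros H1 H2 H3 H4. assert (Hh : Rabs 0 <= h0) by (rewrite Rabs_R0; lra).
  unfold punctured.
  rewrite (CInt_Chasles (regularized t 0) (- a) (- r1) (- s1)),
          (CInt_Chasles (regularized t 0) s2 r2 a);
    try (apply regularized_ex; auto; lra).
  set (x := CInt _ (- a) (- r1)). set (y := CInt _ r2 a).
  match goal with |- Cmod (x + y - (x + ?p + (?q + y)))%C <= _ =>
    replace (x + y - (x + p + (q + y)))%C with (- p + - q)%C by ring end.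
  eapply Rle_trans; [apply Cmod_triangle|]. rewrite !Cmod_opp.
  assert (B1 : Cmod (CInt (regularized t 0) (- r1) (- s1)) <= (- s1 - - r1) * M)
    by (apply regularized_CInt_bound; auto; lra).
  assert (B2 : Cmod (CInt (regularized t 0) s2 r2) <= (r2 - s2) * M)
    by (apply regularized_CInt_bound; auto; lra).
  nra.
Qed.

Lemma at_right_0_lt (d : R) : 0 < d -> at_right 0 (fun r => 0 < r < d).
Proof.
  intros Hd. exists (mkposreal d Hd). intros r Hr H0. split; auto.
  change (Rabs (r - 0) < d) in Hr. rewrite Rminus_0_r, Rabs_pos_eq in Hr; lra.
Qed.

(** At h = 0 the integrand is controlled only for u <> 0, so its integral is defined as a limit.
    Boundedness by [M] gives the Cauchy property and a rate that does not depend on [t]. *)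
Lemma punctured_limit (t : R) : exists l : C, forall r1 r2,
  0 < r1 <= a -> 0 < r2 <= a -> Cmod (punctured t 0 r1 r2 - l)%C <= (r1 + r2) * M.
Proof.
  assert (Ha : 0 < a) by (unfold a; lra).
  assert (Hex : exists l : C, filterlim (fun r => punctured t 0 r r) (at_right 0) (locally l)).
  { apply (@filterlim_locally_cauchy R C_R_CompleteNormedModule (at_right 0) _).
    intros eps. set (d := Rmin a (eps / (4 * M))).
    assert (Hd : 0 < d).
    { apply Rmin_pos; auto. apply Rdiv_lt_0_compat; [apply cond_pos | lra]. }
    exists (fun r => 0 < r < d). split; [now apply at_right_0_lt|].
    assert (Hd1 : d <= a) by apply Rmin_l.
    assert (Hd2 : 4 * M * d <= eps).
    { assert (Hm := Rmin_r a (eps / (4 * M))). fold d in Hm.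
      apply (Rmult_le_compat_l (4 * M)) in Hm; [|lra].
      replace (4 * M * (eps / (4 * M))) with (pos eps) in Hm by (field; lra). exact Hm. }
    intros u v Hu Hv. apply C_ball_Cmod.
    set (s := Rmin u v).
    assert (Hs : 0 < s) by (apply Rmin_pos; lra).
    assert (s1 : s <= u) by apply Rmin_l. assert (s2 : s <= v) by apply Rmin_r.
    assert (E1 := punctured_cauchy t u u s s ltac:(lra) ltac:(lra) ltac:(lra) ltac:(lra)).
    assert (E2 := punctured_cauchy t v v s s ltac:(lra) ltac:(lra) ltac:(lra) ltac:(lra)).
    replace (punctured t 0 v v - punctured t 0 u u)%C with
      ((punctured t 0 v v - punctured t 0 s s) - (punctured t 0 u u - punctured t 0 s s))%C by ring.
    eapply Rle_lt_trans; [apply Cmod_triangle|]. rewrite Cmod_opp.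
    assert ((u + u) * M < 2 * d * M) by (apply Rmult_lt_compat_r; lra).
    assert ((v + v) * M < 2 * d * M) by (apply Rmult_lt_compat_r; lra).
    lra. }
  destruct Hex as [l Hl]. exists l. intros r1 r2 H1 H2.
  apply Rle_plus_epsilon. intros e He.
  assert (Hnear := proj1 (filterlim_Cmod _ _ _) Hl e He).
  assert (Hm : 0 < Rmin r1 r2) by (apply Rmin_pos; lra).
  destruct (filter_ex (F := at_right 0) _ (filter_and _ _ Hnear (at_right_0_lt _ Hm))) as [s [Hs1 Hs2]].
  assert (m1 := Rmin_l r1 r2). assert (m2 := Rmin_r r1 r2).
  assert (E := punctured_cauchy t r1 r2 s s ltac:(lra) ltac:(lra) ltac:(lra) ltac:(lra)).
  replace (punctured t 0 r1 r2 - l)%C with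
    ((punctured t 0 r1 r2 - punctured t 0 s s) + (punctured t 0 s s - l))%C by ring.
  eapply Rle_trans; [apply Cmod_triangle|]. lra.
Qed.

(** This number will be both the principal value and the part of the one-sided limits that does not
    jump. *)
Definition regular_value (t : R) : C := epsilon (inhabits (RtoC 0)) (fun l : C => forall r1 r2,
  0 < r1 <= a -> 0 < r2 <= a -> Cmod (punctured t 0 r1 r2 - l)%C <= (r1 + r2) * M).

Lemma regular_value_spec (t : R) : forall r1 r2,
  0 < r1 <= a -> 0 < r2 <= a ->
  Cmod (punctured t 0 r1 r2 - regular_value t)%C <= (r1 + r2) * M.
Proof. apply (epsilon_spec (inhabits (RtoC 0)) _ (punctured_limit t)). Qed.

(** Away from u = 0 the integrand is jointly continuous in (u, t, h) up to h = 0, so the tube lemma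
    applies on both remaining intervals. *)
Lemma punctured_near (t0 r e : R) : 0 < r < a -> 0 < e -> exists d, 0 < d <= h0 /\
  forall t h, Rabs (t - t0) < d -> Rabs h < d ->
    Cmod (punctured t h r r - punctured t0 0 r r)%C < e.
Proof.
  intros Hr He.
  assert (He2 : 0 < e / (4 * a)) by (apply Rdiv_lt_0_compat; lra).
  assert (Htube : forall b c, - a <= b -> b <= c -> c <= a -> (0 < b \/ c < 0) ->
    exists d, 0 < d /\ forall s, b <= s <= c -> forall p : R * R, ball (t0, 0) d p ->
      Cmod (regularized (fst p) (snd p) s - regularized t0 0 s)%C < e / (4 * a)).
  { intros b c Hb Hbc Hc Hor.
    apply (tube b c (fun s (p : R * R) => regularized (fst p) (snd p) s) (t0, 0)); auto.
    intros s Hs.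
    assert (Hpos : 0 < Rabs 0 + Rabs s).
    { rewrite Rabs_R0. assert (0 < Rabs s) by (apply Rabs_pos_lt; lra). lra. }
    apply regularized_continuous; auto.
    apply (HMb t0 0 s); auto.
    - rewrite Rabs_R0. lra.
    - apply Rabs_le. lra. }
  destruct (Htube (- a) (- r)) as [d1 [Hd1 T1]]; try lra.
  destruct (Htube r a) as [d2 [Hd2 T2]]; try lra.
  exists (Rmin h0 (Rmin d1 d2)). split.
  { split; [repeat apply Rmin_pos; auto | apply Rmin_l]. }
  intros t h Ht Hh.
  assert (Ht' := Rlt_le_trans _ _ _ Ht (Rmin_r _ _)).
  assert (Hh' := Rlt_le_trans _ _ _ Hh (Rmin_r _ _)).
  assert (Hhh := Rlt_le_trans _ _ _ Hh (Rmin_l _ _)).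
  assert (Hball : forall d', Rmin d1 d2 <= d' -> ball (t0, 0) d' (t, h)).
  { intros d' Hd'. split.
    - change (Rabs (t - t0) < d'). lra.
    - change (Rabs (h - 0) < d'). rewrite Rminus_0_r. lra. }
  assert (Hz : Rabs 0 <= h0) by (rewrite Rabs_R0; lra).
  assert (B1 : Cmod (CInt (regularized t h) (- a) (- r) - CInt (regularized t0 0) (- a) (- r))%C
                 <= (- r - - a) * (e / (4 * a))).
  { rewrite <- CInt_minus by (apply regularized_ex; auto; lra).
    apply CInt_bound; try lra.
    - assert (X1 : ex_CInt (regularized t h) (- a) (- r)) by (apply regularized_ex; auto; lra).
      assert (X2 : ex_CInt (regularized t0 0) (- a) (- r)) by (apply regularized_ex; auto; lra).
      eexists. apply is_CInt_minus; apply CInt_correct; auto.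
    - intros s Hs. left. apply (T1 s Hs (t, h)). apply Hball, Rmin_l. }
  assert (B2 : Cmod (CInt (regularized t h) r a - CInt (regularized t0 0) r a)%C
                 <= (a - r) * (e / (4 * a))).
  { rewrite <- CInt_minus by (apply regularized_ex; auto; lra).
    apply CInt_bound; try lra.
    - assert (X1 : ex_CInt (regularized t h) r a) by (apply regularized_ex; auto; lra).
      assert (X2 : ex_CInt (regularized t0 0) r a) by (apply regularized_ex; auto; lra).
      eexists. apply is_CInt_minus; apply CInt_correct; auto.
    - intros s Hs. left. apply (T2 s Hs (t, h)). apply Hball, Rmin_r. }
  unfold punctured.
  match goal with |- Cmod (?x1 + ?y1 - (?x2 + ?y2))%C < _ =>
    replace (x1 + y1 - (x2 + y2))%C with ((x1 - x2) + (y1 - y2))%C by ring end.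
  eapply Rle_lt_trans; [apply Cmod_triangle|].
  assert (E : a * (e / (4 * a)) = e / 4) by (field; lra).
  assert (0 < r * (e / (4 * a))) by (apply Rmult_lt_0_compat; lra).
  lra.
Qed.

(** The middle interval of length 2 r contributes at most 2 r M whatever [h] is; fix such an r, then
    let (t, h) tend to (t0, 0) on the rest. *)
Lemma regularized_CInt_limit (t0 e : R) : 0 < e -> exists d, 0 < d <= h0 /\
  forall t h, Rabs (t - t0) < d -> Rabs h < d -> h <> 0 ->
    Cmod (CInt (regularized t h) (- a) a - regular_value t0)%C < e.
Proof.
  intros He. assert (Ha : 0 < a) by (unfold a; lra).
  set (r := Rmin (a / 2) (e / (8 * M))).
  assert (Hr : 0 < r).
  { apply Rmin_pos; [lra|]. apply Rdiv_lt_0_compat; lra. }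
  assert (Hr1 : r <= a / 2) by apply Rmin_l.
  assert (Hr2 : r * M <= e / 8).
  { assert (Hm := Rmin_r (a / 2) (e / (8 * M))). fold r in Hm.
    apply (Rmult_le_compat_r M) in Hm; [|lra].
    replace (e / (8 * M) * M) with (e / 8) in Hm by (field; lra). exact Hm. }
  destruct (punctured_near t0 r (e / 4)) as [d [Hd Hn]]; try lra.
  exists d. split; auto. intros t h Ht Hh H0. specialize (Hn t h Ht Hh).
  assert (Hs := regular_value_spec t0 r r ltac:(lra) ltac:(lra)).
  assert (Hhh : Rabs h <= h0) by lra.
  assert (X : forall b c, - a <= b -> b <= c -> c <= a -> ex_CInt (regularized t h) b c)
    by (intros; apply regularized_ex; auto).
  assert (E : (punctured t h r r + CInt (regularized t h) (- r) r)%C =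
            CInt (regularized t h) (- a) a).
  { unfold punctured.
    rewrite (CInt_Chasles _ (- a) (- r) a), (CInt_Chasles _ (- r) r a) by (apply X; lra). ring. }
  rewrite <- E.
  assert (Bm : Cmod (CInt (regularized t h) (- r) r) <= (r - - r) * M)
    by (apply regularized_CInt_bound; auto; lra).
  match goal with |- Cmod (?p + ?q - ?v)%C < _ =>
    replace (p + q - v)%C with ((p - punctured t0 0 r r) + (punctured t0 0 r r - v) + q)%C by ring end.
  eapply Rle_lt_trans; [apply Cmod_triangle|].
  eapply Rle_lt_trans; [apply Rplus_le_compat_r, Cmod_triangle|]. lra.
Qed.

Lemma potential_decompose (t h : R) : Rabs h <= h0 -> h <> 0 ->
  CInt (fun s => kappa (g t + RtoC h * normal g' t - g s) * w s)%C 0 T =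
  (CInt (regularized t h) (- a) a + w t * CInt (fun u => k (chrdm t h u)) (- a) a)%C.
Proof.
  intros Hh H0. apply CInt_unique. apply (is_CInt_recenter _ T t); auto.
  { intros s. rewrite Hw_per. now rewrite Hper. }
  fold a.
  apply is_CInt_ext with (fun u => regularized t h u + w t * k (chrdm t h u))%C.
  - unfold a; lra.
  - intros u _. unfold regularized, chord. ring.
  - assert (Ha : 0 < a) by (unfold a; lra).
    apply is_CInt_plus.
    + apply CInt_correct, regularized_ex; auto; lra.
    + apply is_CInt_scal, CInt_correct, ex_CInt_cont; [lra|].
      intros u _. assert (Hp : 0 < Rabs h) by now apply Rabs_pos_lt.
      assert (Hu := Rabs_pos u).
      apply (continuous_comp (fun u => chrdm t h u) k).
      * unfold chord_model. prove_continuous.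
      * apply Hk_cont, chord_model_neq_0. lra.
Qed.

Lemma principal_value (t : R) :
  exists J : R -> C,
    at_right 0 (fun d => is_CInt (fun s =>
      if Rlt_dec d (Cmod (g s - g t)%C) then (kappa (g t - g s) * w s)%C else RtoC 0) 0 T (J d)) /\
    filterlim J (at_right 0) (locally (regular_value t)).
Proof.
  destruct (cut_interval g g' T B Hg) as [d0 [C0 [Hd0 [HC0 Hcut]]]]. fold a in Hcut.
  set (F := fun (d s : R) =>
    if Rlt_dec d (Cmod (g s - g t)%C) then (kappa (g t - g s) * w s)%C else RtoC 0).
  set (kt := (w t * k (g' t))%C).
  assert (Hval : forall d, 0 < d < d0 -> exists r1 r2,
    0 < r1 <= a /\ 0 < r2 <= a /\ r1 <= C0 * d /\ r2 <= C0 * d /\ Rabs (ln r2 - ln r1) <= C0 * d /\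
    is_CInt (F d) 0 T (punctured t 0 r1 r2 + kt * RtoC (ln r2 - ln r1))%C).
  { intros d Hd. destruct (Hcut t d Hd) as [r1 [r2 [H1 [H2 [H3 [H4 [H5 H6]]]]]]].
    exists r1, r2. repeat (split; [assumption|]).
    apply (is_CInt_recenter _ T t); auto.
    { intros s. unfold F. now rewrite Hper, Hw_per. }
    fold a.
    assert (Hpiece : forall b c, - a <= b -> b <= c -> c <= a -> 0 < b \/ c < 0 ->
      (forall u, b < u < c -> u < - r1 \/ r2 < u) ->
      is_CInt (fun u => F d (t + u)) b c
        (CInt (regularized t 0) b c + kt * RtoC (ln (Rabs b) - ln (Rabs c)))%C).
    { intros b c Hb Hbc Hc Hor Hout.
      apply is_CInt_ext with (fun u => regularized t 0 u + kt * RtoC (- / u))%C; auto.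
      - intros u Hu. unfold F. destruct (Rlt_dec _ _) as [_|Hn].
        2:{ exfalso. apply Hn. apply H6; [lra | now apply Hout]. }
        unfold regularized, chord, chord_model, kt.
        replace (g t + RtoC 0 * normal g' t - g (t + u)%R)%C with (g t - g (t + u)%R)%C by ring.
        replace (RtoC 0 * normal g' t - RtoC u * g' t)%C with (RtoC (- u) * g' t)%C
          by (rewrite RtoC_opp; ring).
        rewrite Hk_hom by (try lra; apply (curve_deriv_neq_0 _ _ _ _ Hg)).
        assert (Hu0 : RtoC u <> 0) by (apply RtoC_neq_0; lra).
        rewrite !RtoC_opp, RtoC_inv by lra. field. auto.
      - apply is_CInt_plus.
        + apply CInt_correct, regularized_ex; auto; rewrite Rabs_R0; lra.
        + apply is_CInt_scal.
          apply (is_RInt_fct_extend_pair (U := R_NormedModule) (V := R_NormedModule)); simpl.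
          * now apply is_RInt_opp_inv.
          * evar_last; [apply (@is_RInt_const R_NormedModule)|].
            unfold scal; simpl. unfold mult; simpl. ring. }
    assert (P1 := Hpiece (- a) (- r1) ltac:(lra) ltac:(lra) ltac:(lra) ltac:(lra)
                    ltac:(intros; lra)).
    assert (P2 := Hpiece r2 a ltac:(lra) ltac:(lra) ltac:(lra) ltac:(lra) ltac:(intros; lra)).
    rewrite !Rabs_Ropp, !Rabs_pos_eq in P1 by lra. rewrite !Rabs_pos_eq in P2 by lra.
    (* Inside the disc the truncated integrand vanishes. *)
    assert (P0 : is_CInt (fun u => F d (t + u)) (- r1) r2 (RtoC 0)).
    { apply is_CInt_ext with (fun _ => RtoC 0); [lra | |].
      - intros u Hu. unfold F. destruct (Rlt_dec _ _) as [Hlt|_]; auto.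
        exfalso. apply H6 in Hlt; lra.
      - evar_last; [apply (@is_RInt_const C_R_NormedModule)|].
        apply injective_projections; unfold scal; simpl; unfold prod_scal, scal; simpl;
          unfold mult; simpl; ring. }
    assert (P := is_CInt_Chasles _ _ _ _ _ _ (is_CInt_Chasles _ _ _ _ _ _ P1 P0) P2).
    evar_last; [exact P|]. unfold punctured. rewrite !RtoC_minus.
    match goal with |- @eq _ ?x ?y => change (@eq C x y) end. ring. }
  exists (fun d => CInt (F d) 0 T). split.
  - generalize (at_right_0_lt d0 Hd0). apply filter_imp. intros d Hd.
    destruct (Hval d Hd) as [r1 [r2 [_ [_ [_ [_ [_ Hi]]]]]]].
    apply CInt_correct. eexists; exact Hi.
  - apply filterlim_Cmod; try apply _. intros e He.
    set (Q := 2 * C0 * M + Cmod kt * C0 + 1).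
    assert (HQ : 0 < Q).
    { assert (0 <= Cmod kt * C0) by (apply Rmult_le_pos; [apply Cmod_ge_0 | lra]).
      assert (0 < C0 * M) by (apply Rmult_lt_0_compat; auto). unfold Q; lra. }
    assert (Hm : 0 < Rmin d0 (e / Q)).
    { apply Rmin_pos; auto. now apply Rdiv_lt_0_compat. }
    generalize (at_right_0_lt _ Hm). apply filter_imp. intros d Hd.
    assert (m1 := Rmin_l d0 (e / Q)). assert (m2 := Rmin_r d0 (e / Q)).
    destruct (Hval d ltac:(lra)) as [r1 [r2 [H1 [H2 [H3 [H4 [H5 Hi]]]]]]].
    rewrite (CInt_unique _ _ _ _ Hi).
    assert (Hs := regular_value_spec t r1 r2 H1 H2).
    match goal with |- Cmod (?p + ?q - ?v)%C < _ =>
      replace (p + q - v)%C with ((p - v) + q)%C by ring end.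
    eapply Rle_lt_trans; [apply Cmod_triangle|]. rewrite Cmod_mult, Cmod_R.
    assert ((r1 + r2) * M <= 2 * C0 * d * M) by (apply Rmult_le_compat_r; lra).
    assert (Cmod kt * Rabs (ln r2 - ln r1) <= Cmod kt * (C0 * d))
      by (apply Rmult_le_compat_l; auto; apply Cmod_ge_0).
    assert (HQd : Q * d < e).
    { assert (Hd' : d < e / Q) by lra. apply (Rmult_lt_compat_l Q) in Hd'; auto.
      replace (Q * (e / Q)) with e in Hd' by (field; lra). exact Hd'. }
    unfold Q in HQd. lra.
Qed.

End WithBounds.

End Jump.

(** * The Cauchy integral over a segment *)

(* [int_{-a}^{a} du / (u - r)] is [+- i PI] plus this function, which vanishes
   continuously at [r = 0]. *)
Definition segment_remainder (a : R) (r : C) : C :=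
  (/ 2 * (ln ((a - fst r) ^ 2 + snd r ^ 2) - ln ((a + fst r) ^ 2 + snd r ^ 2)),
   - (atan (snd r / (a - fst r)) + atan (snd r / (a + fst r)))).

Lemma segment_remainder_continuous (a : R) (r : C) :
  Rabs (fst r) < a -> continuous (segment_remainder a) r.
Proof.
  intros H. apply Rabs_def2 in H.
  assert (Cf : continuous (fun z : C => fst z) r) by prove_continuous.
  assert (Cs : continuous (fun z : C => snd z) r) by prove_continuous.
  assert (Hln : forall f : C -> R, continuous f r -> f r <> 0 ->
            continuous (fun z : C => ln (f z ^ 2 + snd z ^ 2)) r).
  { intros f Hf H0. apply (continuous_Rcomp (fun z : C => f z ^ 2 + snd z ^ 2) ln).
    - prove_continuous.
    - apply derivable_continuous_pt. eexists. apply derivable_pt_lim_ln.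
      assert (H1 := pow2_gt_0 _ H0). assert (H2 := pow2_ge_0 (snd r)). lra. }
  assert (Hat : forall f : C -> R, continuous f r -> f r <> 0 ->
            continuous (fun z : C => atan (snd z / f z)) r).
  { intros f Hf H0. apply (continuous_Rcomp (fun z : C => snd z / f z) atan).
    - prove_continuous. exact H0.
    - apply derivable_continuous_pt, derivable_pt_atan. }
  apply continuous_C; unfold segment_remainder; cbn [fst snd]; prove_continuous.
  - apply (Hln (fun z => a - fst z)); [prove_continuous | lra].
  - apply (Hln (fun z => a + fst z)); [prove_continuous | lra].
  - apply (Hat (fun z => a - fst z)); [prove_continuous | lra].
  - apply (Hat (fun z => a + fst z)); [prove_continuous | lra].
Qed.

Lemma segment_remainder_0 (a : R) : segment_remainder a 0%C = 0%C.
Proof.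
  unfold segment_remainder; simpl. unfold Rdiv. rewrite !Rmult_0_l, atan_0.
  rewrite !Rminus_0_r, !Rplus_0_r, Rminus_diag, Rmult_0_r, Ropp_0. reflexivity.
Qed.

(** With r = p + i m an antiderivative is ln((u - p)^2 + m^2) / 2 + i atan((u - p) / m); the
    arctangent has no limit at m = 0, and this is the jump. *)
Lemma is_CInt_segment (a : R) (r : C) (s : R) :
  Rabs (fst r) < a -> (s = 1 \/ s = -1) -> 0 < s * snd r ->
  is_CInt (fun u => / (RtoC u - r))%C (- a) a (segment_remainder a r + RtoC (s * PI) * Ci)%C.
Proof.
  intros Hr Hs Hm. apply Rabs_def2 in Hr. destruct r as [p m]; simpl in *.
  assert (Hm0 : m <> 0) by (intros ->; lra).
  assert (Hq : forall u, 0 < (u - p) ^ 2 + m ^ 2).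
  { intros u. assert (H1 := pow2_gt_0 _ Hm0). assert (H2 := pow2_ge_0 (u - p)). lra. }
  apply (is_RInt_fct_extend_pair (U := R_NormedModule) (V := R_NormedModule)); simpl.
  - apply (is_RInt_ext (V := R_NormedModule) (fun u => (u - p) / ((u - p) ^ 2 + m ^ 2))).
    { intros u _. specialize (Hq u). simpl in Hq |- *. field.
      replace ((u + - p) * (u + - p) + - m * - m) with ((u - p) * ((u - p) * 1) + m * (m * 1)) by ring.
      lra. }
    evar_last.
    + apply (is_RInt_derive (V := R_CompleteNormedModule) (fun u => / 2 * ln ((u - p) ^ 2 + m ^ 2))).
      * intros x _. specialize (Hq x). auto_derive; simpl in *; [lra | field; lra].
      * intros x _. specialize (Hq x). prove_continuous. lra.
    + unfold minus, plus, opp; simpl.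
      replace ((- a - p) * ((- a - p) * 1)) with ((a + p) * ((a + p) * 1)) by ring. ring.
  - apply (is_RInt_ext (V := R_NormedModule) (fun u => m / ((u - p) ^ 2 + m ^ 2))).
    { intros u _. specialize (Hq u). simpl in Hq |- *. field.
      replace ((u + - p) * (u + - p) + - m * - m) with ((u - p) * ((u - p) * 1) + m * (m * 1)) by ring.
      lra. }
    evar_last.
    + apply (is_RInt_derive (V := R_CompleteNormedModule) (fun u => atan ((u - p) / m))).
      * intros x _. specialize (Hq x). auto_derive; auto. simpl in *. field. split; auto.
        replace (m * m + (x - p) * (x - p)) with ((x - p) * ((x - p) * 1) + m * (m * 1)) by ring. lra.
      * intros x _. specialize (Hq x). prove_continuous. lra.
    + unfold minus, plus, opp; simpl.
      (* Inverting the argument of the arctangent isolates the discontinuous part s PI / 2; the rest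
         is continuous at m = 0. *)
      assert (Hat : forall y, 0 < y -> atan (y / m) = s * (PI / 2) - atan (m / y)).
      { intros y Hy. destruct Hs as [-> | ->].
        - replace (y / m) with (/ (m / y)) by (field; lra).
          rewrite atan_inv; [ring|]. apply Rdiv_lt_0_compat; lra.
        - replace (y / m) with (- / (- m / y)) by (field; lra).
          rewrite atan_opp, atan_inv by (apply Rdiv_lt_0_compat; lra).
          replace (- m / y) with (- (m / y)) by (field; lra). rewrite atan_opp. ring. }
      replace ((- a - p) / m) with (- ((a + p) / m)) by (field; auto).
      rewrite atan_opp, !Hat by lra. field.
Qed.

Section Model.

Variables (g g' : R -> C) (T B : R).
Hypothesis Hg : regular_curve g g' T B.
Let HT : 0 < T := proj1 Hg.

(** For X the normal and Y the tangent, this shows that the sign of Im r is the product of the signs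
    of the determinant and of [h]. *)
Lemma Im_linmap_ratio (p q X Y : C) : linmap p q Y <> 0 ->
  Im (linmap p q X / linmap p q Y)%C * Cmod (linmap p q Y) ^ 2
    = Im (Cconj p * q)%C * (snd X * fst Y - fst X * snd Y).
Proof.
  intros H.
  assert (Haux : forall z1 z2 : C, z2 <> 0 -> Im (z1 / z2)%C * Cmod z2 ^ 2 = Im (z1 * Cconj z2)%C).
  { intros z1 z2 H2. rewrite Cmod2_alt. apply C_neq_0_sqr in H2.
    unfold Re, Im, Cconj in *; simpl in *. rewrite !Rmult_1_r in *. field. exact H2. }
  rewrite Haux by auto. unfold linmap, Im, Cconj; simpl. ring.
Qed.

(** By linearity L(h N - u g') = - L(g') (u - r) with r = h L(N) / L(g'), so the integral is - 1 /
    L(g') times the one over a segment. [s] is the sign of the determinant, [sigma] the side of the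
    curve. *)
Lemma model_integral_limit (p q : C) (s sigma t0 e : R) :
  (s = 1 \/ s = -1) -> 0 < s * Im (Cconj p * q)%C -> (sigma = 1 \/ sigma = -1) -> 0 < e ->
  exists d, 0 < d /\ forall t h, Rabs (t - t0) < d -> Rabs h < d -> 0 < sigma * h ->
    exists l, is_CInt (fun u => / linmap p q (chord_model g' t h u))%C (- (T / 2)) (T / 2) l /\
      Cmod (l - - (RtoC (s * sigma * PI) * Ci / linmap p q (g' t0)))%C < e.
Proof.
  intros Hs Hcr Hsg He.
  assert (Hcr0 : Im (Cconj p * q)%C <> 0) by (intros E; rewrite E in Hcr; lra).
  assert (HL : forall t, linmap p q (g' t) <> 0).
  { intros t. apply linmap_neq_0; auto. apply (curve_deriv_neq_0 _ _ _ _ Hg). }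
  set (a := T / 2). assert (Ha : 0 < a) by (unfold a; lra).
  set (r := fun x : R * R => (RtoC (snd x) * (linmap p q (normal g' (fst x)) / linmap p q (g' (fst x))))%C).
  assert (Cg' := curve_deriv_continuous g g' T B Hg). assert (CN := normal_continuous g g' T B Hg).
  assert (CLg : continuous (fun x : R * R => linmap p q (g' (fst x))) (t0, 0)).
  { apply (continuous_linmap p q (fun x : R * R => g' (fst x))). prove_continuous. }
  assert (CLn : continuous (fun x : R * R => linmap p q (normal g' (fst x))) (t0, 0)).
  { apply (continuous_linmap p q (fun x : R * R => normal g' (fst x))). prove_continuous. }
  assert (Cr : continuous r (t0, 0)) by (unfold r; prove_continuous; apply HL).
  assert (Hr0 : r (t0, 0) = 0%C) by (unfold r; simpl; ring).
  (* The closed form of the integral on the side [sigma]. It is continuous through h = 0, so its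
     continuity at (t0, 0) gives the limit uniformly in t near t0. *)
  set (Psi := fun x => (- ((segment_remainder a (r x) + RtoC (s * sigma * PI) * Ci) / linmap p q (g' (fst x))))%C).
  assert (CPsi : continuous Psi (t0, 0)).
  { unfold Psi. prove_continuous; [|apply HL].
    apply (continuous_comp r (segment_remainder a)); auto.
    apply segment_remainder_continuous. rewrite Hr0. simpl. now rewrite Rabs_R0. }
  assert (HP0 : Psi (t0, 0) = (- (RtoC (s * sigma * PI) * Ci / linmap p q (g' t0)))%C).
  { unfold Psi. rewrite Hr0, segment_remainder_0. simpl. f_equal. f_equal. ring. }
  destruct (filter_and _ _ (proj1 (continuous_Cmod_lt _ _) CPsi e He)
              (proj1 (continuous_Cmod_lt _ _) Cr a Ha)) as [d Hd].
  exists d. split; [apply cond_pos|]. intros t h Ht Hh Hsh.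
  destruct (Hd (t, h)) as [D1 D2].
  { split; [exact Ht|]. change (Rabs (h - 0) < d). now rewrite Rminus_0_r. }
  rewrite Hr0 in D2. replace (r (t, h) - 0)%C with (r (t, h)) in D2 by ring.
  exists (Psi (t, h)). split; [|rewrite <- HP0; exact D1].
  unfold Psi. simpl fst.
  assert (Him : 0 < s * sigma * snd (r (t, h))).
  { assert (E := Im_linmap_ratio p q (normal g' t) (g' t) (HL t)).
    assert (Hp := Cmod_deriv_pos g g' T B Hg t).
    assert (Hlp : 0 < Cmod (linmap p q (g' t)) ^ 2) by (apply pow_lt, Cmod_gt_0, HL).
    assert (HN : snd (normal g' t) * fst (g' t) - fst (normal g' t) * snd (g' t) = Cmod (g' t)).
    { unfold normal. set (G := g' t) in *. set (m := Cmod G) in *.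
      assert (Hm : m * m = fst G * fst G + snd G * snd G).
      { unfold m, Cmod. rewrite sqrt_sqrt; [ring|]. apply Rplus_le_le_0_compat; apply pow2_ge_0. }
      replace (snd (Ci * G / RtoC m)%C * fst G - fst (Ci * G / RtoC m)%C * snd G)
        with ((fst G * fst G + snd G * snd G) / m) by (simpl; field; lra).
      rewrite <- Hm. field. lra. }
    rewrite HN in E.
    set (z := (linmap p q (normal g' t) / linmap p q (g' t))%C) in *.
    change (r (t, h)) with (RtoC h * z)%C.
    replace (snd (RtoC h * z)%C) with (h * Im z) by (unfold Im; simpl; ring).
    apply Rmult_lt_reg_r with (Cmod (linmap p q (g' t)) ^ 2); auto. rewrite Rmult_0_l.
    replace (s * sigma * (h * Im z) * Cmod (linmap p q (g' t)) ^ 2)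
      with (s * sigma * h * (Im z * Cmod (linmap p q (g' t)) ^ 2)) by ring.
    rewrite E.
    replace (s * sigma * h * (Im (Cconj p * q)%C * Cmod (g' t)))
      with ((sigma * h) * (s * Im (Cconj p * q)%C) * Cmod (g' t)) by ring.
    apply Rmult_lt_0_compat; auto. now apply Rmult_lt_0_compat. }
  replace (- ((segment_remainder a (r (t, h)) + RtoC (s * sigma * PI) * Ci) / linmap p q (g' t)))%C
    with (- / linmap p q (g' t) * (segment_remainder a (r (t, h)) + RtoC (s * sigma * PI) * Ci))%C
    by (field; apply HL).
  apply is_CInt_ext with (fun u => - / linmap p q (g' t) * / (RtoC u - r (t, h)))%C; [lra | |].
  - intros u _.
    assert (Hur : (RtoC u - r (t, h))%C <> 0).
    { intros E0. assert (E1 : snd (RtoC u - r (t, h))%C = 0) by now rewrite E0.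
      simpl in E1. simpl in Him. apply (Rlt_irrefl 0). nra. }
    assert (E1 : linmap p q (chord_model g' t h u) =
              (- linmap p q (g' t) * (RtoC u - r (t, h)))%C).
    { unfold chord_model. rewrite linmap_minus.
      assert (Hhom : forall (x : R) (X : C), linmap p q (RtoC x * X)%C = (RtoC x * linmap p q X)%C).
      { intros x X. unfold linmap. simpl.
        replace (x * fst X - 0 * snd X) with (x * fst X) by ring.
        replace (x * snd X + 0 * fst X) with (x * snd X) by ring.
        rewrite !RtoC_mult. ring. }
      rewrite !Hhom. unfold r. simpl fst; simpl snd. field. apply HL. }
    rewrite E1. field. split; auto. 
  - apply is_CInt_scal. apply is_CInt_segment; auto.
    + eapply Rle_lt_trans; [apply fst_le_Cmod | exact D2].
    + destruct Hs as [-> | ->]; destruct Hsg as [-> | ->]; [left | right | right | left]; ring.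
Qed.

End Model.

(** * Differentiation of potentials off the curve *)

Section Differentiation.

Variables (g g' : R -> C) (T B : R).
Hypothesis Hg : regular_curve g g' T B.
Let HT : 0 < T := proj1 Hg.

Variable w : R -> C.
Variables Wb Wl : R.
Hypothesis Hw_bound : forall t, Cmod (w t) <= Wb.
Hypothesis Hw_cont : forall t, continuous w t.

Definition potential (f : C -> C) (x : C) : C := CInt (fun s => f (x - g s) * w s)%C 0 T.

Lemma potential_integrand_continuous (f : C -> C) (x : C) (s : R) :
  (forall X : C, X <> 0 -> continuous f X) -> x <> g s ->
  continuous (fun s => f (x - g s) * w s)%C s.
Proof.
  intros Hf Hx. assert (Cg := curve_continuous g g' T B Hg). prove_continuous.
  apply (continuous_comp (fun s => x - g s)%C f); [prove_continuous|].
  apply Hf. intros E. apply Hx. replace x with (x - g s + g s)%C by ring. rewrite E. ring.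
Qed.

Lemma potential_ex (f : C -> C) (x : C) :
  (forall X : C, X <> 0 -> continuous f X) -> (forall s, x <> g s) ->
  ex_CInt (fun s => f (x - g s) * w s)%C 0 T.
Proof.
  intros Hf Hx. apply ex_CInt_cont; [lra|]. intros s _.
  now apply potential_integrand_continuous.
Qed.

Lemma dist_curve_pos (x : C) : (forall s, x <> g s) ->
  exists rho, 0 < rho /\ forall s, rho <= Cmod (x - g s)%C.
Proof.
  intros Hx. destruct (nearest_point g g' T B Hg x) as [t Ht].
  exists (Cmod (x - g t)%C). split; auto. apply Cmod_gt_0. intros E.
  apply (Hx t). replace x with (x - g t + g t)%C by ring. rewrite E. ring.
Qed.

Lemma kernel_tube (f : C -> C) (x : C) :
  (forall X : C, X <> 0 -> continuous f X) -> (forall s, x <> g s) ->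
  forall e, 0 < e -> exists d, 0 < d /\ forall s, 0 <= s <= T ->
    forall p : C, Cmod (p - x)%C < d -> Cmod (f (p - g s) - f (x - g s))%C < e.
Proof.
  intros Hf Hx e He.
  destruct (tube (U := C_UniformSpace) 0 T (fun s p => f (p - g s)%C) x) with (e := e)
    as [d [Hd H]]; auto.
  - intros s _.
    apply (continuous_comp (fun q : R * C => snd q - g (fst q))%C f).
    + assert (Cg := curve_continuous g g' T B Hg). prove_continuous.
    + apply Hf. simpl. intros E. apply (Hx s). replace x with (x - g s + g s)%C by ring.
      rewrite E. ring.
  - exists d. split; auto. intros s Hs p Hp. apply H; auto. now apply C_ball_Cmod.
Qed.

Lemma off_curve_open (x : C) : (forall s, x <> g s) ->
  exists d, 0 < d /\ forall y : C, Cmod (y - x)%C < d -> forall s, y <> g s.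
Proof.
  intros Hx. destruct (dist_curve_pos x Hx) as [rho [Hr Hd]].
  exists rho. split; auto. intros y Hy s E. specialize (Hd s). rewrite E in Hy.
  rewrite Cmod_minus_sym in Hy. lra.
Qed.

Lemma potential_continuous (f : C -> C) (x : C) :
  (forall X : C, X <> 0 -> continuous f X) -> (forall s, x <> g s) ->
  continuous (potential f) x.
Proof.
  intros Hf Hx. apply continuous_Cmod_lt. intros e He.
  assert (Hb : 0 <= Wb) by (eapply Rle_trans; [apply Cmod_ge_0 | apply (Hw_bound 0)]).
  assert (Hq : 0 < T * (Wb + 1)) by (apply Rmult_lt_0_compat; lra).
  assert (He' : 0 < e / 2 / (T * (Wb + 1))) by (apply Rdiv_lt_0_compat; lra).
  destruct (kernel_tube f x Hf Hx _ He') as [d1 [Hd1 H1]].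
  destruct (off_curve_open x Hx) as [d2 [Hd2 H2]].
  assert (Hd : 0 < Rmin d1 d2 / 2) by (assert (0 < Rmin d1 d2) by (now apply Rmin_pos); lra).
  exists (mkposreal _ Hd). intros y Hy. apply Cmod_C_ball in Hy. simpl in Hy.
  assert (m1 := Rmin_l d1 d2). assert (m2 := Rmin_r d1 d2).
  assert (Hoff := H2 y ltac:(lra)).
  unfold potential. rewrite <- CInt_minus by (apply potential_ex; auto).
  apply Rle_lt_trans with ((T - 0) * (e / 2 / (T * (Wb + 1)) * Wb)).
  - apply CInt_bound; [lra | |].
    + eexists. apply is_CInt_minus; apply CInt_correct, potential_ex; auto.
    + intros s Hs. specialize (H1 s Hs y ltac:(lra)).
      replace (f (y - g s) * w s - f (x - g s) * w s)%C with ((f (y - g s) - f (x - g s)) * w s)%C by ring.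
      rewrite Cmod_mult. apply Rmult_le_compat; auto using Cmod_ge_0. lra.
  - apply Rle_lt_trans with (e / 2); [|lra].
    replace ((T - 0) * (e / 2 / (T * (Wb + 1)) * Wb)) with (e / 2 * (Wb / (Wb + 1))) by (field; lra).
    rewrite <- (Rmult_1_r (e / 2)) at 2. apply Rmult_le_compat_l; [lra|].
    apply Rmult_le_reg_r with (Wb + 1); [lra|]. field_simplify; lra.
Qed.

Variables f f1 f2 : C -> C.
Hypothesis Hf : forall X : C, X <> 0 -> continuous f X.
Hypothesis Hf1 : forall X : C, X <> 0 -> continuous f1 X.
Hypothesis Hf2 : forall X : C, X <> 0 -> continuous f2 X.
Hypothesis Hderiv : forall (X : R -> C) (t : R) (dX : C),
  is_Cderive X t dX -> X t <> 0 ->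
  is_Cderive (fun s => f (X s)) t (f1 (X t) * RtoC (fst dX) + f2 (X t) * RtoC (snd dX))%C.

(** Mean value inequality along the segment from X to X + h. The factor 4 counts two partial
    derivatives and two components. *)
Lemma increment_bound (X h : C) (e : R) :
  (forall th, 0 <= th <= 1 -> (X + RtoC th * h)%C <> 0 /\
     Cmod (f1 (X + RtoC th * h) - f1 X)%C <= e /\ Cmod (f2 (X + RtoC th * h) - f2 X)%C <= e) ->
  Cmod (f (X + h) - f X - (f1 X * RtoC (fst h) + f2 X * RtoC (snd h)))%C <= 4 * e * Cmod h.
Proof.
  intros H.
  assert (Hlin : forall t, is_Cderive (fun th => X + RtoC th * h)%C t h).
  { intros t. apply is_Cderive_bound. intros e0 He0. exists 1. split; [lra|]. intros k _.
    replace (X + RtoC (t + k) * h - (X + RtoC t * h) - h * RtoC k)%C with (RtoC 0)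
      by (rewrite RtoC_plus; ring).
    rewrite Cmod_0. apply Rmult_le_pos; [lra | apply Rabs_pos]. }
  set (D := fun th => (f1 (X + RtoC th * h)%C * RtoC (fst h) + f2 (X + RtoC th * h)%C * RtoC (snd h))%C).
  assert (HD : forall th, 0 <= th <= 1 -> is_Cderive (fun s => f (X + RtoC s * h)%C) th (D th)).
  { intros th Hth. apply (Hderiv (fun s => X + RtoC s * h)%C); auto. now apply H. }
  assert (HDb : forall th, 0 <= th <= 1 -> Cmod (D th - D 0)%C <= 2 * e * Cmod h).
  { intros th Hth. destruct (H th Hth) as [_ [B1 B2]]. unfold D.
    replace (X + RtoC 0 * h)%C with X by ring.
    replace (_ - _)%C with ((f1 (X + RtoC th * h) - f1 X) * RtoC (fst h)
       + (f2 (X + RtoC th * h) - f2 X) * RtoC (snd h))%C by ring.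
    eapply Rle_trans; [apply Cmod_triangle|]. rewrite !Cmod_mult, !Cmod_R.
    assert (m1 := fst_le_Cmod h). assert (m2 := snd_le_Cmod h).
    assert (Cmod (f1 (X + RtoC th * h) - f1 X)%C * Rabs (fst h) <= e * Cmod h)
      by (apply Rmult_le_compat; auto using Cmod_ge_0, Rabs_pos).
    assert (Cmod (f2 (X + RtoC th * h) - f2 X)%C * Rabs (snd h) <= e * Cmod h)
      by (apply Rmult_le_compat; auto using Cmod_ge_0, Rabs_pos).
    lra. }
  assert (Hmvt : forall (F dF : R -> R), (forall th, 0 <= th <= 1 -> is_derive F th (dF th)) ->
    (forall th, 0 <= th <= 1 -> Rabs (dF th - dF 0) <= 2 * e * Cmod h) ->
    Rabs (F 1 - F 0 - dF 0) <= 2 * e * Cmod h).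
  { intros F dF HF Hb. destruct (MVT_gen F 0 1 dF) as [c [Hc E]].
    - intros x. rewrite Rmin_left, Rmax_right by lra. intros Hx. apply HF. lra.
    - intros x. rewrite Rmin_left, Rmax_right by lra. intros Hx.
      apply derivable_continuous_pt. exists (dF x). apply is_derive_Reals, HF. lra.
    - rewrite Rmin_left, Rmax_right in Hc by lra. rewrite E.
      replace (dF c * (1 - 0) - dF 0) with (dF c - dF 0) by ring. auto. }
  assert (R1 := Hmvt (fun th => fst (f (X + RtoC th * h)%C)) (fun th => fst (D th))
    (fun th Hth => proj1 (HD th Hth))
    (fun th Hth => Rle_trans _ _ _ (fst_le_Cmod (D th - D 0)%C) (HDb th Hth))).
  assert (R2 := Hmvt (fun th => snd (f (X + RtoC th * h)%C)) (fun th => snd (D th))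
    (fun th Hth => proj2 (HD th Hth))
    (fun th Hth => Rle_trans _ _ _ (snd_le_Cmod (D th - D 0)%C) (HDb th Hth))).
  cbv beta in R1, R2.
  replace (X + RtoC 1 * h)%C with (X + h)%C in R1, R2 by ring.
  assert (HD0 : D 0 = (f1 X * RtoC (fst h) + f2 X * RtoC (snd h))%C).
  { unfold D. now replace (X + RtoC 0 * h)%C with X by ring. }
  rewrite HD0 in R1, R2.
  replace (X + RtoC 0 * h)%C with X in R1, R2 by ring.
  set (L := (f1 X * RtoC (fst h) + f2 X * RtoC (snd h))%C) in *.
  eapply Rle_trans; [apply Cmod_le_abs|].
  change (fst (f (X + h) - f X - L)%C) with (fst (f (X + h)%C) - fst (f X) - fst L).
  change (snd (f (X + h) - f X - L)%C) with (snd (f (X + h)%C) - snd (f X) - snd L).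
  lra.
Qed.

(** Differentiation under the integral sign: the increment bound holds with one modulus for all
    points of the curve, by compactness, and is then integrated. [e'] is [e] divided by 4 T (Wb +
    1). *)
Lemma potential_differentiable (x : C) : (forall s, x <> g s) ->
  forall e, 0 < e -> exists d, 0 < d /\ forall h : C, Cmod h < d ->
    Cmod (potential f (x + h) - potential f x
          - (potential f1 x * RtoC (fst h) + potential f2 x * RtoC (snd h)))%C <= e * Cmod h.
Proof.
  intros Hx e He.
  assert (Hb : 0 <= Wb) by (eapply Rle_trans; [apply Cmod_ge_0 | apply (Hw_bound 0)]).
  assert (Hq : 0 < 4 * T * (Wb + 1)) by (repeat apply Rmult_lt_0_compat; lra).
  set (e' := e / (4 * T * (Wb + 1))).
  assert (He' : 0 < e') by (apply Rdiv_lt_0_compat; lra).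
  destruct (kernel_tube f1 x Hf1 Hx _ He') as [d1 [Hd1 H1]].
  destruct (kernel_tube f2 x Hf2 Hx _ He') as [d2 [Hd2 H2]].
  destruct (off_curve_open x Hx) as [d3 [Hd3 H3]].
  exists (Rmin d1 (Rmin d2 d3)). split; [repeat apply Rmin_pos; auto|].
  intros h Hh.
  assert (Hh1 := Rlt_le_trans _ _ _ Hh (Rmin_l _ _)).
  assert (Hh' := Rlt_le_trans _ _ _ Hh (Rmin_r _ _)).
  assert (Hh2 := Rlt_le_trans _ _ _ Hh' (Rmin_l _ _)).
  assert (Hh3 := Rlt_le_trans _ _ _ Hh' (Rmin_r _ _)).
  assert (Hseg : forall th, 0 <= th <= 1 -> Cmod (x + RtoC th * h - x)%C <= Cmod h).
  { intros th Hth. replace (x + RtoC th * h - x)%C with (RtoC th * h)%C by ring.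
    rewrite Cmod_mult, Cmod_R, Rabs_pos_eq by lra. assert (H0 := Cmod_ge_0 h). nra. }
  assert (Hxh : forall s, (x + h)%C <> g s).
  { apply H3. replace (x + h - x)%C with h by ring. exact Hh3. }
  assert (I0 := CInt_correct _ _ _ (potential_ex f _ Hf Hxh)).
  assert (I1 := CInt_correct _ _ _ (potential_ex f _ Hf Hx)).
  assert (I2 := is_CInt_scal _ _ _ (RtoC (fst h)) _ (CInt_correct _ _ _ (potential_ex f1 _ Hf1 Hx))).
  assert (I3 := is_CInt_scal _ _ _ (RtoC (snd h)) _ (CInt_correct _ _ _ (potential_ex f2 _ Hf2 Hx))).
  assert (I := is_CInt_minus _ _ _ _ _ _ (is_CInt_minus _ _ _ _ _ _ I0 I1) (is_CInt_plus _ _ _ _ _ _ I2 I3)).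
  fold (potential f (x + h)%C) (potential f x) (potential f1 x) (potential f2 x) in I.
  rewrite (Cmult_comm (potential f1 x)), (Cmult_comm (potential f2 x)).
  eapply Rle_trans.
  - refine (is_CInt_bound _ 0 T (4 * e' * Cmod h * Wb) _ _ _ I); [lra|].
    intros s Hs.
    assert (Hinc := increment_bound (x - g s)%C h e').
    assert (Hcond : forall th, 0 <= th <= 1 -> (x - g s + RtoC th * h)%C <> 0 /\
     Cmod (f1 (x - g s + RtoC th * h) - f1 (x - g s))%C <= e' /\
     Cmod (f2 (x - g s + RtoC th * h) - f2 (x - g s))%C <= e').
    { intros th Hth. specialize (Hseg th Hth).
      replace (x - g s + RtoC th * h)%C with (x + RtoC th * h - g s)%C by ring. split.
      - intros E. apply (H3 (x + RtoC th * h)%C ltac:(lra) s).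
        replace (x + RtoC th * h)%C with (x + RtoC th * h - g s + g s)%C by ring. rewrite E. ring.
      - split; left; [apply H1 | apply H2]; auto; lra. }
    specialize (Hinc Hcond).
    replace (x - g s + h)%C with (x + h - g s)%C in Hinc by ring.
    match goal with |- Cmod ?z <= _ =>
      replace z with ((f (x + h - g s) - f (x - g s) -
        (f1 (x - g s) * RtoC (fst h) + f2 (x - g s) * RtoC (snd h))) * w s)%C by ring end.
    rewrite Cmod_mult. apply Rmult_le_compat; auto using Cmod_ge_0.
  - assert (H0 := Cmod_ge_0 h).
    replace ((T - 0) * (4 * e' * Cmod h * Wb)) with (e * Cmod h * (Wb / (Wb + 1)))
      by (unfold e'; field; lra).
    rewrite <- (Rmult_1_r (e * Cmod h)) at 2. apply Rmult_le_compat_l; [apply Rmult_le_pos; lra|].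
    apply Rmult_le_reg_r with (Wb + 1); [lra|]. field_simplify; lra.
Qed.

End Differentiation.

Lemma Derive_RC_unique (f : R -> C) (t : R) (d : C) : is_Cderive f t d -> Derive_RC f t = d.
Proof.
  intros [H1 H2]. unfold Derive_RC. apply injective_projections; now apply is_derive_unique.
Qed.

Lemma frechet_grad (v : R * R -> C) (x : R * R) (a b : C) :
  (forall e, 0 < e -> exists d, 0 < d /\ forall h : C, Cmod h < d ->
    Cmod (v (Cplus x h) - v x - (a * RtoC (fst h) + b * RtoC (snd h)))%C <= e * Cmod h) ->
  differentiable_at v x /\ grad v x = (a, b).
Proof.
  intros H.
  assert (Hnorm : forall z : C, Cmod z = @norm R_AbsRing C_R_NormedModule z) by exact Cmod_norm.
  split.
  - exists (fun h : R * R => (a * RtoC (fst h) + b * RtoC (snd h))%C). split.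
    + split.
      * intros y z. change (plus y z) with (Cplus y z).
        change (plus ?p ?q) with (Cplus p q). simpl. rewrite !RtoC_plus. ring.
      * intros k y. apply injective_projections; unfold scal; simpl; unfold prod_scal, scal;
          simpl; unfold mult; simpl; ring.
      * exists (Cmod a + Cmod b + 1). assert (Ha := Cmod_ge_0 a). assert (Hb := Cmod_ge_0 b).
        split; [lra|]. intros y.
        change (@norm R_AbsRing C_R_NormedModule (linmap a b y)
                <= (Cmod a + Cmod b + 1) * @norm R_AbsRing C_R_NormedModule y).
        rewrite <- !Hnorm.
        eapply Rle_trans; [apply linmap_upper|]. apply Rmult_le_compat_r; [apply Cmod_ge_0 | lra].
    + intros y Hy. 
      apply (@is_filter_lim_locally_unique R_AbsRing
               (prod_NormedModule R_AbsRing R_NormedModule R_NormedModule)) in Hy.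
      subst y. intros eps.
      destruct (H eps (cond_pos eps)) as [d [Hd Hb]].
      assert (Hd2 : 0 < d / 2) by lra.
      exists (mkposreal _ Hd2). intros y Hy. apply Cmod_C_ball in Hy. simpl in Hy.
      specialize (Hb (y - x)%C ltac:(lra)).
      assert (Hxy : forall p q : C, (p + (q - p))%C = q) by (intros; ring).
      rewrite Hxy in Hb.
      rewrite !Hnorm in Hb. exact Hb.
  - unfold grad. f_equal; apply Derive_RC_unique, is_Cderive_bound; intros e He;
      destruct (H e He) as [d [Hd Hb]]; exists d; split; auto; intros h Hh.
    + specialize (Hb (RtoC h)). rewrite Cmod_R in Hb. specialize (Hb Hh).
      replace (Cplus x (RtoC h)) with (fst x + h, snd x) in Hb
        by (unfold Cplus; simpl; f_equal; ring).
      rewrite <- surjective_pairing. simpl fst in Hb; simpl snd in Hb.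
      replace (a * RtoC h + b * RtoC 0)%C with (a * RtoC h)%C in Hb by ring. exact Hb.
    + specialize (Hb (RtoC h * Ci)%C). rewrite Cmod_mult, Cmod_R, Cmod_Ci, Rmult_1_r in Hb.
      specialize (Hb Hh).
      replace (Cplus x (RtoC h * Ci)) with (fst x, snd x + h) in Hb
        by (unfold Cplus; simpl; f_equal; ring).
      rewrite <- surjective_pairing.
      replace (a * RtoC (fst (RtoC h * Ci)) + b * RtoC (snd (RtoC h * Ci)))%C with (b * RtoC h)%C in Hb.
      2:{ simpl. replace (h * 0 - 0 * 1) with 0 by ring. replace (h * 1 + 0 * 0) with h by ring. ring. }
      exact Hb.
Qed.

Lemma grad_Phi (k0 : R) (eps1 eps2 : C) (x y : R * R) :
  0 < k0 -> 0 < Im eps1 -> 0 < Im eps2 -> x <> y ->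
  grad (fun z => Phi k0 eps1 eps2 z y) x =
    (grad_kernel1 k0 eps1 eps2 (Cminus x y), grad_kernel2 k0 eps1 eps2 (Cminus x y)).
Proof.
  intros Hk H1 H2 Hxy.
  assert (Hn : Cminus x y <> RtoC 0).
  { intros E. apply Hxy.
    assert (Hpq : forall p q : C, (p - q)%C = RtoC 0 -> p = q).
    { intros p q Hz. replace p with (p - q + q)%C by ring. rewrite Hz. ring. }
    now apply Hpq. }
  unfold grad. f_equal; apply Derive_RC_unique.
  - apply is_Cderive_ext with (fun s => kernel k0 eps1 eps2 (s - fst y, snd x - snd y)).
    { apply filter_forall. intros s. reflexivity. }
    assert (H := is_Cderive_kernel k0 eps1 eps2 Hk H1 H2
      (fun s => (s - fst y, snd x - snd y)) (fst x) (RtoC 1)).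
    change (fst x - fst y, snd x - snd y) with (Cminus x y) in H.
    simpl fst in H at 3; simpl snd in H at 3.
    evar_last; [apply H; auto|].
    + split; simpl.
      * auto_derive; auto.
      * auto_derive; auto.
    + change (fst (RtoC 1)) with 1. change (snd (RtoC 1)) with 0.
      match goal with |- @eq _ ?a ?b => change (@eq C a b) end.
      change ((fst x - fst y, snd x - snd y) : C) with (Cminus x y). ring.
  - apply is_Cderive_ext with (fun s => kernel k0 eps1 eps2 (fst x - fst y, s - snd y)).
    { apply filter_forall. intros s. reflexivity. }
    assert (H := is_Cderive_kernel k0 eps1 eps2 Hk H1 H2
      (fun s => (fst x - fst y, s - snd y)) (snd x) Ci).
    evar_last; [apply H; auto|].
    + split; simpl.
      * auto_derive; auto.
      * auto_derive; auto.
    + change (fst Ci) with 0. change (snd Ci) with 1.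
      match goal with |- @eq _ ?a ?b => change (@eq C a b) end.
      change ((fst x - fst y, snd x - snd y) : C) with (Cminus x y). ring.
Qed.

(** * Jump relations for a kernel with Cauchy singularity *)

(** The conditions on the leading kernel in the section above; they hold for c / L with L an
    invertible real-linear map, and are stable under sums. *)
Definition cauchy_like (k : C -> C) (K : R) : Prop :=
  0 < K /\
  (forall X : C, X <> 0 -> continuous k X) /\
  (forall X : C, X <> 0 -> Cmod (k X) <= K / Cmod X) /\
  (forall X Y : C, X <> 0 -> Y <> 0 ->
    Cmod (k X - k Y)%C <= K * Cmod (X - Y)%C / (Cmod X * Cmod Y)) /\
  (forall (x : R) (X : C), x <> 0 -> X <> 0 -> k (RtoC x * X)%C = (k X / RtoC x)%C).

Lemma linmap_hom (p q : C) (x : R) (X : C) : linmap p q (RtoC x * X)%C = (RtoC x * linmap p q X)%C.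
Proof.
  unfold linmap. simpl.
  replace (x * fst X - 0 * snd X) with (x * fst X) by ring.
  replace (x * snd X + 0 * fst X) with (x * snd X) by ring.
  rewrite !RtoC_mult. ring.
Qed.

Lemma cauchy_like_linmap (p q c : C) : Im (Cconj p * q)%C <> 0 ->
  exists K, cauchy_like (fun X => c / linmap p q X)%C K.
Proof.
  intros Hm. destruct (linmap_lower p q Hm) as [l [Hl Hlow]].
  assert (Hc := Cmod_ge_0 c). set (s := Cmod p + Cmod q).
  assert (Hs : 0 <= s) by (apply Rplus_le_le_0_compat; apply Cmod_ge_0).
  assert (Hll : 0 < l ^ 2) by (apply pow_lt; auto).
  assert (HA : 0 <= Cmod c / l) by (apply Rmult_le_pos; [auto | left; now apply Rinv_0_lt_compat]).
  assert (HB : 0 <= Cmod c * s / l ^ 2).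
  { apply Rmult_le_pos; [now apply Rmult_le_pos | left; now apply Rinv_0_lt_compat]. }
  exists (Cmod c / l + Cmod c * s / l ^ 2 + 1).
  assert (Hnz : forall X : C, X <> 0 -> linmap p q X <> 0) by (intros; now apply linmap_neq_0).
  repeat split.
  - lra.
  - intros X HX.
    apply (continuous_Cdiv (fun _ => c) (linmap p q)); [apply continuous_const | | auto].
    apply (continuous_linmap p q (fun X => X)), continuous_id.
  - intros X HX. rewrite Cmod_div by auto.
    assert (Hx : 0 < Cmod X) by now apply Cmod_gt_0.
    assert (Hlx : 0 < l * Cmod X) by now apply Rmult_lt_0_compat.
    apply Rle_trans with (Cmod c / (l * Cmod X)).
    + apply Rmult_le_compat_l; auto. apply Rinv_le_contravar; auto.
    + replace (Cmod c / (l * Cmod X)) with (Cmod c / l * / Cmod X) by (field; lra).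
      apply Rmult_le_compat_r; [left; now apply Rinv_0_lt_compat | lra].
  - intros X Y HX HY.
    assert (Hx : 0 < Cmod X) by now apply Cmod_gt_0.
    assert (Hy : 0 < Cmod Y) by now apply Cmod_gt_0.
    replace (c / linmap p q X - c / linmap p q Y)%C
      with (c * linmap p q (Y - X) / (linmap p q X * linmap p q Y))%C
      by (rewrite linmap_minus; field; auto).
    rewrite Cmod_div by (apply Cmult_neq_0; auto).
    rewrite !Cmod_mult, (Cmod_minus_sym X Y).
    assert (U := linmap_upper p q (Y - X)%C). fold s in U.
    assert (Hxy : 0 < Cmod X * Cmod Y) by now apply Rmult_lt_0_compat.
    assert (HD := Cmod_ge_0 (Y - X)). set (d := Cmod (Y - X)) in *.
    assert (Hden : l ^ 2 * (Cmod X * Cmod Y) <= Cmod (linmap p q X) * Cmod (linmap p q Y)).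
    { replace (l ^ 2 * (Cmod X * Cmod Y)) with (l * Cmod X * (l * Cmod Y)) by ring.
      apply Rmult_le_compat; auto; apply Rmult_le_pos; lra. }
    apply Rle_trans with (Cmod c * (s * d) / (l ^ 2 * (Cmod X * Cmod Y))).
    + apply Rmult_le_compat.
      * apply Rmult_le_pos; auto using Cmod_ge_0.
      * left. apply Rinv_0_lt_compat. apply Rmult_lt_0_compat; apply Cmod_gt_0; auto.
      * now apply Rmult_le_compat_l.
      * apply Rinv_le_contravar; auto. now apply Rmult_lt_0_compat.
    + replace (Cmod c * (s * d) / (l ^ 2 * (Cmod X * Cmod Y)))
        with (Cmod c * s / l ^ 2 * (d / (Cmod X * Cmod Y))) by (field; lra).
      unfold Rdiv at 3. rewrite (Rmult_assoc _ d).
      apply Rmult_le_compat_r; [|lra].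
      apply Rmult_le_pos; auto. left; now apply Rinv_0_lt_compat.
  - intros x X Hx HX. rewrite linmap_hom. field. split; auto. now apply RtoC_neq_0.
Qed.

Lemma cauchy_like_plus (k1 k2 : C -> C) (K1 K2 : R) :
  cauchy_like k1 K1 -> cauchy_like k2 K2 -> cauchy_like (fun X => k1 X + k2 X)%C (K1 + K2).
Proof.
  intros [P1 [C1 [B1 [D1 H1]]]] [P2 [C2 [B2 [D2 H2]]]]. repeat split.
  - lra.
  - intros X HX. now apply (continuous_Cplus k1 k2); [apply C1 | apply C2].
  - intros X HX. eapply Rle_trans; [apply Cmod_triangle|].
    unfold Rdiv. rewrite Rmult_plus_distr_r. now apply Rplus_le_compat; [apply B1 | apply B2].
  - intros X Y HX HY.
    replace (k1 X + k2 X - (k1 Y + k2 Y))%C with ((k1 X - k1 Y) + (k2 X - k2 Y))%C by ring.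
    eapply Rle_trans; [apply Cmod_triangle|].
    unfold Rdiv. rewrite !Rmult_plus_distr_r. now apply Rplus_le_compat; [apply D1 | apply D2].
  - intros x X Hx HX. rewrite H1, H2 by auto. field. now apply RtoC_neq_0.
Qed.

Definition is_curve_pv (g w : R -> C) (T : R) (kappa : C -> C) (x l : C) : Prop :=
  exists J : R -> C,
    at_right 0 (fun d => is_CInt (fun s =>
      if Rlt_dec d (Cmod (g s - x)%C) then (kappa (x - g s) * w s)%C else RtoC 0) 0 T (J d)) /\
    filterlim J (at_right 0) (locally l).

(** Ensures that the principal value depends on the point of the curve and not on the parameter
    chosen for it. *)
Lemma is_curve_pv_unique (g w : R -> C) (T : R) (kappa : C -> C) (x l1 l2 : C) :
  is_curve_pv g w T kappa x l1 -> is_curve_pv g w T kappa x l2 -> l1 = l2.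
Proof.
  intros [J1 [I1 L1]] [J2 [I2 L2]].
  apply (filterlim_locally_unique (V := C_R_NormedModule) (F := at_right 0) J1); auto.
  apply filterlim_ext_loc with J2; auto.
  generalize (filter_and _ _ I1 I2). apply filter_imp. intros d [H1 H2].
  now rewrite <- (CInt_unique _ _ _ _ H1), <- (CInt_unique _ _ _ _ H2).
Qed.

Section ScalarJump.

Variables (g g' : R -> C) (T B : R).
Hypothesis Hg : regular_curve g g' T B.
Let HT : 0 < T := proj1 Hg.

Variable w : R -> C.
Variables Wb Wl : R.
Hypothesis Hw_bound : forall t, Cmod (w t) <= Wb.
Hypothesis Hw_lip : forall s t, Cmod (w s - w t)%C <= Wl * Rabs (s - t).
Hypothesis Hw_per : forall t, w (t + T) = w t.

Variables p1 q1 p2 q2 c1 c2 : C.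
Hypothesis Hcr1 : 0 < Im (Cconj p1 * q1)%C.
Hypothesis Hcr2 : Im (Cconj p2 * q2)%C < 0.

Variable kappa : C -> C.
Hypothesis Hkappa_cont : forall X : C, X <> 0 -> continuous kappa X.
Hypothesis Hrem : forall rho, exists M, 0 < M /\
  forall X : C, X <> 0 -> Cmod X <= rho ->
    Cmod (kappa X - (c1 / linmap p1 q1 X + c2 / linmap p2 q2 X))%C <= M.

(* Jump across the curve: half the difference of the one-sided limits. *)
Definition half_jump (t : R) : C :=
  (w t * (RtoC PI * Ci) * (c2 / linmap p2 q2 (g' t) - c1 / linmap p1 q1 (g' t)))%C.

(** The regularized part tends to [P t0] from either side, and the model integrals add - sigma PI i
    c1 / L1(g') and + sigma PI i c2 / L2(g'). Letting [t] vary with [h] is needed for continuity of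
    the extension, not only for limits along one normal. *)
Lemma scalar_jump : exists P : R -> C,
  (forall t, is_curve_pv g w T kappa (g t) (P t)) /\
  (forall sigma t0 e, sigma = 1 \/ sigma = -1 -> 0 < e -> exists d, 0 < d /\
    forall t h, Rabs (t - t0) < d -> Rabs h < d -> 0 < sigma * h ->
      Cmod (potential g T w kappa (g t + RtoC h * normal g' t)
            - (P t0 + RtoC sigma * half_jump t0))%C < e).
Proof.
  set (k := fun X => (c1 / linmap p1 q1 X + c2 / linmap p2 q2 X)%C).
  assert (Hk : exists K, cauchy_like k K).
  { destruct (cauchy_like_linmap p1 q1 c1) as [K1 H1]; [lra|].
    destruct (cauchy_like_linmap p2 q2 c2) as [K2 H2]; [lra|].
    exists (K1 + K2). now apply (cauchy_like_plus _ _ K1 K2). }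
  destruct Hk as [K [HK [Hkc [Hkb [Hkd Hkh]]]]].
  destruct (regularized_bound g g' T B Hg w Wb Wl Hw_bound Hw_lip kappa k K HK Hkb Hkd Hrem)
    as [M [h0 [HM [Hh0 HMb]]]].
  set (P := regular_value g g' T w kappa k M).
  exists P. split.
  - intros t. apply (principal_value g g' T B Hg w Wl Hw_lip Hw_per kappa k) with (h0 := h0); auto.
  - intros sigma t0 e Hsg He.
    assert (Hn1 : linmap p1 q1 (g' t0) <> 0).
    { apply linmap_neq_0; [lra|]. apply (curve_deriv_neq_0 _ _ _ _ Hg). }
    assert (Hn2 : linmap p2 q2 (g' t0) <> 0).
    { apply linmap_neq_0; [lra|]. apply (curve_deriv_neq_0 _ _ _ _ Hg). }
    set (A := (RtoC sigma * (RtoC PI * Ci) * (c2 / linmap p2 q2 (g' t0) - c1 / linmap p1 q1 (g' t0)))%C).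
    set (cc := Cmod c1 + Cmod c2 + 1).
    assert (C1 := Cmod_ge_0 c1). assert (C2 := Cmod_ge_0 c2). assert (CA := Cmod_ge_0 A).
    assert (Hb : 0 <= Wb) by (eapply Rle_trans; [apply Cmod_ge_0 | apply (Hw_bound 0)]).
    assert (He1 : 0 < e / 4 / (cc * (Wb + 1))).
    { apply Rdiv_lt_0_compat; [lra|]. unfold cc. apply Rmult_lt_0_compat; lra. }
    destruct (regularized_CInt_limit g g' T B Hg w Wl Hw_lip kappa k Hkappa_cont Hkc M h0 HM Hh0 HMb
      t0 (e / 4)) as [d1 [Hd1 L1]]; [lra|].
    destruct (model_integral_limit g g' T B Hg p1 q1 1 sigma t0 (e / 4 / (cc * (Wb + 1))))
      as [d2 [Hd2 L2]]; auto; [lra|].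
    destruct (model_integral_limit g g' T B Hg p2 q2 (-1) sigma t0 (e / 4 / (cc * (Wb + 1))))
      as [d3 [Hd3 L3]]; auto; [lra|].
    assert (Hwc : 0 < e / 4 / (Cmod A + 1)) by (apply Rdiv_lt_0_compat; lra).
    destruct (proj1 (continuous_Cmod_lt w t0) (density_continuous w Wl Hw_lip t0) _ Hwc) as [d4 L4].
    exists (Rmin d1 (Rmin d2 (Rmin d3 d4))). split.
    { repeat apply Rmin_pos; auto; try apply cond_pos; lra. }
    intros t h Ht Hh Hsh.
    assert (E1 := Rmin_l d1 (Rmin d2 (Rmin d3 d4))). assert (E2 := Rmin_r d1 (Rmin d2 (Rmin d3 d4))).
    assert (E3 := Rmin_l d2 (Rmin d3 d4)). assert (E4 := Rmin_r d2 (Rmin d3 d4)).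
    assert (E5 := Rmin_l d3 d4). assert (E6 := Rmin_r d3 d4).
    assert (Hh1 : h <> 0) by (intros ->; lra).
    specialize (L1 t h ltac:(lra) ltac:(lra) Hh1).
    destruct (L2 t h ltac:(lra) ltac:(lra) Hsh) as [l1 [I1 N1]].
    destruct (L3 t h ltac:(lra) ltac:(lra) Hsh) as [l2 [I2 N2]].
    assert (N4 : Cmod (w t - w t0)%C < e / 4 / (Cmod A + 1)).
    { apply (L4 t). change (Rabs (t - t0) < d4). lra. }
    assert (Hdec : potential g T w kappa (g t + RtoC h * normal g' t)%C =
        (CInt (regularized g g' w kappa k t h) (- (T / 2)) (T / 2)
          + w t * CInt (fun u => k (chord_model g' t h u)) (- (T / 2)) (T / 2))%C).
    { apply (potential_decompose g g' T B Hg w Wl Hw_lip Hw_per kappa k) with (M := M) (h0 := h0); auto. lra. }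
    assert (Hint : CInt (fun u => k (chord_model g' t h u)) (- (T / 2)) (T / 2) = (c1 * l1 + c2 * l2)%C).
    { apply CInt_unique. apply is_CInt_plus; now apply is_CInt_scal. }
    rewrite Hdec, Hint.
    set (R0 := CInt (regularized g g' w kappa k t h) (- (T / 2)) (T / 2)) in *. fold P in L1.
    set (m1 := (- (RtoC (1 * sigma * PI) * Ci / linmap p1 q1 (g' t0)))%C) in *.
    set (m2 := (- (RtoC (-1 * sigma * PI) * Ci / linmap p2 q2 (g' t0)))%C) in *.
    assert (HA : (c1 * m1 + c2 * m2)%C = A).
    { unfold m1, m2, A. rewrite !RtoC_mult. 
      replace (RtoC (-1)) with (- RtoC 1)%C by (rewrite <- RtoC_opp; f_equal; lra).
      field. auto. }
    replace (RtoC sigma * half_jump t0)%C with (w t0 * A)%C by (unfold half_jump, A; ring).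
    replace (R0 + w t * (c1 * l1 + c2 * l2) - (P t0 + w t0 * A))%C with
      ((R0 - P t0) + w t * (c1 * (l1 - m1) + c2 * (l2 - m2)) + (w t - w t0) * A)%C
      by (rewrite <- HA; ring).
    eapply Rle_lt_trans; [apply Cmod_triangle|].
    eapply Rle_lt_trans; [apply Rplus_le_compat_r, Cmod_triangle|].
    rewrite !Cmod_mult.
    set (e1 := e / 4 / (cc * (Wb + 1))) in *.
    assert (B1 : Cmod (c1 * (l1 - m1) + c2 * (l2 - m2))%C <= cc * e1).
    { eapply Rle_trans; [apply Cmod_triangle|]. rewrite !Cmod_mult.
      assert (Cmod c1 * Cmod (l1 - m1)%C <= Cmod c1 * e1) by (apply Rmult_le_compat_l; lra).
      assert (Cmod c2 * Cmod (l2 - m2)%C <= Cmod c2 * e1) by (apply Rmult_le_compat_l; lra).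
      unfold cc. lra. }
    assert (B2 : Cmod (w t) * Cmod (c1 * (l1 - m1) + c2 * (l2 - m2))%C <= e / 4).
    { apply Rle_trans with ((Wb + 1) * (cc * e1)).
      - apply Rmult_le_compat; auto using Cmod_ge_0. specialize (Hw_bound t). lra.
      - apply Req_le. unfold e1, cc. field. lra. }
    assert (B3 : Cmod (w t - w t0)%C * Cmod A <= e / 4).
    { apply Rle_trans with (e / 4 / (Cmod A + 1) * (Cmod A + 1)).
      - apply Rmult_le_compat; auto using Cmod_ge_0; lra.
      - apply Req_le. field. lra. }
    lra.
Qed.

End ScalarJump.

(** * The curve as the boundary of a domain *)

Lemma is_Cderive_of_is_derive (f : R -> C) (t : R) (d : C) :
  @is_derive R_AbsRing (prod_NormedModule R_AbsRing R_NormedModule R_NormedModule) f t d ->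
  is_Cderive f t d.
Proof.
  intros [_ H]. apply is_Cderive_bound. intros e He.
  destruct (H t (fun P HP => HP) (mkposreal e He)) as [r Hr].
  exists r. split; [apply cond_pos|]. intros h Hh.
  assert (Hb : ball t r (t + h)).
  { change (Rabs (t + h - t) < r). now replace (t + h - t) with h by ring. }
  specialize (Hr _ Hb). simpl pos in Hr.
  assert (Hn : @norm R_AbsRing R_NormedModule (minus (t + h) t) = Rabs h).
  { change (Rabs (t + h - t) = Rabs h). f_equal. ring. }
  change (@norm R_AbsRing C_R_NormedModule
     (f (t + h)%R - f t - @scal R_AbsRing C_R_NormedModule (t + h - t)%R d)%C
     <= e * @norm R_AbsRing R_NormedModule (minus (t + h) t)) in Hr.
  rewrite Hn in Hr.
  assert (Hnorm : forall z : C, Cmod z = @norm R_AbsRing C_R_NormedModule z) by exact Cmod_norm.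
  rewrite <- Hnorm in Hr.
  replace (@scal R_AbsRing C_R_NormedModule (t + h - t)%R d) with (d * RtoC h)%C in Hr; auto.
  apply injective_projections; unfold scal; simpl; unfold prod_scal, scal; simpl;
    unfold mult; simpl; ring.
Qed.

Lemma C2_closed_curve_regular (G : R * R -> Prop) (gamma : R -> R * R) (T : R) :
  C2_closed_curve G gamma T ->
  exists g' B, regular_curve gamma g' T B /\ (forall t, velocity gamma t = g' t).
Proof.
  intros [HT [[g' [Hd1 [g'' [Hd2 Hc]]]] [Hper [Hinj [Hv _]]]]].
  assert (D1 : forall t, is_Cderive gamma t (g' t)) by (intros; now apply is_Cderive_of_is_derive).
  assert (D2 : forall t, is_Cderive g' t (g'' t)) by (intros; now apply is_Cderive_of_is_derive).
  assert (Hper' := is_Cderive_periodic gamma g' T Hper D1).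
  destruct (periodic_Cderive_lipschitz g' g'' T HT Hper' D2 Hc) as [B [HB Hl]].
  assert (Hvel : forall t, velocity gamma t = g' t).
  { intros t. destruct (D1 t) as [E1 E2]. unfold velocity.
    apply injective_projections; now apply is_derive_unique. }
  exists g', B. repeat (split; auto).
  intros t E. apply (Hv t). now rewrite Hvel, E.
Qed.

(** The speed is absorbed into the density, so that integrals over arc length become integrals in
    the parameter with a bounded Lipschitz weight. *)
Lemma density_regular (gamma g' : R -> C) (T B : R) (phi : R * R -> C) :
  regular_curve gamma g' T B -> C1_on_curve gamma phi ->
  exists Wb Wl, let w := fun s => (phi (gamma s) * RtoC (Cmod (g' s)))%C in
    (forall t, Cmod (w t) <= Wb) /\ (forall s t, Cmod (w s - w t)%C <= Wl * Rabs (s - t)) /\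
    (forall t, w (t + T) = w t).
Proof.
  intros Hg [d [Hd Hc]].
  destruct Hg as [HT [HB [Hder [Hlip [Hper Hrest]]]]].
  assert (Hg : regular_curve gamma g' T B) by (repeat (split; auto)).
  set (f := fun t => phi (gamma t)).
  assert (Hf : forall t, f (t + T) = f t) by (intros t; unfold f; now rewrite Hper).
  assert (Df : forall t, is_Cderive f t (d t)) by (intros; now apply is_Cderive_of_is_derive).
  destruct (periodic_Cderive_lipschitz f d T HT Hf Df Hc) as [L [HL Hl]].
  assert (Hfb := periodic_lipschitz_bounded f T L HT HL Hf Hl).
  set (F := Cmod (f 0) + L * T) in *.
  destruct (curve_deriv_bounds gamma g' T B Hg) as [m [M [Hm [HM Hb]]]].
  exists (F * M), (F * B + L * M). simpl. repeat split.
  - intros t. rewrite Cmod_mult, Cmod_R, Rabs_pos_eq by apply Cmod_ge_0.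
    apply Rmult_le_compat; auto using Cmod_ge_0. apply Hfb. apply Hb.
  - intros s t. fold (f s) (f t).
    replace (f s * RtoC (Cmod (g' s)) - f t * RtoC (Cmod (g' t)))%C
      with (f s * RtoC (Cmod (g' s) - Cmod (g' t)) + (f s - f t) * RtoC (Cmod (g' t)))%C
      by (rewrite RtoC_minus; ring).
    eapply Rle_trans; [apply Cmod_triangle|]. rewrite !Cmod_mult, !Cmod_R.
    rewrite (Rabs_pos_eq (Cmod (g' t))) by apply Cmod_ge_0.
    assert (H1 : Rabs (Cmod (g' s) - Cmod (g' t)) <= B * Rabs (s - t)).
    { eapply Rle_trans; [|apply Hlip].
      assert (T1 := Cmod_triangle_rev (g' s) (g' t)).
      assert (T2 := Cmod_triangle_rev (g' t) (g' s)). rewrite Cmod_minus_sym in T2.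
      apply Rabs_le. lra. }
    assert (H2 : Cmod (f s) * Rabs (Cmod (g' s) - Cmod (g' t)) <= F * (B * Rabs (s - t))).
    { apply Rmult_le_compat; auto using Cmod_ge_0, Rabs_pos. }
    assert (H3 : Cmod (f s - f t)%C * Cmod (g' t) <= L * Rabs (s - t) * M).
    { apply Rmult_le_compat; auto using Cmod_ge_0. apply Hb. }
    lra.
  - intros t. rewrite Hper. now rewrite (is_Cderive_periodic gamma g' T Hper Hder).
Qed.

Lemma open_closure_frontier (D : R * R -> Prop) (x : R * R) :
  open D -> D x -> ~ frontier D x.
Proof.
  intros Ho Hx [_ Hf]. destruct (Ho x Hx) as [e He].
  destruct (Hf e) as [y [Hb Hy]]. apply Hy, He, Hb.
Qed.

Lemma closure_frontier (D : R * R -> Prop) (x : R * R) :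
  closure2 D x -> D x \/ frontier D x.
Proof.
  intros Hc. destruct (classic (D x)) as [H|H]; auto. right. split; auto.
  intros e. exists x. split; auto. apply ball_center.
Qed.

Lemma subset_closure (D : R * R -> Prop) (x : R * R) : D x -> closure2 D x.
Proof. intros H e. exists x. split; auto. apply ball_center. Qed.

Lemma closure_complement_open (D : R * R -> Prop) (x : R * R) :
  ~ closure2 D x -> locally x (fun y => ~ D y).
Proof.
  intros H. apply not_all_ex_not in H. destruct H as [e He].
  exists e. intros y Hy HD. apply He. now exists y.
Qed.

(* A path that avoids the frontier cannot leave the domain: its indicator is
   locally constant, so the intermediate value theorem applies. *)
Lemma path_off_frontier (D : R * R -> Prop) (c : R -> R * R) (a b : R) :
  open D -> (forall t, continuous c t) ->
  (forall t, Rmin a b <= t <= Rmax a b -> ~ frontier D (c t)) ->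
  D (c a) -> D (c b).
Proof.
  intros Ho Hc Hoff Ha. apply NNPP. intros Hb.
  set (chi := fun t => if excluded_middle_informative (D (c t)) then 1 else -1).
  assert (H1 : forall t, D (c t) -> chi t = 1).
  { intros t Ht. unfold chi. destruct (excluded_middle_informative _); tauto. }
  assert (H2 : forall t, ~ D (c t) -> chi t = -1).
  { intros t Ht. unfold chi. destruct (excluded_middle_informative _); tauto. }
  assert (Hchi : forall t, Rmin a b <= t <= Rmax a b -> continuity_pt chi t).
  { intros t Ht. apply continuity_pt_filterlim. change (continuous chi t).
    destruct (classic (D (c t))) as [HD|HD].
    - apply continuous_ext_loc with (fun _ : R => 1); [|apply continuous_const].
      assert (Hl : locally t (fun s => D (c s))) by exact (Hc t _ (Ho _ HD)).
      generalize Hl. apply filter_imp. intros s Hs. symmetry. now apply H1.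
    - apply continuous_ext_loc with (fun _ : R => -1); [|apply continuous_const].
      assert (Hn : ~ closure2 D (c t)).
      { intros Hcl. destruct (closure_frontier _ _ Hcl); auto. now apply (Hoff t Ht). }
      assert (Hl : locally t (fun s => ~ D (c s))) by exact (Hc t _ (closure_complement_open _ _ Hn)).
      generalize Hl. apply filter_imp.
      intros s Hs. symmetry. now apply H2. }
  assert (Hz : exists z, chi z = 0).
  { destruct (Rle_lt_dec a b) as [Hab|Hab].
    - rewrite Rmin_left, Rmax_right in * by lra.
      destruct Hab as [Hab| ->]; [|tauto].
      destruct (IVT_interv (- chi)%F a b) as [z [_ Hz]]; auto.
      + intros t Ht. apply continuity_pt_opp. now apply Hchi.
      + unfold opp_fct. rewrite H1 by auto. lra.
      + unfold opp_fct. rewrite H2 by auto. lra.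
      + exists z. unfold opp_fct in Hz. lra.
    - rewrite Rmin_right, Rmax_left in * by lra.
      destruct (IVT_interv chi b a) as [z [_ Hz]]; auto.
      + rewrite H2 by auto. lra.
      + rewrite H1 by auto. lra.
      + now exists z. }
  destruct Hz as [z Hz]. unfold chi in Hz. destruct (excluded_middle_informative _); lra.
Qed.

Lemma unit_normal_unique (g' : R -> C) (t : R) (n : R * R) :
  0 < Cmod (g' t) -> norm2 n = 1 -> dot2 n (g' t) = 0 ->
  exists sigma, (sigma = 1 \/ sigma = -1) /\ n = (RtoC sigma * normal g' t)%C.
Proof.
  intros Hp Hn Hd. unfold normal. set (G := g' t) in *. set (r := Cmod G) in *.
  assert (Hr : r * r = fst G * fst G + snd G * snd G).
  { unfold r, Cmod. rewrite sqrt_sqrt; [ring|]. apply Rplus_le_le_0_compat; apply pow2_ge_0. }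
  assert (Hn2 : fst n * fst n + snd n * snd n = 1).
  { unfold norm2, dot2 in Hn. rewrite <- (sqrt_sqrt (fst n * fst n + snd n * snd n)), Hn by nra. ring. }
  unfold dot2 in Hd.
  set (s := (fst G * snd n - snd G * fst n) / r).
  assert (Hs : s * r = fst G * snd n - snd G * fst n) by (unfold s; field; lra).
  assert (Hs2 : s * s = 1).
  { apply Rmult_eq_reg_r with (r * r); [|apply Rmult_integral_contrapositive; lra].
    replace (s * s * (r * r)) with ((s * r) * (s * r)) by ring. rewrite Hs, Hr, Rmult_1_l.
    transitivity ((fst G * fst G + snd G * snd G) * (fst n * fst n + snd n * snd n)
       - (fst n * fst G + snd n * snd G) * (fst n * fst G + snd n * snd G)); [ring|].
    rewrite Hn2, Hd. ring. }
  exists s. split.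
  { assert (E : (s - 1) * (s + 1) = 0) by (replace ((s - 1) * (s + 1)) with (s * s - 1) by ring; lra).
    apply Rmult_integral in E. destruct E; [left | right]; lra. }
  assert (X1 : fst n * (r * r) = - snd G * (s * r)).
  { rewrite Hs, Hr. apply Rminus_diag_uniq.
    transitivity (fst G * (fst n * fst G + snd n * snd G)); [ring|]. rewrite Hd. ring. }
  assert (X2 : snd n * (r * r) = fst G * (s * r)).
  { rewrite Hs, Hr. apply Rminus_diag_uniq.
    transitivity (snd G * (fst n * fst G + snd n * snd G)); [ring|]. rewrite Hd. ring. }
  clearbody s r. apply injective_projections; simpl.
  - apply Rmult_eq_reg_r with (r * r); [|apply Rmult_integral_contrapositive; lra].
    rewrite X1. field. lra.
  - apply Rmult_eq_reg_r with (r * r); [|apply Rmult_integral_contrapositive; lra].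
    rewrite X2. field. lra.
Qed.

Section Sides.

Variables (Omega : R * R -> Prop) (g g' : R -> C) (T B : R) (nu : R * R -> R * R).
Hypothesis Hg : regular_curve g g' T B.
Hypothesis Hopen : open Omega.
Hypothesis Hfr : forall x, frontier Omega x <-> exists t, g t = x.
Hypothesis Hvel : forall t, velocity g t = g' t.
Hypothesis Hnu : forall x, frontier Omega x -> outward_unit_normal Omega g x (nu x).

(** After reduction of s - t modulo T to [- T / 2, T / 2), a coincidence would be a chord of length
    0, against [chord_lower]. *)
Lemma tube_off_curve : exists h1, 0 < h1 /\
  forall t h s, 0 < Rabs h <= h1 -> (g t + RtoC h * normal g' t)%C <> g s.
Proof.
  destruct (chord_lower g g' T B Hg) as [c [h1 [Hc [Hh1 Hch]]]].
  assert (HT : 0 < T) by exact (proj1 Hg).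
  exists h1. split; auto. intros t h s Hh E.
  destruct (period_reduce T (- (T / 2)) (s - t) HT) as [k Hk].
  set (u := s - t + IZR k * T) in *.
  assert (Es : g s = g (t + u)%R).
  { rewrite <- (periodic_Z g T (curve_periodic _ _ _ _ Hg) k s).
    f_equal. unfold u. ring. }
  specialize (Hch t h u ltac:(lra) ltac:(apply Rabs_le; lra)).
  unfold chord in Hch. rewrite E, Es in Hch.
  replace (g (t + u)%R - g (t + u)%R)%C with (RtoC 0) in Hch by ring.
  rewrite Cmod_0 in Hch. assert (H0 := Rabs_pos u).
  assert (0 < c * (Rabs h + Rabs u)) by (apply Rmult_lt_0_compat; lra). lra.
Qed.

(** Normal segments without their foot avoid the frontier, so each half lies on one side, and the
    outward normal tells which one near the foot. The sign is the same for all [t], since t -> g t +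
    h1 N(t) is also a path off the frontier. *)
Lemma sides : exists h1 sigma, 0 < h1 /\ (sigma = 1 \/ sigma = -1) /\
  forall t, nu (g t) = (RtoC sigma * normal g' t)%C /\
    forall h, 0 < Rabs h <= h1 ->
      (forall s, (g t + RtoC h * normal g' t)%C <> g s) /\
      (Omega (g t + RtoC h * normal g' t)%C <-> sigma * h < 0) /\
      (~ closure2 Omega (g t + RtoC h * normal g' t)%C <-> 0 < sigma * h).
Proof.
  destruct tube_off_curve as [h1 [Hh1 Htube]].
  set (z := fun t h => (g t + RtoC h * normal g' t)%C).
  assert (Hoff : forall t h, 0 < Rabs h <= h1 -> ~ frontier Omega (z t h)).
  { intros t h Hh Hf. apply Hfr in Hf. destruct Hf as [s Hs].
    apply (Htube t h s Hh). now rewrite Hs. }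
  assert (Hzc : forall t s, continuous (fun h => z t h) s).
  { intros t s. unfold z. prove_continuous. }
  assert (Hzc' : forall h s, continuous (fun t => z t h) s).
  { intros h s. assert (Cg := curve_continuous g g' T B Hg).
    assert (CN := normal_continuous g g' T B Hg). unfold z. prove_continuous. }
  assert (Hseg : forall t h h', 0 < Rabs h <= h1 -> 0 < Rabs h' <= h1 -> 0 < h * h' ->
            Omega (z t h) -> Omega (z t h')).
  { intros t h h' H1 H2 H3. apply (path_off_frontier Omega (fun h => z t h)); auto.
    intros s Hs. apply Hoff. revert Hs. unfold Rmin, Rmax, Rabs in *.
    destruct (Rle_dec h h'); destruct (Rcase_abs h); destruct (Rcase_abs h');
      destruct (Rcase_abs s); intros; try nra. }
  assert (Hloc : forall t, exists sigma, (sigma = 1 \/ sigma = -1) /\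
            nu (g t) = (RtoC sigma * normal g' t)%C /\
            forall h, 0 < Rabs h <= h1 -> (Omega (z t h) <-> sigma * h < 0)).
  { intros t. destruct (Hnu (g t)) as [N1 [N2 [h0 [Hh0 N3]]]]; [apply Hfr; now exists t|].
    destruct (unit_normal_unique g' t (nu (g t))) as [sigma [Hs En]]; auto.
    { apply (Cmod_deriv_pos g g' T B Hg). }
    { rewrite <- Hvel. now apply N2. }
    exists sigma. split; auto. split; auto.
    assert (Hss : sigma * sigma = 1) by (destruct Hs as [-> | ->]; ring).
    assert (Hsa : Rabs sigma = 1).
    { destruct Hs as [-> | ->]; [apply Rabs_R1 | rewrite Rabs_left; lra]. }
    assert (Hsh : forall d, shift (g t) d (nu (g t)) = z t (sigma * d)).
    { intros d. rewrite En. unfold z, shift. apply injective_projections; simpl; ring. }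
    set (d := Rmin h0 h1 / 2).
    assert (Hd : 0 < d) by (assert (0 < Rmin h0 h1) by (now apply Rmin_pos); unfold d; lra).
    assert (m1 := Rmin_l h0 h1). assert (m2 := Rmin_r h0 h1).
    destruct (N3 d) as [I1 I2]; [unfold d in *; lra|].
    rewrite Hsh in I1, I2.
    assert (Habs : forall x, Rabs (sigma * x) = Rabs x) by (intros; rewrite Rabs_mult, Hsa; ring).
    assert (B1 : 0 < Rabs (sigma * - d) <= h1).
    { rewrite Habs, Rabs_Ropp, Rabs_pos_eq by lra. unfold d in *; lra. }
    assert (B2 : 0 < Rabs (sigma * d) <= h1).
    { rewrite Habs, Rabs_pos_eq by lra. unfold d in *; lra. }
    intros h Hh. split; intros H.
    - apply Rnot_le_lt. intros Hle. apply I2, subset_closure.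
      assert (Hlt : 0 < sigma * h).
      { destruct Hle as [Hle|Hle]; auto. exfalso. symmetry in Hle.
        apply Rmult_integral in Hle. destruct Hle as [Hle|Hle].
        - rewrite Hle in Hss. lra.
        - rewrite Hle, Rabs_R0 in Hh. lra. }
      apply (Hseg t h); auto.
      replace (h * (sigma * d)) with (sigma * h * d) by ring. now apply Rmult_lt_0_compat.
    - apply (Hseg t (sigma * - d)); auto.
      replace (sigma * - d * h) with (- (sigma * h) * d) by ring. apply Rmult_lt_0_compat; lra. }
  assert (Hh1a : 0 < Rabs h1 <= h1) by (rewrite Rabs_pos_eq; lra).
  destruct (Hloc 0) as [sigma [Hs [_ H0]]].
  exists h1, sigma. split; auto. split; auto. intros t.
  destruct (Hloc t) as [sigma' [Hs' [En Ht]]].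
  assert (E : sigma' = sigma).
  { assert (Hpath : forall a b, Omega (z a h1) -> Omega (z b h1)).
    { intros a b. apply (path_off_frontier Omega (fun t => z t h1)); auto. }
    assert (Hiff : sigma * h1 < 0 <-> sigma' * h1 < 0).
    { rewrite <- (H0 h1 Hh1a), <- (Ht h1 Hh1a). split; apply Hpath. }
    destruct Hs as [-> | ->]; destruct Hs' as [-> | ->]; auto; exfalso; lra. }
  subst sigma'. split; auto. intros h Hh. split; [intros s; now apply Htube|].
  specialize (Ht h Hh). split; auto.
  assert (Hsh : sigma * h <> 0).
  { apply Rmult_integral_contrapositive. split; [destruct Hs as [-> | ->]; lra|].
    intros ->. rewrite Rabs_R0 in Hh. lra. }
  split; intros H.
  - apply Rnot_le_lt. intros Hle. apply H, subset_closure, Ht. lra.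
  - intros Hc. destruct (closure_frontier _ _ Hc) as [HO|HF].
    + apply Ht in HO. lra.
    + now apply (Hoff t h Hh).
Qed.

(** The foot is a nearest point, with its parameter shifted by periods to within T / 2 of [t0]. Then
    |g t - g t0| <= 2 |z - g t0|, and [chord_lower] at h = 0 turns this into a bound on t - t0. *)
Lemma normal_coordinates (t0 : R) : exists C0, 0 < C0 /\
  forall z : C, exists t h, z = (g t + RtoC h * normal g' t)%C /\
    Rabs (t - t0) <= C0 * Cmod (z - g t0)%C /\ Rabs h <= Cmod (z - g t0)%C.
Proof.
  destruct (chord_lower g g' T B Hg) as [c [h0 [Hc [Hh0 Hch]]]].
  assert (HT : 0 < T) by exact (proj1 Hg).
  assert (Hgp := curve_periodic _ _ _ _ Hg).
  assert (Hic : 0 < / c) by now apply Rinv_0_lt_compat.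
  exists (2 * / c). split; [lra|]. intros z.
  destruct (nearest_point g g' T B Hg z) as [t1 Hmin1].
  destruct (period_reduce T (- (T / 2)) (t1 - t0) HT) as [k Hk].
  set (t := t1 + IZR k * T).
  assert (Et : g t = g t1) by apply (periodic_Z g T Hgp k t1).
  assert (Hmin : forall s, Cmod (z - g t)%C <= Cmod (z - g s)%C) by (intros s; rewrite Et; apply Hmin1).
  destruct (nearest_point_normal g g' T B Hg z t Hmin) as [h Eh].
  exists t, h. split; auto. split.
  - set (u := t - t0).
    assert (Hu : Rabs u <= T / 2) by (apply Rabs_le; unfold u, t; lra).
    specialize (Hch t0 0 u ltac:(rewrite Rabs_R0; lra) Hu).
    unfold chord in Hch. rewrite Rabs_R0, Rplus_0_l in Hch.
    replace (t0 + u) with t in Hch by (unfold u; ring).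
    replace (g t0 + RtoC 0 * normal g' t0 - g t)%C
      with ((z - g t) - (z - g t0))%C in Hch by ring.
    assert (H1 := Cmod_triangle (z - g t) (- (z - g t0))). rewrite Cmod_opp in H1.
    assert (H2 := Hmin t0).
    change ((z - g t) + - (z - g t0))%C with ((z - g t) - (z - g t0))%C in H1.
    apply Rmult_le_reg_l with c; auto.
    replace (c * (2 * / c * Cmod (z - g t0))) with (2 * Cmod (z - g t0)) by (field; lra).
    lra.
  - specialize (Hmin t0). rewrite Eh in Hmin at 1.
    replace (g t + RtoC h * normal g' t - g t)%C with (RtoC h * normal g' t)%C in Hmin by ring.
    rewrite Cmod_mult, Cmod_R, (Cmod_normal g g' T B Hg), Rmult_1_r in Hmin. exact Hmin.
Qed.

End Sides.

(** * Values of the jumps *)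

Lemma fst_RtoC_mult (x : R) (z : C) : fst (RtoC x * z)%C = x * fst z.
Proof. simpl. ring. Qed.

Lemma snd_RtoC_mult (x : R) (z : C) : snd (RtoC x * z)%C = x * snd z.
Proof. simpl. ring. Qed.

Section JumpValues.

Variables (eps1 eps2 : C) (g' w : R -> C) (t : R) (f : C).
Hypothesis Him1 : 0 < Im eps1.
Hypothesis Him2 : 0 < Im eps2.
Hypothesis Hreg : g' t <> 0.
Hypothesis Hw : w t = (f * RtoC (Cmod (g' t)))%C.

Let a1 := sqrt_cut eps1.
Let a2 := sqrt_cut eps2.
Let L1 := linmap a1 (Ci * a2).
Let L2 := linmap a1 (- Ci * a2).
Let N := normal g' t.
Let U : C := (snd N, - fst N).

Lemma tangent_eq : g' t = (RtoC (Cmod (g' t)) * U)%C.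
Proof.
  assert (Hp : Cmod (g' t) <> 0) by (apply Rgt_not_eq, Cmod_gt_0; exact Hreg).
  assert (E : U = (- Ci * N)%C).
  { unfold U. apply injective_projections; simpl; ring. }
  rewrite E. unfold N, normal.
  replace (RtoC (Cmod (g' t)) * (- Ci * (Ci * g' t / RtoC (Cmod (g' t)))))%C
    with (- (Ci * Ci) * g' t)%C by (field; now apply RtoC_neq_0).
  rewrite Ci_sqr. ring.
Qed.

Lemma tangent_neq_0 : U <> 0.
Proof. intros E. apply Hreg. rewrite tangent_eq, E. ring. Qed.

(** In the plane U is N rotated by a right angle, which exchanges the squared coordinates: N1^2 /
    eps1 + N2^2 / eps2 = (eps1 U1^2 + eps2 U2^2) / (eps1 eps2). *)
Lemma normal_conormal (sigma : R) : sigma = 1 \/ sigma = -1 ->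
  dotC (RtoC sigma * N)%C (conormal eps1 eps2 (RtoC sigma * N)%C)
    = (quad eps1 eps2 U / (eps1 * eps2))%C.
Proof.
  intros Hs. assert (Hss : (RtoC sigma * RtoC sigma)%C = 1).
  { rewrite <- RtoC_mult. f_equal. destruct Hs as [-> | ->]; ring. }
  assert (E1 : eps1 <> 0) by (intros E; rewrite E in Him1; simpl in Him1; lra).
  assert (E2 : eps2 <> 0) by (intros E; rewrite E in Him2; simpl in Him2; lra).
  unfold dotC, conormal, quad, U. cbn [fst snd pow].
  rewrite fst_RtoC_mult, snd_RtoC_mult.
  rewrite !Rmult_1_r, !RtoC_mult, !RtoC_opp.
  set (x := RtoC (fst N)). set (y := RtoC (snd N)).
  replace (RtoC sigma * x * (RtoC sigma * x / eps1) + RtoC sigma * y * (RtoC sigma * y / eps2))%C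
    with ((RtoC sigma * RtoC sigma) * (x * x / eps1 + y * y / eps2))%C by (field; auto).
  rewrite Hss. field. auto.
Qed.

(** The speed in [w t] cancels the one in L(g' t) = |g' t| L(U), so the jump depends only on the
    direction of the tangent. *)
Lemma half_jump_common (p q : C) :
  half_jump g' w a1 (Ci * a2) a1 (- Ci * a2)
    (sing_coef eps1 eps2 p) (sing_coef eps1 eps2 q) t =
  (f * Ci / RtoC 4 * a1 * a2 * (p * L2 U - q * L1 U) / quad eps1 eps2 U)%C.
Proof.
  assert (HU := tangent_neq_0).
  assert (H1 : L1 U <> 0).
  { apply linmap_neq_0; auto. apply Rgt_not_eq, cross_plus; auto. }
  assert (H2 : L2 U <> 0).
  { apply linmap_neq_0; auto. apply Rlt_not_eq, cross_minus; auto. }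
  assert (Hp : Cmod (g' t) <> 0) by (apply Rgt_not_eq, Cmod_gt_0; exact Hreg).
  assert (Hpi : RtoC PI <> 0) by (apply RtoC_neq_0, PI_neq0).
  assert (Hgt : forall p q, linmap p q (g' t) = (RtoC (Cmod (g' t)) * linmap p q U)%C).
  { intros p' q'. rewrite <- linmap_hom. f_equal. exact tangent_eq. }
  unfold half_jump. rewrite Hw, !Hgt. fold L1 L2.
  rewrite (quad_factor eps1 eps2 Him1 Him2). fold a1 a2. fold L1 L2.
  unfold sing_coef. fold a1 a2. rewrite RtoC_mult.
  assert (Hm : RtoC (Cmod (g' t)) <> 0) by now apply RtoC_neq_0.
  field. repeat split; auto.
Qed.

(** The numerator p L-(U) - q L+(U) collapses to 2 i a1 a2 times a coordinate of N. The factors i i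
    and a1^2 a2^2 = eps1 eps2 then produce the minus sign and the denominator nu . A nu. *)
Lemma half_jump_value (sigma : R) : sigma = 1 \/ sigma = -1 ->
  (RtoC sigma * half_jump g' w a1 (Ci * a2) a1 (- Ci * a2)
    (sing_coef eps1 eps2 a1) (sing_coef eps1 eps2 a1) t)%C
  = (- (RtoC (1 / 2) * f) * fst (e_vec eps1 eps2 (RtoC sigma * N)))%C /\
  (RtoC sigma * half_jump g' w a1 (Ci * a2) a1 (- Ci * a2)
    (sing_coef eps1 eps2 (Ci * a2)) (sing_coef eps1 eps2 (- Ci * a2)) t)%C
  = (- (RtoC (1 / 2) * f) * snd (e_vec eps1 eps2 (RtoC sigma * N)))%C.
Proof.
  intros Hs. unfold e_vec. cbn [fst snd].
  rewrite normal_conormal by auto. rewrite !half_jump_common.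
  assert (Hq : quad eps1 eps2 U <> 0) by (apply quad_neq_0; auto; apply tangent_neq_0).
  assert (E1 : eps1 <> 0) by (intros E; rewrite E in Him1; simpl in Him1; lra).
  assert (E2 : eps2 <> 0) by (intros E; rewrite E in Him2; simpl in Him2; lra).
  assert (H4 : RtoC 4 = (RtoC 2 * RtoC 2)%C) by (rewrite <- RtoC_mult; f_equal; ring).
  assert (Hh : RtoC (1 / 2) = (1 / RtoC 2)%C) by (rewrite RtoC_div; auto; lra).
  set (Q := quad eps1 eps2 U) in *.
  rewrite fst_RtoC_mult, snd_RtoC_mult, !RtoC_mult.
  rewrite <- (sqrt_cut_sqr eps1 Him1), <- (sqrt_cut_sqr eps2 Him2).
  fold a1 a2. rewrite <- (sqrt_cut_sqr eps1 Him1) in E1. rewrite <- (sqrt_cut_sqr eps2 Him2) in E2.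
  fold a1 in E1. fold a2 in E2.
  assert (A1 : a1 <> 0) by (intros E; apply E1; rewrite E; ring).
  assert (A2 : a2 <> 0) by (intros E; apply E2; rewrite E; ring).
  unfold L1, L2, linmap, U. cbn [fst snd]. rewrite RtoC_opp.
  set (x := RtoC (fst N)). set (y := RtoC (snd N)). rewrite H4, Hh. clearbody Q x y.
  split.
  - replace (a1 * (a1 * y + - Ci * a2 * - x) - a1 * (a1 * y + Ci * a2 * - x))%C
      with (RtoC 2 * Ci * a1 * a2 * x)%C by ring.
    replace (f * Ci / (RtoC 2 * RtoC 2) * a1 * a2 * (RtoC 2 * Ci * a1 * a2 * x) / Q)%C
      with ((Ci * Ci) * (f / RtoC 2 * a1 * a2 * (a1 * a2 * x) / Q))%C by (field; auto).
    rewrite Ci_sqr. field. auto.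
  - replace (Ci * a2 * (a1 * y + - Ci * a2 * - x) - - Ci * a2 * (a1 * y + Ci * a2 * - x))%C
      with (RtoC 2 * Ci * a1 * a2 * y)%C by ring.
    replace (f * Ci / (RtoC 2 * RtoC 2) * a1 * a2 * (RtoC 2 * Ci * a1 * a2 * y) / Q)%C
      with ((Ci * Ci) * (f / RtoC 2 * a1 * a2 * (a1 * a2 * y) / Q))%C by (field; auto).
    rewrite Ci_sqr. field. auto.
Qed.

End JumpValues.

(** * Extension of the gradient up to the boundary and its limiting values *)

Lemma filterlim_pair_Cmod {A : Type} (F : (A -> Prop) -> Prop) {FF : Filter F}
  (f : A -> C * C) (l : C * C) :
  (forall e, 0 < e -> F (fun y => Cmod (fst (f y) - fst l)%C < e /\ Cmod (snd (f y) - snd l)%C < e)) ->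
  filterlim f F (locally l).
Proof.
  intros H. apply filterlim_locally. intros e.
  generalize (H e (cond_pos e)). apply filter_imp. intros y [H1 H2].
  split; now apply C_ball_Cmod.
Qed.

Theorem lemma2p3
  (k0 : R) (eps1 eps2 : C)
  (Omega : R * R -> Prop) (gamma : R -> R * R) (T : R)
  (nu : R * R -> R * R) (phi : R * R -> C)
  (Hk0 : 0 < k0)
  (Hre : Re eps1 * Re eps2 < 0)
  (Him1 : 0 < Im eps1) (Him2 : 0 < Im eps2)
  (HOmega : bounded_simply_connected_domain Omega)
  (HGamma : C2_closed_curve (frontier Omega) gamma T)
  (Hnu : forall x, frontier Omega x -> outward_unit_normal Omega gamma x (nu x))
  (Hphi : C1_on_curve gamma phi) :
  let v := single_layer k0 eps1 eps2 gamma T phi in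
  (forall x, ~ frontier Omega x -> differentiable_at v x) /\
  exists grad_int grad_ext : R * R -> C * C,
    continuous_on (closure2 Omega) grad_int /\
    (forall x, Omega x -> grad_int x = grad v x) /\
    continuous_on (fun x => ~ Omega x) grad_ext /\
    (forall x, ~ closure2 Omega x -> grad_ext x = grad v x) /\
    forall x, frontier Omega x ->
      filterlim (fun h => grad v (shift x h (nu x)))
        (at_right 0) (locally (grad_ext x)) /\
      filterlim (fun h => grad v (shift x (- h) (nu x)))
        (at_right 0) (locally (grad_int x)) /\
      exists pv : C * C,
        is_pv_grad_single_layer k0 eps1 eps2 gamma T phi x pv /\
        grad_ext x =
          addC2 pv (scalC2 (- (RtoC (1 / 2) * phi x))%C
                      (e_vec eps1 eps2 (nu x))) /\
        grad_int x =
          addC2 pv (scalC2 (RtoC (1 / 2) * phi x)%C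
                      (e_vec eps1 eps2 (nu x))).
Proof.
  intros v.
  assert (Hopen : open Omega) by apply HOmega.
  assert (Hfr : forall x, frontier Omega x <-> exists t, gamma t = x) by apply HGamma.
  destruct (C2_closed_curve_regular _ _ _ HGamma) as [g' [B [Hg Hvel]]].
  destruct (density_regular gamma g' T B phi Hg Hphi) as [Wb [Wl [Hwb [Hwl Hwp]]]].
  set (w := fun s => (phi (gamma s) * RtoC (Cmod (g' s)))%C) in *.
  assert (Hwc := density_continuous w Wl Hwl).
  destruct (sides Omega gamma g' T B nu Hg Hopen Hfr Hvel Hnu) as [h1 [sigma [Hh1 [Hsg Hside]]]].
  set (K1 := grad_kernel1 k0 eps1 eps2). set (K2 := grad_kernel2 k0 eps1 eps2).
  assert (HKc : forall X : C, X <> 0 -> continuous (kernel k0 eps1 eps2) X).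
  { intros X HX. apply (continuous_kernel k0 eps1 eps2 Hk0 Him1 Him2 (fun Y => Y)); auto.
    apply continuous_id. }
  assert (HK1c : forall X : C, X <> 0 -> continuous K1 X).
  { intros X HX. apply (continuous_grad_kernel k0 eps1 eps2 Him1 Him2 eps1 fst); auto.
    apply continuous_fst. }
  assert (HK2c : forall X : C, X <> 0 -> continuous K2 X).
  { intros X HX. apply (continuous_grad_kernel k0 eps1 eps2 Him1 Him2 eps2 snd); auto.
    apply continuous_snd. }
  set (S1 := potential gamma T w K1). set (S2 := potential gamma T w K2).
  assert (Hoff : forall x : R * R, ~ frontier Omega x -> forall s, x <> gamma s).
  { intros x Hx s E. apply Hx, Hfr. now exists s. }
  assert (Hv : forall x, v x = potential gamma T w (kernel k0 eps1 eps2) x).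
  { intros x. unfold v, single_layer, curve_RInt, potential.
    apply (@RInt_ext C_R_CompleteNormedModule). intros s _. unfold curve_integrand, speed.
    rewrite Hvel, norm2_Cmod, Phi_kernel. unfold w.
    match goal with |- @eq _ ?a ?b => change (@eq C a b) end. ring. }
  assert (Hgrad : forall x : R * R, (forall s, x <> gamma s) ->
            differentiable_at v x /\ grad v x = (S1 x, S2 x)).
  { intros x Hx. apply frechet_grad. intros e He.
    destruct (potential_differentiable gamma g' T B Hg w Wb Hwb Hwc (kernel k0 eps1 eps2) K1 K2
      HKc HK1c HK2c (is_Cderive_kernel k0 eps1 eps2 Hk0 Him1 Him2) x Hx e He) as [d [Hd H]].
    exists d. split; auto. intros h Hh. rewrite !Hv. now apply H. }
  split.
  { intros x Hx. now apply Hgrad, Hoff. }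
  destruct (scalar_jump gamma g' T B Hg w Wb Wl Hwb Hwl Hwp
    (sqrt_cut eps1) (Ci * sqrt_cut eps2)%C (sqrt_cut eps1) (- Ci * sqrt_cut eps2)%C
    (sing_coef eps1 eps2 (sqrt_cut eps1)) (sing_coef eps1 eps2 (sqrt_cut eps1))
    (cross_plus eps1 eps2 Him1 Him2) (cross_minus eps1 eps2 Him1 Him2) K1 HK1c
    (grad_kernel1_remainder k0 eps1 eps2 Hre Him1 Him2)) as [P1 [PV1 J1]].
  destruct (scalar_jump gamma g' T B Hg w Wb Wl Hwb Hwl Hwp
    (sqrt_cut eps1) (Ci * sqrt_cut eps2)%C (sqrt_cut eps1) (- Ci * sqrt_cut eps2)%C
    (sing_coef eps1 eps2 (Ci * sqrt_cut eps2)%C) (sing_coef eps1 eps2 (- Ci * sqrt_cut eps2)%C)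
    (cross_plus eps1 eps2 Him1 Him2) (cross_minus eps1 eps2 Him1 Him2) K2 HK2c
    (grad_kernel2_remainder k0 eps1 eps2 Hre Him1 Him2)) as [P2 [PV2 J2]].
  set (D1 := half_jump g' w (sqrt_cut eps1) (Ci * sqrt_cut eps2) (sqrt_cut eps1) (- Ci * sqrt_cut eps2)
    (sing_coef eps1 eps2 (sqrt_cut eps1)) (sing_coef eps1 eps2 (sqrt_cut eps1))) in *.
  set (D2 := half_jump g' w (sqrt_cut eps1) (Ci * sqrt_cut eps2) (sqrt_cut eps1) (- Ci * sqrt_cut eps2)
    (sing_coef eps1 eps2 (Ci * sqrt_cut eps2)%C) (sing_coef eps1 eps2 (- Ci * sqrt_cut eps2)%C)) in *.
  fold S1 in J1. fold S2 in J2.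
  set (z := fun t h => (gamma t + RtoC h * normal g' t)%C) in *.
  (* [bv s t] is the limit at [gamma t] from the side s h > 0, and [ext s] extends the gradient by
     it. The exterior will be s = sigma, the interior s = - sigma; [foot] chooses some parameter of
     a boundary point. *)
  set (bv := fun s t => (P1 t + RtoC s * D1 t, P2 t + RtoC s * D2 t)%C).
  set (foot := fun x : R * R => epsilon (inhabits 0) (fun t => gamma t = x)).
  set (ext := fun s (x : R * R) =>
    if excluded_middle_informative (frontier Omega x) then bv s (foot x) else grad v x).
  assert (Hfoot : forall t, gamma (foot (gamma t)) = gamma t).
  { intros t. apply (epsilon_spec (inhabits 0) (fun s => gamma s = gamma t)). now exists t. }
  assert (Hgp' := curve_deriv_periodic gamma g' T B Hg).
  (* Independence of the chosen parameter: two parameters of a point differ by a multiple of T, and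
     the principal values agree by uniqueness. *)
  assert (Hext_fr : forall s t, ext s (gamma t) = bv s t).
  { intros s t. unfold ext. destruct (excluded_middle_informative _) as [_|Hn].
    2:{ exfalso. apply Hn, Hfr. now exists t. }
    assert (E := Hfoot t). set (t' := foot (gamma t)) in *.
    destruct (curve_inj gamma g' T B Hg t' t E) as [k Hk].
    assert (EP1 : P1 t' = P1 t).
    { apply (is_curve_pv_unique gamma w T K1 (gamma t)); auto. rewrite <- E. apply PV1. }
    assert (EP2 : P2 t' = P2 t).
    { apply (is_curve_pv_unique gamma w T K2 (gamma t)); auto. rewrite <- E. apply PV2. }
    assert (Eg : g' t' = g' t) by (rewrite Hk; now apply periodic_Z).
    assert (Ew : w t' = w t) by (rewrite Hk; now apply periodic_Z).
    unfold bv, D1, D2, half_jump. now rewrite EP1, EP2, Eg, Ew. }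
  assert (Hext_off : forall s x, (forall u, x <> gamma u) -> ext s x = grad v x).
  { intros s x Hx. unfold ext. destruct (excluded_middle_informative _) as [Hf|_]; auto.
    apply Hfr in Hf. destruct Hf as [u Hu]. exfalso. now apply (Hx u). }
  assert (Hlim : forall s t0 e, s = 1 \/ s = -1 -> 0 < e -> exists d, 0 < d <= h1 /\
    forall t h, Rabs (t - t0) < d -> Rabs h < d -> 0 <= s * h ->
      Cmod (fst (ext s (z t h)) - fst (bv s t0))%C < e /\
      Cmod (snd (ext s (z t h)) - snd (bv s t0))%C < e).
  { intros s t0 e Hs He. assert (He2 : 0 < e / 2) by lra.
    assert (Hnear : forall t1 e1, 0 < e1 -> exists d, 0 < d <= h1 /\
      forall t h, Rabs (t - t1) < d -> Rabs h < d -> 0 < s * h ->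
        Cmod (fst (ext s (z t h)) - fst (bv s t1))%C < e1 /\
        Cmod (snd (ext s (z t h)) - snd (bv s t1))%C < e1).
    { intros t1 e1 He1.
      destruct (J1 s t1 e1 Hs He1) as [d1 [Hd1 B1]]. destruct (J2 s t1 e1 Hs He1) as [d2 [Hd2 B2]].
      exists (Rmin h1 (Rmin d1 d2)). split; [split; [repeat apply Rmin_pos; auto | apply Rmin_l]|].
      intros t h Ht Hh Hsh.
      assert (Ht' := Rlt_le_trans _ _ _ Ht (Rmin_r _ _)).
      assert (Hh' := Rlt_le_trans _ _ _ Hh (Rmin_r _ _)).
      assert (Hh'' := Rlt_le_trans _ _ _ Hh (Rmin_l _ _)).
      assert (m1 := Rmin_l d1 d2). assert (m2 := Rmin_r d1 d2).
      assert (Hh0 : 0 < Rabs h).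
      { apply Rabs_pos_lt. intros ->. lra. }
      assert (Hz : forall u, z t h <> gamma u) by (apply (Hside t); lra).
      rewrite Hext_off by auto. rewrite (proj2 (Hgrad _ Hz)).
      split; [apply B1 | apply B2]; auto; lra. }
    destruct (Hnear t0 (e / 2) He2) as [d [Hd Hb]].
    exists d. split; auto. intros t h Ht Hh [Hsh|Hsh].
    - destruct (Hb t h Ht Hh Hsh). lra.
    (* Boundary points are compared through a common point at a small height [k] on the normal at
       [t]: its value is close to [bv s t0] and also to [bv s t]. *)
    - assert (Eh : h = 0).
      { symmetry in Hsh. apply Rmult_integral in Hsh. destruct Hs as [-> | ->]; lra. }
      subst h. assert (Ez : z t 0 = gamma t) by (unfold z; ring). rewrite Ez, Hext_fr.
      destruct (Hnear t (e / 2) He2) as [d' [Hd' Hb']].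
      set (k := s * (Rmin d d' / 2)).
      assert (Hm : 0 < Rmin d d') by (apply Rmin_pos; lra).
      assert (m1 := Rmin_l d d'). assert (m2 := Rmin_r d d').
      assert (Hk : Rabs k = Rmin d d' / 2).
      { unfold k. rewrite Rabs_mult, (Rabs_pos_eq (Rmin d d' / 2)) by lra.
        destruct Hs as [-> | ->]; [rewrite Rabs_R1 | rewrite (Rabs_left (-1)) by lra]; ring. }
      assert (Hsk : 0 < s * k).
      { unfold k. destruct Hs as [-> | ->]; lra. }
      destruct (Hb t k Ht ltac:(lra) Hsk) as [X1 X2].
      destruct (Hb' t k ltac:(rewrite Rminus_diag, Rabs_R0; lra) ltac:(lra) Hsk) as [Y1 Y2].
      assert (Htri : forall p q r : C, Cmod (p - q)%C < e / 2 -> Cmod (p - r)%C < e / 2 ->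
                Cmod (r - q)%C < e).
      { intros p q r A1 A2. replace (r - q)%C with ((p - q) - (p - r))%C by ring.
        eapply Rle_lt_trans; [apply Cmod_triangle|]. rewrite Cmod_opp. lra. }
      split; [apply (Htri _ _ _ X1 Y1) | apply (Htri _ _ _ X2 Y2)]. }
  (* The condition says that near the curve [D] stays on side [s]; it covers both the closure of the
     domain and the complement of the domain. *)
  assert (Hcont : forall s (D : R * R -> Prop), s = 1 \/ s = -1 ->
    (forall t h, 0 < Rabs h <= h1 -> D (z t h) -> 0 < s * h) ->
    continuous_on D (ext s)).
  { intros s D Hs HD x Dx. apply filterlim_pair_Cmod; [apply _|]. intros e He.
    destruct (classic (exists t, gamma t = x)) as [[t0 Ht0]|Hx].
    - subst x. rewrite Hext_fr.
      destruct (Hlim s t0 e Hs He) as [d [Hd Hb]].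
      destruct (normal_coordinates gamma g' T B Hg t0) as [C0 [HC0 Hcoord]].
      assert (Hr : 0 < Rmin d (d / C0) / 2).
      { assert (0 < Rmin d (d / C0)) by (apply Rmin_pos; [lra | apply Rdiv_lt_0_compat; lra]). lra. }
      exists (mkposreal _ Hr). intros y Hy Dy. apply Cmod_C_ball in Hy. simpl in Hy.
      destruct (Hcoord y) as [t [h [Ey [Bt Bh]]]]. change (y = z t h) in Ey.
      assert (m1 := Rmin_l d (d / C0)). assert (m2 := Rmin_r d (d / C0)).
      assert (Hyd : Cmod (y - gamma t0)%C < d / C0) by lra.
      rewrite Ey. apply Hb.
      + eapply Rle_lt_trans; [exact Bt|]. apply (Rmult_lt_compat_l C0) in Hyd; auto.
        replace (C0 * (d / C0)) with d in Hyd by (field; lra). exact Hyd.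
      + lra.
      + destruct (Req_dec h 0) as [->|Hh0]; [lra|]. left. apply (HD t h).
        * split; [now apply Rabs_pos_lt | lra].
        * now rewrite <- Ey.
    - assert (Hx' : forall u, x <> gamma u) by (intros u E; apply Hx; now exists u).
      destruct (off_curve_open gamma g' T B Hg x Hx') as [d [Hd Ho]].
      assert (Cs1 := potential_continuous gamma g' T B Hg w Wb Hwb Hwc K1 x HK1c Hx').
      assert (Cs2 := potential_continuous gamma g' T B Hg w Wb Hwb Hwc K2 x HK2c Hx').
      assert (Hd2 : 0 < d / 2) by lra.
      assert (Hl : locally x (fun y : R * R => forall u, y <> gamma u)).
      { exists (mkposreal _ Hd2). intros y Hy. apply Cmod_C_ball in Hy. simpl in Hy.
        apply Ho. lra. }
      apply filter_imp with (2 := filter_and _ _ Hl (filter_and _ _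
        (proj1 (continuous_Cmod_lt _ _) Cs1 e He) (proj1 (continuous_Cmod_lt _ _) Cs2 e He))).
      intros y [Hy [Y1 Y2]] _. rewrite !Hext_off by auto.
      rewrite (proj2 (Hgrad x Hx')), (proj2 (Hgrad y Hy)). split; [exact Y1 | exact Y2]. }
  assert (Hsg' : - sigma = 1 \/ - sigma = -1) by (destruct Hsg as [-> | ->]; [right | left]; lra).
  exists (ext (- sigma)), (ext sigma).
  split.
  { apply Hcont; auto. intros t h Hh Hc. apply Rnot_le_lt. intros Hle.
    destruct (Hside t) as [_ Hst]. destruct (Hst h Hh) as [Hz [HO HE]].
    destruct (closure_frontier _ _ Hc) as [H|H].
    - apply HO in H. lra.
    - apply Hfr in H. destruct H as [u Hu]. now apply (Hz u). }
  split.
  { intros x Hx. apply Hext_off, Hoff. now apply open_closure_frontier. }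
  split.
  { apply Hcont; auto. intros t h Hh Hc.
    destruct (Hside t) as [_ Hst]. destruct (Hst h Hh) as [Hz [HO HE]]. apply HE.
    intros H. destruct (closure_frontier _ _ H) as [H'|H']; auto.
    apply Hfr in H'. destruct H' as [u Hu]. now apply (Hz u). }
  split.
  { intros x Hx. apply Hext_off, Hoff. intros [H _]. now apply Hx. }
  intros x Hx. destruct (proj1 (Hfr x) Hx) as [t Ht]. subst x.
  destruct (Hside t) as [En Hst]. rewrite !Hext_fr.
  assert (Hshift : forall h, shift (gamma t) h (nu (gamma t)) = z t (sigma * h)).
  { intros h. rewrite En. unfold z, shift. apply injective_projections; simpl; ring. }
  assert (Hnormal : forall s, s = sigma \/ s = - sigma ->
     filterlim (fun h => grad v (z t (s * h))) (at_right 0) (locally (bv s t))).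
  { intros s Hs. assert (Hs1 : s = 1 \/ s = -1) by (destruct Hs as [-> | ->]; auto).
    apply filterlim_pair_Cmod; [apply _|]. intros e He.
    destruct (Hlim s t e Hs1 He) as [d [Hd Hb]].
    generalize (at_right_0_lt d ltac:(lra)). apply filter_imp. intros h Hh.
    assert (Hah : Rabs (s * h) = h).
    { rewrite Rabs_mult, (Rabs_pos_eq h) by lra.
      destruct Hs1 as [-> | ->]; [rewrite Rabs_R1 | rewrite (Rabs_left (-1)) by lra]; ring. }
    assert (Hz : forall u, z t (s * h) <> gamma u) by (apply Hst; rewrite Hah; lra).
    rewrite <- (Hext_off s) by auto. apply Hb.
    - rewrite Rminus_diag, Rabs_R0. lra.
    - rewrite Hah. lra.
    - rewrite <- Rmult_assoc. destruct Hs1 as [-> | ->]; lra. }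
  split.
  { apply filterlim_ext with (fun h => grad v (z t (sigma * h))).
    - intros h. now rewrite Hshift.
    - apply Hnormal. now left. }
  split.
  { apply filterlim_ext with (fun h => grad v (z t (- sigma * h))).
    - intros h. rewrite Hshift. do 2 f_equal. ring.
    - apply Hnormal. now right. }
  (* At y = gamma t the gradient of the fundamental solution is only a default value of [Derive];
     the truncation at positive distance removes that point, hence [G] is prescribed only
     elsewhere. *)
  assert (Hpv : forall (K : C -> C) (p : C) (G : R * R -> C),
    (forall y, gamma t <> y -> G y = K (gamma t - y)%C) ->
    is_curve_pv gamma w T K (gamma t) p ->
    is_principal_value gamma T (fun y => G y * phi y)%C (gamma t) p).
  { intros K p G HG [J [HJ HL]]. exists J. split; auto.
    generalize (filter_and _ _ HJ (at_right_0_lt 1 Rlt_0_1)). apply filter_imp.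
    intros d [Hd Hd0]. revert Hd. apply (@is_RInt_ext C_R_NormedModule). intros s _.
    match goal with |- @eq _ ?a ?b => change (@eq C a b) end.
    unfold curve_integrand, cut_off, speed. rewrite Hvel, !norm2_Cmod.
    change (sub2 (gamma s) (gamma t)) with (Cminus (gamma s) (gamma t)).
    destruct (Rlt_dec d (Cmod (gamma s - gamma t)%C)) as [Hlt|_]; [|ring].
    rewrite HG.
    - unfold w. ring.
    - intros E. rewrite E in Hlt.
      replace (gamma s - gamma s)%C with (RtoC 0) in Hlt by ring. rewrite Cmod_0 in Hlt. lra. }
  assert (Hreg : g' t <> 0) by apply (curve_deriv_neq_0 _ _ _ _ Hg).
  (* Computed for the exterior sign [sigma]; the interior value is its opposite, because the jump
     enters linearly in the sign. *)
  destruct (half_jump_value eps1 eps2 g' w t (phi (gamma t)) Him1 Him2 Hreg eq_refl sigma Hsg)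
    as [V1 V2].
  fold D1 in V1. fold D2 in V2. rewrite <- En in V1, V2.
  exists (P1 t, P2 t). split; [split|split].
  - apply (Hpv K1); [|apply PV1]. intros y Hy. now rewrite grad_Phi.
  - apply (Hpv K2); [|apply PV2]. intros y Hy. now rewrite grad_Phi.
  - unfold bv, addC2, scalC2. cbn [fst snd]. now rewrite V1, V2.
  - unfold bv, addC2, scalC2. cbn [fst snd].
    rewrite RtoC_opp. f_equal.
    + replace (- RtoC sigma * D1 t)%C with (- (RtoC sigma * D1 t))%C by ring. rewrite V1. ring.
    + replace (- RtoC sigma * D2 t)%C with (- (RtoC sigma * D2 t))%C by ring. rewrite V2. ring.
Qed.
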